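(* Let $(X,d,f)$ be a topological dynamical system (TDS), i.e. $(X,d)$ is a compact metric space and $f:X\to X$ is continuous. Assume $(X,f)$ is topologically transitive and has the pseudo-orbit tracing property. If $U$ is a nonempty open subset of $\mathscr M_{\rm inv}(X,f)$ (with the weak* topology), then \[ h^B_{\rm top}(\Delta_{sub}(U),f)=h^B_{\rm top}(\Delta_{cap}(U),f)=\sup_{\nu\in U}h_\nu(f). \]
   Context: $\mathscr M_{\rm inv}(X,f)$ is the set of $f$-invariant Borel probability measures on $X$ with the weak* topology; $h_\nu(f)$ is the measure-theoretic entropy. For $x\in X$ and $n\in\mathbb N$, $\mathscr E_n(x)=\frac1n\sum_{i=0}^{n-1}\delta_{f^ix}$, and $V(x)$ is the set of weak* limit points of the sequence $(\mathscr E_n(x))_n$. For $I\subset\mathscr M_{\rm inv}(X,f)$: $\Delta_{sub}(I)=\{x\in X: V(x)\subset I\}$ and $\Delta_{cap}(I)=\{x\in X: V(x)\cap I\neq\emptyset\}$. $(X,f)$ is topologically transitive if for all nonempty open $U,V\subset X$ there is $n\in\mathbb N$ with $f^n(U)\cap V\ne\emptyset$. A $\delta$-pseudo-orbit is a sequence $(x_i)_{i\ge0}$ with $d(f(x_i),x_{i+1})\le\delta$ for all $i$; $f$ has the pseudo-orbit tracing property if for every $\epsilon>0$ there is $\delta>0$ such that for every $\delta$-pseudo-orbit $(x_i)$ there is $x\in X$ with $d(f^ix,x_i)<\epsilon$ for all $i\ge0$. Bowen topological entropy: let $d_n(x,y)=\max_{0\le i\le n-1}d(f^ix,f^iy)$,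 $B_n(x,\epsilon)=\{y:d_n(x,y)<\epsilon\}$. For $Z\subset X$, $\epsilon>0$, $N\in\mathbb N$, let $\Gamma_N(Z,\epsilon)$ be the set of finite or countable covers of $Z$ by sets $B_n(x,\epsilon)$ with $n\ge N$; for $s\in\mathbb R$ set $m(Z,s,N,\epsilon)=\inf_{\mathcal C\in\Gamma_N(Z,\epsilon)}\sum_{B_n(x,\epsilon)\in\mathcal C}e^{-ns}$, $m(Z,s,\epsilon)=\lim_{N\to\infty}m(Z,s,N,\epsilon)$, $h_{\rm top}(Z,\epsilon)=\inf\{s:m(Z,s,\epsilon)=0\}$, and $h^B_{\rm top}(Z,f)=\lim_{\epsilon\to0}h_{\rm top}(Z,\epsilon)$. *)

(* Defs.v *)
From HB Require Import structures.
From mathcomp Require Import all_boot all_order all_algebra.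
From mathcomp Require Import all_classical all_reals all_analysis.
Set Implicit Arguments.
Unset Strict Implicit.
Unset Printing Implicit Defensive.
Import Order.TTheory GRing.Theory Num.Theory.
Import numFieldTopology.Exports numFieldNormedType.Exports.
Local Open Scope classical_set_scope.
Local Open Scope ring_scope.

(* A metric space (distance [mdist]) whose carrier is given a distinguished
   point; the point is only needed because MathComp-Analysis measurable
   types are pointed.  The spaces considered in the theorem are nonempty
   anyway (they carry invariant probability measures). *)
#[short(type="pointedMetricType")]
HB.structure Definition PointedMetric (K : numDomainType) :=
  {M of Metric K M & Pointed M}.

Section Dyn.
Context {R : realType} {X : pointedMetricType R}.

Definition borel : Type := g_sigma_algebraType (@open X).

Definition Mprob : Type := probability borel R.

Definition integ (mu : Mprob) (g : X -> R) : \bar R :=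
  (\int[mu]_x (g x)%:E)%E.

Definition Minv (f : X -> X) : set Mprob :=
  [set mu : Mprob | forall A : set borel, measurable A ->
     mu (f @^-1` A) = mu A].

(* U is open in M_inv(X,f) for the (subspace topology of the) weak*
   topology: the weak* topology is the coarsest topology making all maps
   mu |-> \int g dmu (g continuous) continuous; its basic neighbourhoods of
   nu are given by finitely many continuous g and an eps > 0. *)
Definition weak_open_inv (f : X -> X) (U : set Mprob) : Prop :=
  U `<=` Minv f /\
  forall nu, U nu ->
    exists (k : nat) (gs : 'I_k -> X -> R) (eps : R),
      (forall j, continuous (gs j)) /\ 0 < eps /\
      forall mu, Minv f mu ->
        (forall j, (`| integ mu (gs j) - integ nu (gs j) | < eps%:E)%E) ->
        U mu.

Definition emp_integ (f : X -> X) (x : X) (n : nat) (g : X -> R) : R :=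
  n%:R^-1 * \sum_(i < n) g (iter i f x).

(* V(x): weak* limit points (cluster points) of (E_n(x))_{n>=1} in M(X). *)
Definition Vlim (f : X -> X) (x : X) : set Mprob :=
  [set nu : Mprob | forall (k : nat) (gs : 'I_k -> X -> R) (eps : R) (N : nat),
     (forall j, continuous (gs j)) -> 0 < eps ->
     exists n : nat, (N <= n)%N /\ (0 < n)%N /\
       forall j, `| emp_integ f x n (gs j) - fine (integ nu (gs j)) | < eps].

Definition Dsub (f : X -> X) (I : set Mprob) : set X :=
  [set x | Vlim f x `<=` I].
Definition Dcap (f : X -> X) (I : set Mprob) : set X :=
  [set x | Vlim f x `&` I !=set0].

Definition top_transitive (f : X -> X) : Prop :=
  forall U V : set X, open U -> open V -> U !=set0 -> V !=set0 ->
    exists n : nat, (0 < n)%N /\ (iter n f @` U) `&` V !=set0.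

Definition pseudo_orbit (f : X -> X) (delta : R) (xs : nat -> X) : Prop :=
  forall i, mdist (f (xs i)) (xs i.+1) <= delta.

Definition tracing_property (f : X -> X) : Prop :=
  forall eps : R, 0 < eps -> exists delta : R, 0 < delta /\
    forall xs, pseudo_orbit f delta xs ->
      exists x : X, forall i, mdist (iter i f x) (xs i) < eps.

Definition is_partition (k : nat) (P : 'I_k -> set X) : Prop :=
  (forall j, measurable (P j : set borel)) /\
  (forall j j', j != j' -> P j `&` P j' = set0) /\
  \bigcup_(j in [set: 'I_k]) P j = setT.

Definition phi (t : R) : R := - (t * ln t).   (* with 0 log 0 = 0 *)

Definition Hpart (nu : Mprob) (k : nat) (P : 'I_k -> set X) : R :=
  \sum_(j < k) phi (fine (nu (P j : set borel))).

Definition Hjoin (f : X -> X) (nu : Mprob) (k : nat) (P : 'I_k -> set X)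
    (n : nat) : R :=
  \sum_(w : {ffun 'I_n -> 'I_k})
     phi (fine (nu (\bigcap_(i in [set: 'I_n]) (iter i f @^-1` P (w i))
                     : set borel))).

Definition hpart (f : X -> X) (nu : Mprob) (k : nat) (P : 'I_k -> set X) : R :=
  limn (fun n => Hjoin f nu P n.+1 / n.+1%:R).

Definition hmeas (f : X -> X) (nu : Mprob) : \bar R :=
  ereal_sup [set e : \bar R | exists (k : nat) (P : 'I_k -> set X),
                 is_partition P /\ e = (hpart f nu P)%:E].

Definition Bball (f : X -> X) (n : nat) (x : X) (eps : R) : set X :=
  [set y | forall i, (i < n)%N -> mdist (iter i f x) (iter i f y) < eps].

(* a finite or countable family of Bowen balls B_n(x,eps), encoded as a
   sequence of optional centres/lengths (None = no ball). *)
Definition cover_ball (f : X -> X) (eps : R) (c : option (X * nat)) : set X :=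
  if c is Some (x, n) then Bball f n x eps else set0.

Definition cover_cost (s : R) (c : option (X * nat)) : \bar R :=
  if c is Some (_, n) then (expR (- (n%:R * s)))%:E else 0%E.

Definition is_cover (f : X -> X) (Z : set X) (N : nat) (eps : R)
    (c : nat -> option (X * nat)) : Prop :=
  (forall i x n, c i = Some (x, n) -> (N <= n)%N) /\
  Z `<=` \bigcup_i cover_ball f eps (c i).

Definition mBowen (f : X -> X) (Z : set X) (s : R) (N : nat) (eps : R)
  : \bar R :=
  ereal_inf [set e : \bar R | exists c, is_cover f Z N eps c /\
                 e = (\sum_(i <oo) cover_cost s (c i))%E].

Definition mBowen_lim (f : X -> X) (Z : set X) (s : R) (eps : R) : \bar R :=
  limn (fun N => mBowen f Z s N eps).

Definition htop_eps (f : X -> X) (Z : set X) (eps : R) : \bar R :=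
  ereal_inf [set e : \bar R | exists s : R,
                 mBowen_lim f Z s eps = 0%E /\ e = s%:E].

Definition hBowen (f : X -> X) (Z : set X) : \bar R :=
  lim (htop_eps f Z eps @[eps --> 0^'+]).

End Dyn.

(* Main.v *)
(* Upper bound. Let mu in V(x) have entropy at most t. A Shannon code for words of some
   length n, whose mean cost under mu is about n t, describes infinitely many initial
   segments of the orbit of x at about n t per n symbols. By Kraft's inequality few
   segments have such a description, so the points described by a given code have small
   Bowen measure, and there are only countably many codes. This bounds the entropy of
   the set of x such that V(x) contains a measure of entropy at most t, and in
   particular that of Delta_cap(U).

   Lower bound. Given nu in U and a partition of entropy larger than s, the method of
   types yields about exp(L h) pseudo-orbit loops of common length L through a fixed
   point, made of orbit segments with the statistics of nu and of connections supplied
   by transitivity. They can be concatenated freely, and points tracing the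
   concatenations have all limit measures in U. The partition is replaced by disjoint
   closed cores of its atoms, so a point follows at most exp(L (h - s)) different
   loops at a small scale, and a mass distribution argument shows that the traced set
   has Bowen entropy at least s. No ergodicity of nu is used. *)
Require Import Defs.
From HB Require Import structures.
From mathcomp Require Import all_boot all_order all_algebra.
From mathcomp Require Import all_classical all_reals all_analysis.
From mathcomp Require Import zify ring lra.
Set Implicit Arguments.
Unset Strict Implicit.
Unset Printing Implicit Defensive.
Import Order.TTheory GRing.Theory Num.Theory.
Import numFieldTopology.Exports numFieldNormedType.Exports.
Local Open Scope classical_set_scope.
Local Open Scope ring_scope.

(** * Metric spaces *)

(** Upper bound: [V(x)] consists of cluster points tested on continuous functions, so no ergodic
    theorem controls the orbit of [x]. The code is built from [nu], its cost is majorised by a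
    continuous function, and this function is averaged up to a time provided by [Vlim]. Such times
    are arbitrarily large, and a Borel-Cantelli sum over the number of code words suffices.

    Lower bound: connections have different lengths, and a single typical word need not have the
    averages of [nu]. Both difficulties vanish when one fixed list of blocks is permuted: the
    length, the sums of the test functions and the number of special letters are then the same for
    all loops. The constants are chosen in the order cores, scale [eps], jump size [delta],
    connection length [M], word length [n], list size about [t], each depending on the previous
    ones, so that connections and rounding errors are negligible.

    The two sets are compared through the nonemptiness of [V(x)]. The cluster measure comes from the
    Riesz representation theorem, which is proved by the outer measure construction. *)

Section MetricBasics.
Context {R : realType} {X : pointedMetricType R}.
Implicit Types (A F G : set X) (g h u : X -> R).

Lemma half_gt0 (e : R) : 0 < e -> 0 < e / 2.
Proof. by move=> e0; rewrite divr_gt0. Qed.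

Lemma mdist_tri (x y z : X) : mdist x z <= mdist x y + mdist y z.
Proof. exact: metric_triangle. Qed.

Lemma mdist_symm (x y : X) : mdist x y = mdist y x.
Proof. exact: metric_sym. Qed.

Lemma open_mdist (x : X) (e : R) : open [set y | mdist x y < e].
Proof.
rewrite openE => y /= xye; apply/metricType_numDomainType.nbhs_mdistP; exists (e - mdist x y) => /=.
  by rewrite subr_gt0.
by move=> z /= yz; rewrite (le_lt_trans (mdist_tri x y z))// -ltrBrDl.
Qed.

Lemma openP_mdist G : open G <->
  forall x, G x -> exists2 e : R, 0 < e & forall y, mdist x y < e -> G y.
Proof.
rewrite openE; split=> H x /H.
  by move=> /metricType_numDomainType.nbhs_mdistP[e /= e0 eG]; exists e.
by move=> [e e0 eG]; apply/metricType_numDomainType.nbhs_mdistP; exists e.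
Qed.

Lemma continuousP_mdist g : continuous g <->
  forall x (e : R), 0 < e -> exists2 d : R, 0 < d &
    forall y, mdist x y < d -> `|g x - g y| < e.
Proof.
split=> H x.
  move=> e e0; have /cvgrPdist_lt/(_ _ e0) := H x.
  by move=> /metricType_numDomainType.nbhs_mdistP[d /= d0 dG]; exists d.
apply/cvgrPdist_lt => e e0; have [d d0 dG] := H x e e0.
by apply/metricType_numDomainType.nbhs_mdistP; exists d.
Qed.

Lemma continuous_mdistP (f : X -> X) : continuous f <->
  forall x (e : R), 0 < e -> exists2 d : R, 0 < d &
    forall y, mdist x y < d -> mdist (f x) (f y) < e.
Proof.
split=> H x.
  move=> e e0; have /metricType_numDomainType.cvgrPdist_lt/(_ _ e0) := H x.
  by move=> /metricType_numDomainType.nbhs_mdistP[d /= d0 dG]; exists d.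
apply/metricType_numDomainType.cvgrPdist_lt => e e0; have [d d0 dG] := H x e e0.
by apply/metricType_numDomainType.nbhs_mdistP; exists d.
Qed.

Lemma continuous_mdist (x : X) : continuous (mdist x).
Proof.
apply/continuousP_mdist => y e e0; exists e => // z yz.
rewrite (le_lt_trans _ yz)// ler_norml.
have := mdist_tri x y z; have := mdist_tri x z y; rewrite (mdist_symm z y).
by move=> ? ?; apply/andP; split; lra.
Qed.

Lemma continuous_iter (f : X -> X) n : continuous f -> continuous (iter n f).
Proof.
move=> fc; elim: n => [|n IH] x /=; first exact: cvg_id.
by apply: continuous_comp; [exact: IH|exact: fc].
Qed.

Hypothesis Xcompact : compact [set: X].

(** The radius may vary with the centre, so this serves both as a choice of a finite net and as the
    subcover in Lebesgue number arguments. *)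
Lemma finite_net (r : X -> R) : (forall x, 0 < r x) ->
  exists s : seq X, forall x, exists2 c, c \in s & mdist c x < r c.
Proof.
move=> r0; move: Xcompact; rewrite compact_cover.
move=> /(_ X setT (fun c => [set y | mdist c y < r c])).
case=> [c _|x _|D _ HD]; first exact: open_mdist.
  by exists x => //=; rewrite mdistxx.
exists (finmap.enum_fset D) => x; have [c Dc xc] := HD x I.
by exists c.
Qed.

Lemma min_seq (T : eqType) (s : seq T) (r : T -> R) : (forall x, 0 < r x) ->
  exists2 d : R, 0 < d & forall c, c \in s -> d <= r c.
Proof.
move=> r0; elim: s => [|c s [d d0 IH]]; first by exists 1.
exists (Num.min d (r c)) => [|c']; first by rewrite lt_min d0 r0.
by rewrite inE ge_min => /orP[/eqP->|/IH->//]; rewrite lexx orbT.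
Qed.

Lemma unif_cont_real g : continuous g -> forall e : R, 0 < e ->
  exists2 d : R, 0 < d & forall x y, mdist x y < d -> `|g x - g y| < e.
Proof.
move=> /continuousP_mdist gc e e0.
have /choice[r Hr] : forall x, exists d : R, 0 < d /\
    forall y, mdist x y < d -> `|g x - g y| < e / 2.
  by move=> x; have [d d0 H] := gc x (e / 2) (half_gt0 e0); exists d.
(* Half radii: a point [d]-close to a point of the half ball around [c] still lies in the full ball,
   where [g] stays within [e / 2] of [g c]. *)
have [s Hs] : exists s : seq X, forall x, exists2 c, c \in s & mdist c x < r c / 2.
  by apply: finite_net => x; rewrite divr_gt0//; case: (Hr x).
have [d d0 Hd] := @min_seq _ s (fun c => r c / 2) (fun c => half_gt0 (Hr c).1).
exists d => // x y xy; have [c cs cx] := Hs x.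
have h1 : `|g c - g x| < e / 2 by apply: (Hr c).2; have := (Hr c).1; lra.
have h2 : `|g c - g y| < e / 2.
  by apply: (Hr c).2; have /= := Hd _ cs; have := mdist_tri c x y; lra.
rewrite (_ : g x - g y = (g c - g y) - (g c - g x)); last by ring.
by rewrite (le_lt_trans (ler_normB _ _))//; lra.
Qed.

Lemma unif_cont (f : X -> X) : continuous f -> forall e : R, 0 < e ->
  exists2 d : R, 0 < d & forall x y, mdist x y < d -> mdist (f x) (f y) < e.
Proof.
move=> /continuous_mdistP gc e e0.
have /choice[r Hr] : forall x, exists d : R, 0 < d /\
    forall y, mdist x y < d -> mdist (f x) (f y) < e / 2.
  by move=> x; have [d d0 H] := gc x (e / 2) (half_gt0 e0); exists d.
have [s Hs] : exists s : seq X, forall x, exists2 c, c \in s & mdist c x < r c / 2.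
  by apply: finite_net => x; rewrite divr_gt0//; case: (Hr x).
have [d d0 Hd] := @min_seq _ s (fun c => r c / 2) (fun c => half_gt0 (Hr c).1).
exists d => // x y xy; have [c cs cx] := Hs x.
have h1 : mdist (f c) (f x) < e / 2 by apply: (Hr c).2; have := (Hr c).1; lra.
have h2 : mdist (f c) (f y) < e / 2.
  by apply: (Hr c).2; have /= := Hd _ cs; have := mdist_tri c x y; lra.
by have := mdist_tri (f x) (f c) (f y); rewrite (mdist_symm (f x) (f c)); lra.
Qed.

Lemma unif_cont_iter (f : X -> X) n : continuous f -> forall e : R, 0 < e ->
  exists2 d : R, 0 < d & forall x y, mdist x y < d ->
    forall i, (i < n)%N -> mdist (iter i f x) (iter i f y) < e.
Proof.
move=> fc e e0; elim: n => [|n [d d0 IH]]; first by exists 1.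
have [d' d'0 H] := unif_cont (continuous_iter (n := n) fc) e0.
exists (Num.min d d'); first by rewrite lt_min d0.
move=> x y; rewrite lt_min => /andP[xd xd'] i; rewrite ltnS leq_eqVlt.
by move=> /predU1P[->|]; [exact: H|exact: IH].
Qed.

Lemma continuous_bounded g : continuous g ->
  exists2 B : R, 0 < B & forall x, `|g x| <= B.
Proof.
move=> /continuousP_mdist gc.
have /choice[r Hr] : forall x, exists d : R, 0 < d /\
    forall y, mdist x y < d -> `|g x - g y| < 1.
  by move=> x; have [d d0 H] := gc x 1 ltr01; exists d.
have [s Hs] := finite_net (fun x => (Hr x).1).
exists (1 + \sum_(c <- s) `|g c|).
  by rewrite ltr_wpDr// sumr_ge0.
move=> x; have [c cs /(Hr c).2 cx] := Hs x.
have : `|g c| <= \sum_(c <- s) `|g c|.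
  by rewrite (big_rem c)//= lerDl sumr_ge0.
have := lerB_dist (g x) (g c); rewrite distrC; lra.
Qed.

Lemma urysohn_fun F G : closed F -> open G -> F `<=` G ->
  exists u : X -> R, [/\ continuous u, forall x, 0 <= u x <= 1,
    forall x, F x -> u x = 1 & forall x, ~ G x -> u x = 0].
Proof.
move=> cF oG FG.
have nX : normal_space X.
  by apply: compact_normal => //; exact: metric_hausdorff.
have [] := @urysohn_ext_itv X R nX (~` G) F 0 1.
- exact: open_closedC.
- exact: cF.
- by apply/disjoints_subset => x /= nGx Fx; apply: nGx; apply: FG.
- exact: ltr01.
move=> u [cu u0 u1 ur]; exists u; split=> //.
- by move=> x; have := ur (u x); rewrite /= in_itv/=; apply; exists x.
- by move=> x Fx; apply: u1; exists x.
- by move=> x Fx; apply: u0; exists x.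
Qed.

(** A Urysohn function drops from 1 to 0 between the two sets, and its uniform continuity forbids
    this over short distances. *)
Lemma closed_disjoint_dist F G : closed F -> closed G -> F `&` G = set0 ->
  exists2 d : R, 0 < d & forall x y, F x -> G y -> d <= mdist x y.
Proof.
move=> cF cG FG.
have [|u [cu u01 u1 u0]] := @urysohn_fun F (~` G) cF (closed_openC cG).
  by apply/disjoints_subset.
have [d d0 H] := unif_cont_real cu (@ltr01 R).
exists d => // x y Fx Gy; rewrite leNgt; apply/negP => /H.
by rewrite (u1 _ Fx) (u0 y)/= ?subr0 ?normr1 ?ltxx//; exact.
Qed.

End MetricBasics.

(** * Borel probability measures *)

Section BorelProb.
Context {R : realType} {X : pointedMetricType R}.
Local Notation bX := (@borel R X).
Local Notation Mp := (@Mprob R X).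
Implicit Types (A F G : set X) (g h u : X -> R) (mu nu : Mp).

Definition bmeas (A : set X) : Prop := measurable (A : set bX).

Definition pr mu (A : set X) : R := fine (mu (A : set bX)).

Definition Rint mu g : R := fine (integ mu g).

Definition bmeasf g : Prop := measurable_fun [set: bX] (g : bX -> R).

Definition bint mu g : Prop := mu.-integrable [set: bX] (EFin \o (g : bX -> R)).

Section mk_prob.
Variable m : set bX -> \bar R.
Hypotheses (m0 : m set0 = 0%E) (mge0 : forall A, (0 <= m A)%E)
  (mS : semi_sigma_additive m) (mT : m setT = 1%E).

(** The proofs are arguments of the name, so that the measure structures declared on it below can
    refer to them. *)
Definition mk_prob_fun (_ : semi_sigma_additive m) (_ : m setT = 1%E)
  (_ : forall A, (0 <= m A)%E) (_ : m set0 = 0%E) : set bX -> \bar R := m.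

HB.instance Definition _ := isMeasure.Build _ _ _
  (mk_prob_fun mS mT mge0 m0) m0 mge0 mS.
HB.instance Definition _ := Measure_isProbability.Build _ _ _
  (mk_prob_fun mS mT mge0 m0) mT.

Lemma mk_prob : exists mu : Mp, forall A : set X, mu A = m A.
Proof. by exists (mk_prob_fun mS mT mge0 m0). Qed.

End mk_prob.

Lemma bmeas_open A : open A -> bmeas A.
Proof. exact: sub_sigma_algebra. Qed.

Lemma bmeasC A : bmeas A -> bmeas (~` A).
Proof. exact: measurableC. Qed.

Lemma bmeas_closed A : closed A -> bmeas A.
Proof.
move=> cA; rewrite -(setCK A); apply: bmeasC; apply: bmeas_open.
exact: closed_openC.
Qed.

Lemma bmeas_preimage (f : X -> X) A : continuous f -> bmeas A ->
  bmeas (f @^-1` A).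
Proof.
move=> fc mA.
have mf : measurable_fun [set: bX] (f : bX -> bX).
  apply: (@measurability _ _ bX bX setT f (@open X)) => //.
  move=> _ [B oB <-]; rewrite setTI; apply: bmeas_open.
  by apply: open_comp => // x _; exact: fc.
by rewrite /bmeas -[X in measurable X]setTI; exact: mf.
Qed.

Lemma bmeas_bigcap (I : finType) (A : I -> set X) :
  (forall i, bmeas (A i)) -> bmeas (\bigcap_(i in [set: I]) A i).
Proof. by move=> mA; apply: fin_bigcap_measurable => [|i _]; [exact: finite_finset|exact: mA]. Qed.

Lemma bmeas_bigcup (I : finType) (P : set I) (A : I -> set X) :
  (forall i, bmeas (A i)) -> bmeas (\bigcup_(i in P) A i).
Proof. by move=> mA; apply: fin_bigcup_measurable => [|i _]; [exact: finite_finset|exact: mA]. Qed.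

Lemma measurable_fun_cont g : continuous g -> bmeasf g.
Proof.
move=> gc; apply: (@measurability _ _ bX R setT g (@measurable_realfun.RGenOInfty.G R)).
  exact: measurable_realfun.RGenOInfty.measurableE.
move=> _ [_ [x ->] <-]; rewrite setTI; apply: bmeas_open.
by apply: open_comp => [y _|]; [exact: gc|exact: interval_open].
Qed.

Lemma prE mu A : bmeas A -> mu (A : set bX) = (pr mu A)%:E.
Proof. by move=> mA; rewrite /pr fineK//; exact: fin_num_measure. Qed.

Lemma pr_ltoo mu A : bmeas A -> (mu (A : set bX) < +oo)%E.
Proof. by move=> mA; rewrite prE// ltry. Qed.

Lemma pr_ge0 mu A : 0 <= pr mu A.
Proof. exact/fine_ge0/measure_ge0. Qed.

Lemma prT mu : pr mu setT = 1.
Proof. by rewrite /pr probability_setT. Qed.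

Lemma pr0 mu : pr mu set0 = 0.
Proof. by rewrite /pr measure0. Qed.

Lemma pr_le mu A B : bmeas A -> bmeas B -> A `<=` B -> pr mu A <= pr mu B.
Proof.
by move=> mA mB AB; rewrite -lee_fin -!prE//; apply: le_measure; rewrite ?inE.
Qed.

Lemma prU mu A B : bmeas A -> bmeas B -> A `&` B = set0 ->
  pr mu (A `|` B) = pr mu A + pr mu B.
Proof.
move=> mA mB AB; apply: EFin_inj; rewrite EFinD -!prE//.
  by rewrite measureU.
exact: measurableU.
Qed.

Lemma prD mu A B : bmeas A -> bmeas B -> B `<=` A ->
  pr mu (A `\` B) = pr mu A - pr mu B.
Proof.
move=> mA mB BA; apply: (addIr (pr mu B)); rewrite subrK -prU//.
- by rewrite setUC setDUK.
- exact: measurableD.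
- by rewrite setDKI.
Qed.

Lemma pr_bigcup (I : finType) mu (P : pred I) (A : I -> set X) :
  (forall i, bmeas (A i)) -> (forall i j, i != j -> A i `&` A j = set0) ->
  pr mu (\bigcup_(i in [set i | P i]) A i) = \sum_(i | P i) pr mu (A i).
Proof.
move=> mA dA; rewrite (bigcup_pred P) -big_filter -[RHS]big_filter.
have : uniq [seq i <- index_enum I | P i] by rewrite filter_uniq// index_enum_uniq.
elim: [seq i <- index_enum I | P i] => [|i s IH] /=; first by rewrite !big_nil pr0.
move=> /andP[is_ us]; rewrite !big_cons prU ?IH//.
  by apply: bigsetU_measurable => j _; exact: mA.
rewrite -bigcup_seq setI_bigcupr bigcup0// => j /= js; apply: dA.
by apply: contraNneq is_ => ->.
Qed.

Lemma Rint_bounded_integrable mu (g : X -> R) (B : R) :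
  bmeasf g ->
  (forall x, `|g x| <= B) -> bint mu g.
Proof.
move=> mg gB; apply: measurable_bounded_integrable => //.
  exact: (le_lt_trans (probability_le1 mu measurableT) (ltry 1)).
exists B; split; first exact: num_real.
by move=> y By x _ /=; rewrite (le_trans (gB x))// ltW.
Qed.

Lemma cont_integrable (Xcompact : compact [set: X]) mu g :
  continuous g -> bint mu g.
Proof.
move=> gc; have [B B0 gB] := continuous_bounded Xcompact gc.
exact: (Rint_bounded_integrable mu (measurable_fun_cont gc) gB).
Qed.

Lemma integE (Xcompact : compact [set: X]) mu g :
  continuous g -> integ mu g = (Rint mu g)%:E.
Proof.
move=> gc; rewrite /Rint fineK//.
exact: (integrable_fin_num measurableT (cont_integrable Xcompact mu gc)).
Qed.

Definition simple_step (I : finType) (A : I -> set X) (v : I -> R) (x : X) : R :=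
  \sum_i v i * \1_(A i) x.

Lemma simple_stepE (I : finType) (A : I -> set X) (v : I -> R) i x :
  (forall i j, i != j -> A i `&` A j = set0) -> A i x -> simple_step A v x = v i.
Proof.
move=> dA Aix; rewrite /simple_step (bigD1 i)//= indicE mem_set// mulr1.
rewrite big1 ?addr0// => j ji; rewrite indicE memNset ?mulr0// => Ajx.
by have := dA _ _ ji; rewrite -subset0 => /(_ x); apply.
Qed.

Lemma bint_indic mu A : bmeas A -> bint mu \1_A.
Proof. by move=> mA; exact: (integrable_indic mu mA). Qed.

Lemma Rint_simple (I : finType) mu (A : I -> set X) (v : I -> R) :
  (forall i, bmeas (A i)) ->
  bint mu (simple_step A v) /\
  Rint mu (simple_step A v) = \sum_i v i * pr mu (A i).
Proof.
move=> mA; rewrite /Rint /simple_step /integ.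
have iA i : mu.-integrable [set: bX] (fun x : bX => (v i * \1_(A i) x)%:E).
  under [X in _.-integrable _ X]eq_fun do rewrite EFinM.
  by apply: integrableZl => //; exact: (bint_indic mu (mA i)).
split.
  rewrite /bint (_ : EFin \o _ = fun x : bX => (\sum_i (v i * \1_(A i) x)%:E)%E); last first.
    by apply/funext => x; rewrite /= sumEFin.
  by apply: (integrable_sum measurableT).
under eq_integral do rewrite -sumEFin.
rewrite integral_sum//.
rewrite (eq_bigr (fun i => (v i * pr mu (A i))%:E)) ?sumEFin// => i _.
under eq_integral do rewrite EFinM.
rewrite integralZl//; last exact: (bint_indic mu (mA i)).
rewrite integral_indic ?setIT ?EFinM; last exact: mA.
  by congr (_ * _)%E; exact: prE (mA i).
exact: measurableT.
Qed.

(** [g] lies below the step function with values [v], whose integral is the weighted sum. With its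
    twin below it gives the integral estimates over finite partitions. *)
Lemma Rint_le_sum (Xcompact : compact [set: X]) (I : finType) mu g
    (A : I -> set X) (v : I -> R) : continuous g ->
  (forall i, bmeas (A i)) -> (forall i j, i != j -> A i `&` A j = set0) ->
  (forall x, exists i, A i x) -> (forall i x, A i x -> g x <= v i) ->
  Rint mu g <= \sum_i v i * pr mu (A i).
Proof.
move=> gc mA dA cA gv; have [iv <-] := Rint_simple mu v mA.
apply: (le_Rintegral measurableT (cont_integrable Xcompact mu gc) iv) => x _.
by have [i Aix] := cA x; rewrite (simple_stepE v dA Aix); exact: gv.
Qed.

Lemma Rint_ge_sum (Xcompact : compact [set: X]) (I : finType) mu g
    (A : I -> set X) (v : I -> R) : continuous g ->
  (forall i, bmeas (A i)) -> (forall i j, i != j -> A i `&` A j = set0) ->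
  (forall x, exists i, A i x) -> (forall i x, A i x -> v i <= g x) ->
  \sum_i v i * pr mu (A i) <= Rint mu g.
Proof.
move=> gc mA dA cA gv; have [iv <-] := Rint_simple mu v mA.
apply: (le_Rintegral measurableT iv (cont_integrable Xcompact mu gc)) => x _.
by have [i Aix] := cA x; rewrite (simple_stepE v dA Aix); exact: gv.
Qed.

(** The sets that have such approximations form a sigma-algebra, and it contains the open sets
    because an open set is an increasing union of closed ones. *)
Lemma prob_regular mu A (e : R) : bmeas A -> 0 < e ->
  exists F G, [/\ closed F, open G, F `<=` A, A `<=` G & pr mu (G `\` F) < e].
Proof.
move=> mA; move: e.
pose reg (A : set X) := forall e : R, 0 < e ->
  exists F G, [/\ closed F, open G, F `<=` A, A `<=` G & pr mu (G `\` F) < e].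
suff : <<s @open X >> `<=` reg by apply; exact: mA.
have regC B : reg B -> reg (~` B).
  move=> rB e /rB[F [G [cF oG FB BG mu_e]]]; exists (~` G), (~` F); split.
  - exact: open_closedC.
  - exact: closed_openC.
  - exact: subsetC.
  - exact: subsetC.
  - by rewrite setDE setCK setIC -setDE.
apply: smallest_sub; last first.
  move=> G oG e e0.
  (* Closed sets that exhaust [G], since each point of [G] has positive distance to the
     complement. *)
  pose F n := [set x : X | forall y, ~ G y -> n.+1%:R^-1 <= mdist x y].
  have cF n : closed (F n).
    rewrite -(setCK (F n)); apply: open_closedC; apply/openP_mdist => x.
    move=> /existsNP[y /not_implyP[Gy /negP]]; rewrite -ltNge => xy.
    exists (n.+1%:R^-1 - mdist x y); first by rewrite subr_gt0.
    move=> z xz /(_ y Gy); apply/negP; rewrite -ltNge.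
    have := mdist_tri z x y; rewrite (mdist_symm z x).
    by move: (n.+1%:R^-1) xy xz => r xy xz; lra.
  have FG n : F n `<=` G.
    move=> x Fx; apply: contrapT => /Fx; rewrite mdistxx.
    by apply/negP; rewrite -ltNge.
  have mF n : bmeas (G `\` F n).
    by apply: measurableD; [exact: bmeas_open|exact: bmeas_closed].
  have : mu \o (fun n => G `\` F n : set bX) @ \oo --> mu (\bigcap_n (G `\` F n)).
    apply: nonincreasing_cvg_mu.
    - exact: (pr_ltoo mu (mF 0%N)).
    - exact: mF.
    - by apply: bigcap_measurable => // n _; exact: mF.
    - move=> m n mn; apply/subsetPset => x [Gx nFx]; split=> // Fx.
      apply: nFx => y /Fx; apply: le_trans.
      by rewrite lef_pV2 ?posrE// ler_nat.
  rewrite (_ : \bigcap_n _ = set0).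
    rewrite measure0 => /fine_cvgP[_] /cvgrPdist_lt /(_ _ e0)[N _ /(_ N)/=].
    rewrite leqnn sub0r normrN => /(_ isT) H.
    exists (F N), G; split => //; rewrite (le_lt_trans _ H)//.
    by rewrite /comp /= ler_norm.
  rewrite -subset0 => x GFx.
  have Gx : G x by have [] := GFx 0%N I.
  have [r r0 rG] := (openP_mdist G).1 oG x Gx.
  have [n nr] : exists n : nat, n.+1%:R^-1 < r.
    by have [n] := ltr_add_invr r0; rewrite add0r; exists n.
  have [_] := GFx n I; apply => y Gy; rewrite leNgt; apply/negP => xy.
  by apply: Gy; apply: rG; rewrite (lt_trans xy).
split.
- move=> e e0; exists set0, set0; split => //; [exact: closed0|exact: open0|].
  by rewrite setD0 pr0.
- by move=> B rB; rewrite setTD; exact: regC.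
move=> B rB e e0.
have /choice[FG HFG] : forall n, exists FG : set X * set X,
    [/\ closed FG.1, open FG.2, FG.1 `<=` B n, B n `<=` FG.2 &
      pr mu (FG.2 `\` FG.1) < e / 2 / (2 ^ n.+1)%:R].
  move=> n; have [|F [G H]] := rB n (e / 2 / (2 ^ n.+1)%:R).
    by rewrite !divr_gt0// ltr0n expn_gt0.
  by exists (F, G).
(* A countable union of closed sets need not be closed, so only finitely many inner sets are kept;
   continuity from above pays for the others with the second half of [e]. *)
pose F n := \bigcup_(i in [set i | (i < n)%N]) (FG i).1.
pose G := \bigcup_n (FG n).2.
have cF n : closed (F n).
  apply: closed_bigcup => [|i _]; first exact: finite_II.
  by have [] := HFG i.
have oG : open G by apply: bigcup_open => n _; have [] := HFG n.
have mF n : bmeas (G `\` F n).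
  by apply: measurableD; [exact: bmeas_open|exact: bmeas_closed].
have mFn n : bmeas (FG n).1 by apply: bmeas_closed; case: (HFG n).
have mGn n : bmeas (FG n).2 by apply: bmeas_open; case: (HFG n).
have mI : bmeas (\bigcap_n (G `\` F n)).
  by apply: bigcap_measurable => // n _; exact: (mF n).
have cvgF : mu \o (fun n => G `\` F n : set bX) @ \oo --> mu (\bigcap_n (G `\` F n)).
  apply: nonincreasing_cvg_mu.
  - exact: (pr_ltoo mu (mF 0%N)).
  - exact: mF.
  - exact: mI.
  - move=> m n mn; apply/subsetPset => x [Gx nFx]; split=> // -[i /= im Fx].
    by apply: nFx; exists i => //=; exact: leq_trans mn.
have small : (mu (\bigcap_n (G `\` F n)) <= (e / 2)%:E)%E.
  apply: (@le_trans _ _ (\sum_(i <oo) mu ((FG i).2 `\` (FG i).1))%E).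
    apply: measure_sigma_subadditive.
    - by move=> n; apply: measurableD; [exact: mGn|exact: mFn].
    - exact: mI.
    move=> x GFx; have [[n _ Gnx] _] := GFx 0%N I; exists n => //; split => //.
    by move=> Fnx; have [_] := GFx n.+1 I; apply; exists n => /=.
  apply: le_trans (epsilon_trick0 xpredT (ltW (half_gt0 e0))).
  apply: lee_nneseries => [n _ _|n _]; first exact: measure_ge0.
  rewrite [leLHS]prE; last by apply: measurableD; [exact: mGn|exact: mFn].
  by rewrite lee_fin ltW//; case: (HFG n).
have [N HN] : exists N, pr mu (G `\` F N) < e.
  move: cvgF; rewrite (prE mu mI) in small *.
  move=> /fine_cvgP[_] /cvgrPdist_lt /(_ _ (half_gt0 e0))[N _ /(_ N)/=].
  rewrite leqnn => /(_ isT); rewrite lee_fin in small.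
  rewrite distrC => /(le_lt_trans (ler_norm _)) H; exists N.
  by rewrite /pr; move: H; rewrite /comp /=; lra.
exists (F N), G; split => //.
- by move=> x [n /= nN Fnx]; exists n => //; have [_ _ + _ _] := HFG n; apply.
- by move=> x [n _ Bnx]; exists n => //; have [_ _ _ + _] := HFG n; apply.
Qed.

End BorelProb.

(** * The Riesz representation theorem *)

Section Riesz.
Context {R : realType} {X : pointedMetricType R}.
Local Notation bX := (@borel R X).
Local Notation Mp := (@Mprob R X).
Implicit Types (A F G : set X) (g h u : X -> R) (mu nu : Mp).
Hypothesis Xcompact : compact [set: X].

Lemma clampE (t : R) : Num.min (Num.max t 0) 1 =
  if t < 0 then 0 else if t < 1 then t else 1.
Proof.
by rewrite /Order.min /Order.max; case: (ltP t 0) => // _; rewrite ltr01.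
Qed.

Lemma clamp0 (t : R) : t <= 0 -> Num.min (Num.max t 0) 1 = 0.
Proof. by move=> t0; rewrite max_r// min_l. Qed.

Lemma clamp1 (t : R) : 1 <= t -> Num.min (Num.max t 0) 1 = 1.
Proof. by move=> t1; rewrite max_l ?min_r// (le_trans ler01). Qed.

Lemma clamp_id (t : R) : 0 <= t <= 1 -> Num.min (Num.max t 0) 1 = t.
Proof. by move=> /andP[t0 t1]; rewrite max_l// min_l. Qed.

Lemma clamp_itv (t : R) : 0 <= Num.min (Num.max t 0) 1 <= 1.
Proof. by rewrite ge_min lexx orbT andbT le_min ler01 andbT le_max lexx orbT. Qed.

Lemma continuous_clamp g : continuous g ->
  continuous (fun x => Num.min (Num.max (g x) 0) 1).
Proof.
move=> /continuousP_mdist gc; apply/continuousP_mdist => x e /(gc x)[d d0 H].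
exists d => // y /H; apply: le_lt_trans.
rewrite ler_norml; move: (g x) (g y) => a b.
have h1 := ler_norm (a - b); have := ler_norm (b - a); rewrite distrC => h2.
move: (`|a - b|) h1 h2 => w h1 h2; rewrite !clampE.
by apply/andP; split; repeat (case: ltP => ?); lra.
Qed.

Lemma continuous_add g h : continuous g -> continuous h ->
  continuous (fun x => g x + h x).
Proof. by move=> gc hc x; apply: cvgD; [exact: gc|exact: hc]. Qed.

Lemma continuous_scale c g : continuous g -> continuous (fun x => c * g x).
Proof. by move=> gc x; apply: cvgM; [exact: cvg_cst|exact: gc]. Qed.

Lemma cont_cst (c : R) : continuous (fun _ : X => c).
Proof. by move=> x; exact: cvg_cst. Qed.
Arguments cont_cst : clear implicits.

Lemma continuous_sum (I : Type) (s : seq I) (g : I -> X -> R) :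
  (forall i, continuous (g i)) -> continuous (fun x => \sum_(i <- s) g i x).
Proof.
move=> gc; elim: s => [|i s IH].
  under eq_fun do rewrite big_nil; exact: cont_cst.
under eq_fun do rewrite big_cons; exact: continuous_add.
Qed.

Lemma RintD mu g h : continuous g -> continuous h ->
  Rint mu (fun x => g x + h x) = Rint mu g + Rint mu h.
Proof.
move=> gc hc; exact: (RintegralD measurableT (cont_integrable Xcompact mu gc)
  (cont_integrable Xcompact mu hc)).
Qed.

Lemma RintZ mu c g : continuous g -> Rint mu (fun x => c * g x) = c * Rint mu g.
Proof.
by move=> gc; exact: (RintegralZl c measurableT (cont_integrable Xcompact mu gc)).
Qed.

Lemma Rint_le mu g h : continuous g -> continuous h -> (forall x, g x <= h x) ->
  Rint mu g <= Rint mu h.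
Proof.
move=> gc hc gh; exact: (le_Rintegral measurableT (cont_integrable Xcompact mu gc)
  (cont_integrable Xcompact mu hc) (fun x _ => gh x)).
Qed.

Lemma Rint_cst mu c : Rint mu (fun=> c) = c.
Proof.
have S : \sum_(i : unit) c * pr mu setT = c.
  by rewrite big_const card_unit /= prT mulr1 addr0.
apply/eqP; rewrite eq_le -{2 3}S; apply/andP; split.
  apply: (@Rint_le_sum _ _ Xcompact unit mu _ (fun=> setT) (fun=> c)) => //.
  - exact: cont_cst.
  - by move=> _; exact: bmeas_open openT.
apply: (@Rint_ge_sum _ _ Xcompact unit mu _ (fun=> setT) (fun=> c)) => //.
- exact: cont_cst.
- by move=> _; exact: bmeas_open openT.
Qed.

(** Meant for Urysohn functions: it turns integrals of continuous functions into bounds on measures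
    of sets. *)
Lemma Rint_between mu u A B : continuous u -> (forall x, 0 <= u x <= 1) ->
  bmeas A -> bmeas B -> (forall x, A x -> u x = 1) -> (forall x, ~ B x -> u x = 0) ->
  pr mu A <= Rint mu u <= pr mu B.
Proof.
move=> uc u01 mA mB uA uB; apply/andP; split.
  have := @Rint_ge_sum _ _ Xcompact bool mu u (fun b => if b then A else ~` A)
    (fun b => b%:R) uc.
  rewrite big_bool /= mul1r mul0r addr0; apply.
  - by case=> //; exact: bmeasC.
  - by move=> [] [] // _; [exact: setICr|exact: setICl].
  - by move=> x; case: (pselect (A x)) => Ax; [exists true|exists false].
  - by move=> [] x /=; [move=> /uA ->|case/andP: (u01 x)].
have := @Rint_le_sum _ _ Xcompact bool mu u (fun b => if b then B else ~` B)
  (fun b => b%:R) uc.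
rewrite big_bool /= mul1r mul0r addr0; apply.
- by case=> //; exact: bmeasC.
- by move=> [] [] // _; [exact: setICr|exact: setICl].
- by move=> x; case: (pselect (B x)) => Ax; [exists true|exists false].
- by move=> [] x /=; [case/andP: (u01 x)|move=> /uB ->].
Qed.

Section functional.
Variable L : (X -> R) -> R.
Hypothesis LD : forall g h, continuous g -> continuous h ->
  L (fun x => g x + h x) = L g + L h.
Hypothesis LZ : forall c g, continuous g -> L (fun x => c * g x) = c * L g.
Hypothesis Lmono : forall g h, continuous g -> continuous h ->
  (forall x, g x <= h x) -> L g <= L h.
Hypothesis L1 : L (fun=> 1) = 1.

Let Lcst c : L (fun=> c) = c.
Proof.
rewrite -[RHS]mulr1 -L1 -(LZ c (cont_cst 1)).
by congr L; apply/funext => x; rewrite mulr1.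
Qed.

Let Lsum (I : Type) (s : seq I) (g : I -> X -> R) :
  (forall i, continuous (g i)) -> L (fun x => \sum_(i <- s) g i x) = \sum_(i <- s) L (g i).
Proof.
move=> gc; elim: s => [|i s IH].
  by under eq_fun do rewrite big_nil; rewrite big_nil Lcst.
under eq_fun do rewrite big_cons.
by rewrite LD// ?IH ?big_cons//; exact: continuous_sum.
Qed.

(** Vanishing outside [G] replaces the usual compact support in [G]; compactness enters later
    through the closed sets where the function is at least [e]. *)
Definition admissible G g := [/\ continuous g, forall x, 0 <= g x <= 1 &
  forall x, ~ G x -> g x = 0].

(* The mass that the measure representing [L] gives to the open set [G]. *)
Definition open_mass G : R := sup [set L g | g in admissible G].

Let adm0 G : admissible G (fun=> 0).
Proof. by split => // [|x]; [exact: (cont_cst 0)|by rewrite lexx ler01]. Qed.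

Let adm_le1 G g : admissible G g -> L g <= 1.
Proof.
move=> [gc g01 _]; rewrite -L1; apply: (Lmono gc (cont_cst 1)) => x.
by case/andP: (g01 x).
Qed.

Let open_mass_sup G : has_sup [set L g | g in admissible G].
Proof.
split; first by exists (L (fun=> 0)), (fun=> 0).
by exists 1 => _ [g ag <-]; exact: (adm_le1 ag).
Qed.

Let open_mass_ge G g : admissible G g -> L g <= open_mass G.
Proof. by move=> ag; apply: ub_le_sup; [case: (open_mass_sup G)|exists g]. Qed.

Let open_mass_le G c : (forall g, admissible G g -> L g <= c) -> open_mass G <= c.
Proof.
move=> H; apply: ge_sup; first by case: (open_mass_sup G).
by move=> _ [g ag <-]; exact: H.
Qed.

Let open_mass_ge0 G : 0 <= open_mass G.
Proof. by have := open_mass_ge (adm0 G); rewrite Lcst. Qed.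

Let open_mass_approx G (e : R) : 0 < e -> exists2 g, admissible G g & open_mass G - e < L g.
Proof.
move=> e0; have [_ [g ag <-] H] := sup_adherent e0 (open_mass_sup G); by exists g.
Qed.

Let open_mass_mono G F : G `<=` F -> open_mass G <= open_mass F.
Proof.
move=> GF; apply: open_mass_le => g [gc g01 g0]; apply: open_mass_ge; split => // x nF.
by apply: g0 => /GF.
Qed.

Definition outer_mass A : R := inf [set open_mass G | G in [set G | open G /\ A `<=` G]].

Let outer_mass_inf A : has_inf [set open_mass G | G in [set G | open G /\ A `<=` G]].
Proof.
split; first by exists (open_mass setT), setT => //; split => //; exact: openT.
by exists 0 => _ [G _ <-]; exact: open_mass_ge0.
Qed.

Let outer_mass_le A G : open G -> A `<=` G -> outer_mass A <= open_mass G.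
Proof. by move=> oG AG; apply: ge_inf; [case: (outer_mass_inf A)|exists G]. Qed.

Let outer_mass_ge A c : (forall G, open G -> A `<=` G -> c <= open_mass G) -> c <= outer_mass A.
Proof.
move=> H; apply: lb_le_inf; first by case: (outer_mass_inf A).
by move=> _ [G [oG AG] <-]; exact: H.
Qed.

Let outer_mass_approx A (e : R) : 0 < e -> exists G, [/\ open G, A `<=` G & open_mass G < outer_mass A + e].
Proof.
move=> e0; have [_ [G [oG AG] <-] H] := inf_adherent e0 (outer_mass_inf A).
by exists G.
Qed.

Let outer_mass_open G : open G -> outer_mass G = open_mass G.
Proof.
move=> oG; apply/eqP; rewrite eq_le outer_mass_le//=; apply: outer_mass_ge => F _.
exact: open_mass_mono.
Qed.

Let outer_mass_mono A B : A `<=` B -> outer_mass A <= outer_mass B.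
Proof.
by move=> AB; apply: outer_mass_ge => G oG BG; apply: outer_mass_le => //; apply: subset_trans BG.
Qed.

Let outer_mass_ge0 A : 0 <= outer_mass A.
Proof. exact: outer_mass_ge. Qed.

Let outer_mass0 : outer_mass set0 = 0.
Proof.
rewrite outer_mass_open; last exact: open0.
apply/eqP; rewrite eq_le open_mass_ge0 andbT; apply: open_mass_le => g [gc _ g0].
rewrite -[leRHS]Lcst; apply: (Lmono gc (cont_cst 0)) => x.
by rewrite g0.
Qed.

Let outer_massT : outer_mass setT = 1.
Proof.
rewrite outer_mass_open; last exact: openT.
apply/eqP; rewrite eq_le; apply/andP; split; first by apply: open_mass_le => g /adm_le1.
rewrite -[leLHS]L1; apply: open_mass_ge; split => [|x|x []//]; first exact: (cont_cst 1).
by rewrite ler01 lexx.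
Qed.

(** Up to [e], [g] is carried by the compact set where it is at least [e]. This set is split into
    closed pieces inside finitely many of the [G i], whose Urysohn functions add up to a majorant of
    [g] there. *)
Let open_mass_cover (G : nat -> set X) g (e : R) : (forall n, open (G n)) ->
  admissible (\bigcup_n G n) g -> 0 < e ->
  exists N, L g <= e + \sum_(i < N) open_mass (G i).
Proof.
move=> oG [gc g01 g0] e0.
(* [rk.1] is a radius and [rk.2] the index of a member of the cover; the index is arbitrary where
   [g] is small. *)
have /choice[r Hr] : forall x, exists rk : R * nat, 0 < rk.1 /\
    forall y, mdist x y < rk.1 -> g y < e \/ G rk.2 y.
  move=> x; case: (ltP (g x) e) => [gxe|egx].
    have /continuousP_mdist/(_ x (e - g x)) := gc; rewrite subr_gt0.
    move=> /(_ gxe)[d d0 H]; exists (d, 0%N); split => //= y /H yd; left.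
    by move: yd; rewrite ltr_norml => /andP[]; lra.
  have [n Gnx] : exists n, G n x.
    apply: contrapT => nG; have : g x = 0.
      by apply: g0 => -[n _ Gn]; apply: nG; exists n.
    lra.
  have [d d0 H] := (openP_mdist (G n)).1 (oG n) x Gnx.
  by exists (d, n); split => //= y /H; right.
have [s Hs] := finite_net Xcompact (fun x => half_gt0 (Hr x).1).
pose K i := \bigcup_(c in [set c | c \in s /\ (r c).2 = i])
  ([set y | mdist c y <= (r c).1 / 2] `&` [set y | e <= g y]).
have cK i : closed (K i).
  apply: closed_bigcup.
    by apply: (@sub_finite_set _ _ [set` s]) => [c []//|]; exact: finite_seq.
  move=> c _; apply: closedI.
    apply: (@closed_comp _ _ (mdist c) [set t | t <= (r c).1 / 2]) => [? _|].
      exact: continuous_mdist.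
    exact: closed_le.
  by apply: (@closed_comp _ _ g [set t | e <= t]) => [? _|]; [exact: gc|exact: closed_ge].
have KG i : K i `<=` G i.
  move=> y [c [/= cs <-]] [/= cy egy]; have [||//] := (Hr c).2 y.
    by rewrite (le_lt_trans cy)//; have := (Hr c).1; lra.
  by rewrite ltNge egy.
have /choice[u Hu] i := urysohn_fun Xcompact (@cK i) (@oG i) (@KG i).
pose N := (\max_(c <- s) (r c).2).+1.
exists N; rewrite -[in leRHS](Lcst e).
apply: (@le_trans _ _ (L (fun x => e + \sum_(i < N) u i x))); last first.
  rewrite LD ?Lsum; last 3 first.
  - by move=> i; case: (Hu i).
  - exact: cont_cst.
  - by apply: continuous_sum => i; case: (Hu i).
  rewrite lerD2l; apply: ler_sum => i _; apply: open_mass_ge.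
  by case: (Hu i).
apply: Lmono => // [|x].
  apply: continuous_add; first exact: cont_cst.
  by apply: continuous_sum => i; case: (Hu i).
have u0 i : 0 <= u i x by have [_ /(_ x)/andP[]] := Hu i.
case: (ltP (g x) e) => [gxe|egx]; first by rewrite ler_wpDr ?sumr_ge0// ltW.
have [c cs cx] := Hs x.
have cN : ((r c).2 < N)%N by rewrite ltnS; exact: leq_bigmax_seq.
rewrite (bigD1 (Ordinal cN))//=.
have -> : u (r c).2 x = 1.
  have [_ _ + _] := Hu (r c).2; apply; exists c => //; split => //=.
  exact: ltW.
have : 0 <= \sum_(i < N | i != Ordinal cN) u i x by exact: sumr_ge0.
by case/andP: (g01 x); lra.
Qed.

(** Half of [e] is spent on the open supersets, a quarter on the test function [g] and a quarter on
    the finite cover. *)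
Let outer_mass_sub (F : (set X)^nat) :
  ((outer_mass (\bigcup_n F n))%:E <= \sum_(i <oo) (outer_mass (F i))%:E)%E.
Proof.
apply/lee_addgt0Pr => e e0.
have e20 := half_gt0 e0.
have /choice[G HG] : forall n, exists G, [/\ open G, F n `<=` G &
    open_mass G < outer_mass (F n) + e / 2 / (2 ^ n.+1)%:R].
  by move=> n; apply: outer_mass_approx; rewrite !divr_gt0// ltr0n expn_gt0.
have oG : forall n, open (G n) by move=> n; case: (HG n).
have H : outer_mass (\bigcup_n F n) <= open_mass (\bigcup_n G n).
  apply: outer_mass_le; first exact: bigcup_open.
  by move=> x [n _ Fnx]; exists n => //; case: (HG n) => _ + _; apply.
apply: (@le_trans _ _ (\sum_(i <oo) (open_mass (G i))%:E + (e / 2)%:E)%E); last first.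
  rewrite [in leRHS](splitr e) EFinD addeA; apply: leeD => //.
  apply: le_trans (epsilon_trick xpredT _ (ltW e20)).
    apply: lee_nneseries => [n _ _|n _]; first by rewrite lee_fin.
    by rewrite -EFinD lee_fin ltW//; case: (HG n).
  by move=> n; rewrite lee_fin outer_mass_ge0.
have [g ag Lg] := open_mass_approx (\bigcup_n G n) (half_gt0 e20).
have [N HN] := open_mass_cover oG ag (half_gt0 e20).
apply: (@le_trans _ _ (\sum_(i < N) (open_mass (G i))%:E + (e / 2)%:E)%E).
  by rewrite sumEFin -EFinD lee_fin; lra.
apply: leeD => //; rewrite -(big_mkord xpredT (fun i => (open_mass (G i))%:E)).
by apply: nneseries_lim_ge => n _ _; rewrite lee_fin.
Qed.

Definition outer_mass_e A : \bar R := (outer_mass A)%:E.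

Let outer_mass_e0 : outer_mass_e set0 = 0%E.
Proof. by rewrite /outer_mass_e outer_mass0. Qed.
Let outer_mass_e_ge0 A : (0 <= outer_mass_e A)%E.
Proof. by rewrite lee_fin. Qed.
Let outer_mass_e_mono : {homo outer_mass_e : A B / A `<=` B >-> (A <= B)%E}.
Proof. by move=> A B AB; rewrite lee_fin outer_mass_mono. Qed.

HB.instance Definition _ := isOuterMeasure.Build R X outer_mass_e
  outer_mass_e0 outer_mass_e_ge0 outer_mass_e_mono outer_mass_sub.

(** [g] nearly exhausts the mass of [O] inside [G], and [h] lives where [g < e], a set that contains
    the part of [A] outside [G]. Hence [g + h] is at most [1 + e] and, rescaled, admissible for
    [O]. *)
Let cara_open G : open G -> caratheodory_measurable outer_mass_e G.
Proof.
move=> oG; apply: le_caratheodory_measurable => A.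
rewrite -EFinD lee_fin; apply/ler_addgt0Pr => e0 e0pos.
(* The losses are one [e] for [g], one for [h], and one for the factor [1 + e], as the total mass is
   at most 1. *)
have : exists2 e : R, 0 < e & 4 * e <= e0 by exists (e0 / 4); lra.
move=> [e epos ee0]; rewrite -lerBlDr; apply: outer_mass_ge => O oO AO.
rewrite lerBlDr.
pose O1 := O `&` G.
have oO1 : open O1 by exact: openI.
have [g [gc g01 g0] Lg] := open_mass_approx O1 epos.
pose O2 := O `&` [set x | g x < e].
have oO2 : open O2.
  apply: openI => //; apply: (@open_comp _ _ g [set t | t < e]) => [? _|].
    exact: gc.
  exact: open_lt.
have [h [hc h01 h0] Lh] := open_mass_approx O2 epos.
have H1 : outer_mass (A `&` G) <= open_mass O1.
  by apply: outer_mass_le => // x [/AO ? ?].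
have H2 : outer_mass (A `&` ~` G) <= open_mass O2.
  apply: outer_mass_le => // x [/AO Ox nGx]; split => //=.
  by rewrite g0// => -[].
have : L (fun x => (1 + e)^-1 * (g x + h x)) <= open_mass O.
  apply: open_mass_ge; split.
  - by apply: continuous_scale; exact: continuous_add.
  - move=> x; have /andP[g1 g2] := g01 x; have /andP[h1 h2] := h01 x.
    rewrite mulr_ge0 ?invr_ge0; [|lra|lra]; rewrite mulrC ler_pdivrMr; last lra.
    case: (ltP (g x) e) => [|egx]; first lra.
    by rewrite h0; [lra|move=> -[_ /=]; lra].
  - by move=> x nO; rewrite g0 ?h0 ?addr0 ?mulr0// => -[].
rewrite LZ; last exact: continuous_add.
rewrite LD// mulrC ler_pdivrMr; last lra.
have : open_mass O <= 1 by apply: open_mass_le => ? /adm_le1.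
have := open_mass_ge0 O; move: (open_mass O) => l; nra.
Qed.

(** Caratheodory's theorem gives the measure. It represents [L] as soon as [L g] is at most the
    integral of [g] for all continuous [g], because [-g] then gives the converse. *)
Lemma riesz : exists mu, forall g, continuous g -> Rint mu g = L g.
Proof.
have meas A : measurable (A : set bX) -> caratheodory_measurable outer_mass_e A.
  move=> mA.
  have : @measurable _ (caratheodory_type outer_mass_e) A; last by [].
  have : <<s @open X >> `<=` @measurable _ (caratheodory_type outer_mass_e).
    apply: smallest_sub; last by move=> G oG; exact: cara_open.
    exact: sigma_algebra_measurable.
  by apply; exact: mA.
have sadd : semi_sigma_additive (outer_mass_e : set bX -> \bar R).
  move=> F mF tF mUF.
  apply: (@caratheodory_measure_sigma_additive R X outer_mass_e F) => //.
  - by move=> i; exact: meas.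
  - exact: (meas _ mUF).
have [|mu Hmu] := @mk_prob R X outer_mass_e outer_mass_e0 outer_mass_e_ge0 sadd.
  by rewrite /outer_mass_e outer_massT.
exists mu.
have prG G : open G -> pr mu G = open_mass G.
  by move=> oG; rewrite /pr Hmu /outer_mass_e /= outer_mass_open.
have le01 g : continuous g -> (forall x, 0 <= g x <= 1) -> L g <= Rint mu g.
  move=> gc g01; rewrite leNgt; apply/negP => lt.
  have [N0 HN0] : exists N, N.+1%:R^-1 < L g - Rint mu g.
    have := lt; rewrite -subr_gt0 => /ltr_add_invr[k]; rewrite add0r => H.
    by exists k.
  pose N := N0.+1.
  (* Layer-cake slices: they sum to [N * g], the slice [u i] is admissible for the set where
     [N * g > i], and it equals 1 where [N * g > i + 1]. The shift of index costs one slice, hence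
     the 1 in the bound for [N * L g]. *)
  pose u (i : nat) (x : X) := Num.min (Num.max (N%:R * g x - i%:R) 0) 1.
  have uc i : continuous (u i).
    apply: continuous_clamp; apply: continuous_add; first exact: continuous_scale.
    exact: cont_cst.
  have u01 i x : 0 <= u i x <= 1.
    exact: clamp_itv.
  have usum x : \sum_(i < N) u i x = N%:R * g x.
    have /andP[] := g01 x.
    suff : forall (M : nat), (forall (t : R), 0 <= t -> t <= M%:R ->
        \sum_(i < M) Num.min (Num.max (t - i%:R) 0) 1 = t).
      move=> H g0 g1; apply: H; first by rewrite mulr_ge0.
      by rewrite ler_piMr.
    elim=> [|M IH] t t0 tM; first by rewrite big_ord0; move: tM; rewrite mulr0n; lra.
    rewrite big_ord_recr/=; case: (leP t M%:R) => tM'.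
      by rewrite IH// clamp0 ?addr0// subr_le0.
    have -> : \sum_(i < M) Num.min (Num.max (t - i%:R) 0) 1 =
              \sum_(i < M) Num.min (Num.max (M%:R - i%:R) 0) (1 : R).
      apply: eq_bigr => i _.
      have iM : (i%:R + 1 : R) <= M%:R by rewrite -[X in _ + X]/(1%:R) -natrD ler_nat addn1.
      by rewrite !clamp1//; lra.
    rewrite IH//; move: tM; rewrite -[M.+1]addn1 natrD => tM.
    rewrite clamp_id; first by rewrite addrC subrK.
    by apply/andP; split; lra.
  pose P i := [set x : X | i%:R < N%:R * g x].
  have oP i : open (P i).
    apply: (@open_comp _ _ (fun x => N%:R * g x) [set t | i%:R < t]) => [? _|].
      exact: continuous_scale.
    exact: open_gt.
  have Lu i : L (u i) <= pr mu (P i).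
    rewrite prG//; apply: open_mass_ge; split => // x /negP; rewrite -leNgt => H.
    by rewrite /u clamp0// subr_le0.
  have Pu i : pr mu (P i.+1) <= Rint mu (u i).
    suff /andP[-> _//] : pr mu (P i.+1) <= Rint mu (u i) <= pr mu setT.
    have := @Rint_between mu (u i) (P i.+1) setT (uc i) (u01 i)
      (bmeas_open (oP i.+1)) (bmeas_open openT).
    apply=> [x|x []//].
    by rewrite /P/= -addn1 natrD /u => ix; rewrite clamp1//; lra.
  have : N%:R * L g <= 1 + N%:R * Rint mu g.
    rewrite -LZ// -RintZ//.
    have -> : (fun x => N%:R * g x) = (fun x => \sum_(i < N) u i x).
      by apply/funext => x; rewrite usum.
    rewrite Lsum//.
    have -> : Rint mu (fun x => \sum_(i < N) u i x) = \sum_(i < N) Rint mu (u i).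
      elim: (index_enum 'I_N) => [|i s IH].
        by under eq_fun do rewrite big_nil; rewrite big_nil Rint_cst.
      under eq_fun do rewrite big_cons.
      by rewrite RintD// ?IH ?big_cons//; exact: continuous_sum.
    rewrite big_ord_recl [in leRHS]big_ord_recr/= addrCA [leRHS]addrC.
    have h0 : L (u 0%N) <= 1.
      by rewrite -L1; apply: Lmono => // [|x]; [exact: cont_cst|case/andP: (u01 0%N x)].
    have h1 : 0 <= Rint mu (u N0).
      rewrite -(Rint_cst mu 0); apply: Rint_le => // [|x]; first exact: cont_cst.
      by case/andP: (u01 N0 x).
    have h2 : \sum_(i < N0) L (u (lift ord0 i)) <= \sum_(i < N0) Rint mu (u i).
      by apply: ler_sum => i _; rewrite (le_trans (Lu _))// lift0.
    lra.
  have N0' : 0 < (N%:R : R) by rewrite ltr0n.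
  rewrite -lerBlDr -mulrBr mulrC -ler_pdivlMr// mul1r.
  by move: HN0; rewrite /N; move: (N0.+1%:R^-1) => z; lra.
(* A function bounded by [B] is moved into the unit interval by an affine map, which both
   functionals respect. *)
have le g : continuous g -> L g <= Rint mu g.
  move=> gc; have [B B0 gB] := continuous_bounded Xcompact gc.
  have c1 : continuous (fun x => g x + B).
    by apply: continuous_add => //; exact: cont_cst.
  have := le01 (fun x => (2 * B)^-1 * (g x + B)).
  rewrite LZ// RintZ// LD ?RintD// ?Lcst ?Rint_cst; try exact: cont_cst.
  rewrite ler_pM2l; last by rewrite invr_gt0; lra.
  rewrite lerD2r; apply; first exact: continuous_scale.
  move=> x; have := gB x; rewrite ler_norml => /andP[? ?].
  rewrite mulr_ge0 ?invr_ge0; [|lra|lra]; rewrite mulrC ler_pdivrMr; lra.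
move=> g gc; apply/eqP; rewrite eq_le le// andbT.
have := le (fun x => -1 * g x) (@continuous_scale (-1) g gc).
by rewrite LZ// RintZ// !mulN1r lerN2.
Qed.

End functional.
End Riesz.

(** * Limit measures of empirical averages *)

Section LimitMeasures.
Context {R : realType} {X : pointedMetricType R}.
Local Notation bX := (@borel R X).
Local Notation Mp := (@Mprob R X).
Implicit Types (A F G : set X) (g h u : X -> R) (mu nu : Mp).
Hypothesis Xcompact : compact [set: X].
Variable f : X -> X.
Hypothesis fcont : continuous f.

Lemma emp_integ_bound x n g (B : R) : (forall y, `|g y| <= B) ->
  `|emp_integ f x n g| <= B.
Proof.
move=> gB; rewrite /emp_integ normrM; have [->|n0] := posnP n.
  by rewrite big_ord0 normr0 mulr0 (le_trans _ (gB x)).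
rewrite ger0_norm ?invr_ge0// mulrC ler_pdivrMr ?ltr0n//.
rewrite (le_trans (ler_norm_sum _ _ _))//.
by rewrite (le_trans (ler_sum _ (fun i _ => gB _)))// sumr_const card_ord mulr_natr.
Qed.

(** The difference of the two orbit sums telescopes to its two extreme terms. *)
Lemma emp_integ_shift x n g (B : R) : (forall y, `|g y| <= B) ->
  `|emp_integ f x n (g \o f) - emp_integ f x n g| <= 2 * B * n%:R^-1.
Proof.
move=> gB; rewrite /emp_integ -mulrBr normrM [leLHS]mulrC (ger0_norm (x := n%:R^-1)) ?invr_ge0//.
rewrite ler_wpM2r ?invr_ge0//.
have -> : \sum_(i < n) (g \o f) (iter i f x) - \sum_(i < n) g (iter i f x) =
    g (iter n f x) - g x.
  have : \sum_(i < n.+1) g (iter i f x) = \sum_(i < n.+1) g (iter i f x) by [].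
  by rewrite {1}big_ord_recl big_ord_recr/= => H; under eq_bigr do rewrite -iterS; lra.
by rewrite (le_trans (ler_normB _ _))//; have := gB (iter n f x); have := gB x; lra.
Qed.

Lemma Vlim_near x nu g (e : R) (N : nat) : Vlim f x nu -> continuous g -> 0 < e ->
  exists n, [/\ (N <= n)%N, (0 < n)%N & `|emp_integ f x n g - Rint nu g| < e].
Proof.
move=> V gc e0; have [|//|n [Nn [n0 H]]] := V 1%N (fun=> g) e N.
  by move=> _; exact: gc.
by exists n; split => //; exact: (H ord0).
Qed.

Lemma Vlim_comp x nu g : Vlim f x nu -> continuous g ->
  Rint nu (g \o f) = Rint nu g.
Proof.
move=> V gc; have [B B0 gB] := continuous_bounded Xcompact gc.
have gfc : continuous (g \o f) by move=> y; apply: continuous_comp; [exact: fcont|exact: gc].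
apply/eqP; rewrite -subr_eq0 -normr_eq0 eq_le normr_ge0 andbT.
apply/ler_addgt0Pr => e e0; rewrite add0r.
have [N HN] : exists N : nat, forall n, (N <= n)%N -> (0 < n)%N -> 2 * B * n%:R^-1 <= e / 3.
  have [|N] := @ltr_add_invr R 0 (e / 3 / (2 * B)).
    by rewrite !divr_gt0// mulr_gt0.
  rewrite add0r => HN; exists N.+1 => n Nn n0.
  rewrite mulrC -ler_pdivlMr ?mulr_gt0//; apply: le_trans (ltW HN).
  by rewrite lef_pV2 ?posrE ?ltr0n// ler_nat.
(* Both functions have to be compared at the same time [n], so they are tested together as a family
   of two. *)
have [|/=|n [Nn [n0 H]]] := V 2%N (fun j => if j == ord0 then g \o f else g) (e / 3) N.
- by move=> j; case: ifP => _.
- by rewrite divr_gt0.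
have := H ord0; have := H (lift ord0 ord0) => /=.
rewrite -!/(Rint _ _) => h1 h2.
have h3 := le_trans (emp_integ_shift x n gB) (HN n Nn n0).
move: h1 h2 h3; rewrite !ltr_norml !ler_norml.
move=> /andP[? ?] /andP[? ?] /andP[? ?]; apply/andP; split; lra.
Qed.

Lemma push_prob mu : exists nu, forall A : set X, nu A = mu (f @^-1` A).
Proof.
have mf A : bmeas A -> bmeas (f @^-1` A) by exact: bmeas_preimage.
apply: (@mk_prob R X (fun A => mu (f @^-1` A))).
- by rewrite preimage_set0 measure0.
- by move=> A; apply: measure_ge0.
- move=> F mF tF mUF; rewrite preimage_bigcup.
  apply: measure_semi_sigma_additive.
  + by move=> n; apply: mf; exact: mF.
  + apply/trivIsetP => /= i j _ _ ij; rewrite -preimage_setI.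
    by move/trivIsetP : tF => /(_ _ _ _ _ ij) ->//; rewrite preimage_set0.
  + by rewrite -preimage_bigcup; apply: mf; exact: mUF.
- by rewrite preimage_setT probability_setT.
Qed.

(** Invariance holds on continuous functions. Regularity of [mu] and of its image [nu] gives one
    closed and one open set around [A] that suit both, and a Urysohn function between them carries
    the invariance over to [A] up to [e]. *)
Lemma Vlim_Minv x : Vlim f x `<=` Minv f.
Proof.
move=> mu V A mA; have [nu Hnu] := push_prob mu.
have prnu B : pr nu B = pr mu (f @^-1` B) by rewrite /pr Hnu.
have mfA : bmeas (f @^-1` A) by exact: bmeas_preimage.
rewrite !prE// -prnu; congr _%:E; apply/eqP.
rewrite -subr_eq0 -normr_eq0 eq_le normr_ge0 andbT.
apply/ler_addgt0Pr => e e0; rewrite add0r.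
have [F1 [G1 [cF1 oG1 FA1 AG1 H1]]] := prob_regular mu mA (half_gt0 e0).
have [F2 [G2 [cF2 oG2 FA2 AG2 H2]]] := prob_regular nu mA (half_gt0 e0).
pose F := F1 `|` F2; pose G := G1 `&` G2.
have cF : closed F by exact: closedU.
have oG : open G by exact: openI.
have FA : F `<=` A by move=> y [/FA1|/FA2].
have AG : A `<=` G by move=> y Ay; split; [exact: AG1|exact: AG2].
have [u [uc u01 u1 u0]] := urysohn_fun Xcompact cF oG (subset_trans FA AG).
have mF := bmeas_closed cF; have mG := bmeas_open oG.
have small la F' G' : closed F' -> open G' -> F' `<=` F -> G `<=` G' ->
    pr la (G' `\` F') < e / 2 -> pr la G - pr la F < e / 2.
  move=> cF' oG' FF GG; apply: le_lt_trans; rewrite -prD//; last first.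
    exact: subset_trans AG.
  apply: pr_le; [exact: measurableD| |].
  - by apply: measurableD; [exact: bmeas_open|exact: bmeas_closed].
  - by move=> y [/GG ? nF]; split => // /FF.
have s1 : pr mu G - pr mu F < e / 2.
  by apply: small H1 => //; [exact: subsetUl|exact: subIsetl].
have s2 : pr nu G - pr nu F < e / 2.
  by apply: small H2 => //; [exact: subsetUr|exact: subIsetr].
have ufc : continuous (u \o f) by move=> y; apply: continuous_comp; [exact: fcont|exact: uc].
have /andP[a1 a2] := Rint_between Xcompact mu uc u01 mF mG u1 u0.
have : pr mu (f @^-1` F) <= Rint mu (u \o f) <= pr mu (f @^-1` G).
  apply: (@Rint_between _ _ Xcompact mu _ _ _ ufc _ (bmeas_preimage fcont mF)
    (bmeas_preimage fcont mG)) => [y|y|y] /=; [exact: u01|exact: u1|exact: u0].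
rewrite (Vlim_comp V uc) -!prnu => /andP[b1 b2].
have := pr_le mu mF mA FA; have := pr_le mu mA mG AG.
have := pr_le nu mF mA FA; have := pr_le nu mA mG AG.
by rewrite ler_norml => ? ? ? ?; apply/andP; split; lra.
Qed.

(* Along an ultrafilter finer than [\oo] all empirical averages converge; their
   limit is a positive functional, represented by a measure through [riesz]. *)
Lemma Vlim_nonempty x : Vlim f x !=set0.
Proof.
have [U [UU ooU]] := ultraFilterLemma (eventually_filter : ProperFilter \oo).
have lim_ex g : continuous g -> exists l : R, emp_integ f x n g @[n --> U] --> l.
  move=> gc; have [B B0 gB] := continuous_bounded Xcompact gc.
  have K := @segment_compact R (- B) B.
  have [] := K (emp_integ f x n g @[n --> U]).
    apply: (@filterE nat U _ [set n | emp_integ f x n g \in `[- B, B]]) => n /=.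
    have := emp_integ_bound x n gB; rewrite ler_norml => /andP[? ?].
    by rewrite in_itv/=; apply/andP.
  move=> l [_ cl]; exists l => A Al /=.
  have [//|UC] := in_ultra_setVsetC [set n | A (emp_integ f x n g)] UU.
  by have [y []] := cl (~` A) A UC Al.
have /choice[L HL] : forall g, exists l : R, continuous g -> emp_integ f x n g @[n --> U] --> l.
  move=> g; have [gc|ngc] := pselect (continuous g); last by exists 0.
  by have [l Hl] := lim_ex g gc; exists l.
have uniq g l : continuous g -> emp_integ f x n g @[n --> U] --> l -> L g = l.
  by move=> gc Hl; apply: (cvg_unique _ (HL g gc) Hl).
have [||||mu Hmu] := @riesz _ _ Xcompact L.
- move=> g h gc hc; apply: (uniq (fun x => g x + h x)); first exact: (continuous_add gc hc).
  rewrite (_ : (fun n => _) = (emp_integ f x)^~ g \+ (emp_integ f x)^~ h).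
    exact: cvgD (HL g gc) (HL h hc).
  by apply/funext => n; rewrite /emp_integ /= -mulrDr -big_split.
- move=> c g gc; apply: (uniq (fun x => c * g x)); first exact: (continuous_scale gc).
  rewrite (_ : (fun n => _) = (fun n => c * emp_integ f x n g)).
    by apply: cvgM; [exact: cvg_cst|exact: HL].
  by apply/funext => n; rewrite /emp_integ /= -mulr_sumr mulrCA.
- move=> g h gc hc gh; apply: (ler_cvg_to (HL g gc) (HL h hc)).
  near=> n; rewrite /emp_integ ler_wpM2l ?invr_ge0//; apply: ler_sum => i _.
  exact: gh.
- apply: (uniq (fun=> 1)); first by move=> y; exact: cvg_cst.
  apply: cvg_near_cst; apply: ooU.
  near=> n; rewrite /emp_integ sumr_const card_ord mulVf// pnatr_eq0.
  by rewrite -lt0n; near: n; exact: nbhs_infty_gt.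
exists mu => k gs e N gsc e0.
have : \forall n \near U, [/\ (N <= n)%N, (0 < n)%N &
    forall j, `|emp_integ f x n (gs j) - Rint mu (gs j)| < e].
  near=> n; split.
  - by near: n; apply: ooU; exact: nbhs_infty_ge.
  - by near: n; apply: ooU; exact: nbhs_infty_gt.
  - near: n; apply: filter_forall => j; rewrite Hmu//.
    have /cvgrPdist_lt/(_ _ e0) := HL _ (gsc j).
    by apply: filterS => n; rewrite distrC.
move=> /filter_ex[n [Nn n0 H]]; exists n; split => //; split => //.
Unshelve. all: by end_near. Qed.

End LimitMeasures.

(** * Entropy of partitions *)

Section Entropy.
Context {R : realType}.

Lemma phi0 : phi (0 : R) = 0.
Proof. by rewrite /phi mul0r oppr0. Qed.

Lemma phi_ge0 (a : R) : 0 <= a <= 1 -> 0 <= phi a.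
Proof.
move=> /andP[a0 a1]; rewrite /phi oppr_ge0 mulr_ge0_le0//.
exact: ln_le0.
Qed.

Lemma phi_subadd (a b : R) : 0 <= a -> 0 <= b -> phi (a + b) <= phi a + phi b.
Proof.
rewrite le_eqVlt => /predU1P[<-|a0]; first by rewrite phi0 !add0r.
rewrite le_eqVlt => /predU1P[<-|b0]; first by rewrite phi0 !addr0.
have h1 : ln a <= ln (a + b) by rewrite ler_ln ?posrE ?addr_gt0//; lra.
have h2 : ln b <= ln (a + b) by rewrite ler_ln ?posrE ?addr_gt0//; lra.
by rewrite /phi; nra.
Qed.

Lemma phi_sum (I : finType) (P : pred I) (a : I -> R) : (forall i, 0 <= a i) ->
  phi (\sum_(i | P i) a i) <= \sum_(i | P i) phi (a i).
Proof.
move=> a0; suff : 0 <= \sum_(i | P i) a i /\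
   phi (\sum_(i | P i) a i) <= \sum_(i | P i) phi (a i) by case.
elim/big_ind2: _ => [|x1 x2 y1 y2 [x0 Hx] [y0 Hy]|i _]; first by rewrite phi0.
  by split; [exact: addr_ge0|apply: le_trans (phi_subadd x0 y0) _; exact: lerD].
by split.
Qed.

(** Nonnegativity of the relative entropy of [p] with respect to the product of its marginals:
    [ln z <= z - 1] at [z = a i * b j / p (i, j)], with errors that sum to zero. *)
Lemma entropy_pair (I J : finType) (p : I * J -> R) : (forall x, 0 <= p x) ->
  \sum_x p x = 1 ->
  \sum_x phi (p x) <= \sum_i phi (\sum_j p (i, j)) + \sum_j phi (\sum_i p (i, j)).
Proof.
move=> p0 p1; pose a i := \sum_j p (i, j); pose b j := \sum_i p (i, j).
have a0 i : 0 <= a i by exact: sumr_ge0.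
have b0 j : 0 <= b j by exact: sumr_ge0.
have sp (F : I * J -> R) : \sum_x F x = \sum_i \sum_j F (i, j).
  by rewrite pair_bigA; apply: eq_bigr => -[].
have a1 : \sum_i a i = 1 by rewrite -sp.
have b1 : \sum_j b j = 1 by rewrite exchange_big -sp.
have -> : \sum_i phi (a i) = \sum_i \sum_j - (p (i, j) * ln (a i)).
  apply: eq_bigr => i _; rewrite sumrN -mulr_suml; congr (- _).
have -> : \sum_j phi (b j) = \sum_i \sum_j - (p (i, j) * ln (b j)).
  by rewrite exchange_big; apply: eq_bigr => j _; rewrite sumrN -mulr_suml.
have H i j : phi (p (i, j)) <= (- (p (i, j) * ln (a i)) - p (i, j) * ln (b j)) +
    (a i * b j - p (i, j)).
  have := p0 (i, j); rewrite le_eqVlt => /predU1P[p00|pij].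
    by rewrite -p00 phi0 !mul0r !oppr0 !addr0 add0r mulr_ge0.
  have ai : 0 < a i.
    by rewrite (lt_le_trans pij)// /a (bigD1 j)//= lerDl sumr_ge0.
  have bj : 0 < b j.
    by rewrite (lt_le_trans pij)// /b (bigD1 i)//= lerDl sumr_ge0.
  have h : ln (a i) + ln (b j) - ln (p (i, j)) <= a i * b j / p (i, j) - 1.
    rewrite -lnM ?posrE// -ln_div ?posrE ?mulr_gt0//.
    have := @le_ln1Dx R (a i * b j / p (i, j) - 1).
    by rewrite (addrC 1) subrK; apply; rewrite ltrBrDl subrr ?divr_gt0 ?mulr_gt0.
  have e : p (i, j) * (a i * b j / p (i, j) - 1) = a i * b j - p (i, j).
    by rewrite mulrBr mulr1 mulrC divfK ?gt_eqF.
  by have := ler_wpM2l (ltW pij) h; rewrite e /phi; lra.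
rewrite sp (le_trans (ler_sum _ (fun i _ => ler_sum _ (fun j _ => H i j))))//.
have E : \sum_i \sum_j (a i * b j - p (i, j)) = 0.
  under eq_bigr do rewrite sumrB -mulr_sumr b1 mulr1.
  by rewrite sumrB a1 subrr.
under eq_bigr do rewrite big_split/=.
rewrite big_split/= E addr0 -big_split/=; apply: ler_sum => i _.
by rewrite -big_split.
Qed.

(** The limit is the infimum of the quotients, which is why it bounds each of them from below. *)
Lemma fekete (a : nat -> R) : (forall n, 0 <= a n) ->
  (forall n m, a (n + m)%N <= a n + a m) ->
  exists2 l, a n.+1 / n.+1%:R @[n --> \oo] --> l &
    forall n, l <= a n.+1 / n.+1%:R.
Proof.
move=> a0 asub; pose S := range (fun n => a n.+1 / n.+1%:R).
have Sinf : has_inf S.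
  split; first by exists (a 1%N / 1%:R), 0%N.
  by exists 0 => _ [n _ <-]; rewrite divr_ge0.
have lb n : inf S <= a n.+1 / n.+1%:R by apply: ge_inf; [case: Sinf|exists n].
exists (inf S) => //; apply/cvgrPdist_lt => e e0.
have [_ [n _ <-] Hn] := inf_adherent (half_gt0 e0) Sinf.
have amul q m : a (q * m)%N <= q%:R * a m + a 0%N.
  elim: q => [|q IH]; first by rewrite mul0n mul0r add0r.
  rewrite mulSn (le_trans (asub _ _))// -[q.+1]addn1 natrD; lra.
(* [C] covers every possible remainder modulo [n + 1], and the [a 0] left over by [amul]. *)
pose C := a 0%N + \sum_(r < n.+1) a r.
have C0 : 0 <= C by rewrite addr_ge0// sumr_ge0.
have bound m : a m <= (m %/ n.+1)%:R * a n.+1 + C.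
  rewrite {1}(divn_eq m n.+1) (le_trans (asub _ _))//.
  have : a (m %% n.+1)%N <= \sum_(r < n.+1) a r.
    rewrite (bigD1 (Ordinal (ltn_pmod m (ltn0Sn n))))//= lerDl sumr_ge0//.
  by have := amul (m %/ n.+1)%N n.+1; rewrite /C; lra.
have [|K] := @ltr_add_invr R 0 (e / 2 / (C + 1)).
  by rewrite divr_gt0 ?half_gt0//; lra.
rewrite add0r => HK.
near=> m.
have Km : (K <= m)%N by near: m; exact: nbhs_infty_ge.
have m0 : 0 < (m.+1%:R : R) by rewrite ltr0n.
rewrite distrC ger0_norm ?subr_ge0//.
have h1 : a m.+1 / m.+1%:R <= a n.+1 / n.+1%:R + C / m.+1%:R.
  rewrite ler_pdivrMr// mulrDl divfK ?gt_eqF// (le_trans (bound _))// lerD2r.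
  rewrite mulrC -mulrA ler_wpM2l// mulrC ler_pdivlMr ?ltr0n//.
  by rewrite -natrM ler_nat leq_trunc_div.
have h2 : C / m.+1%:R < e / 2.
  apply: (@le_lt_trans _ _ ((C + 1) * K.+1%:R^-1)).
    apply: ler_pM => //; first by lra.
    by rewrite lef_pV2 ?posrE ?ltr0n// ler_nat.
  by rewrite mulrC -ltr_pdivlMr//; lra.
move: Hn h1 h2; move: (inf S) (a m.+1 / m.+1%:R) (a n.+1 / n.+1%:R) (C / m.+1%:R) => x y z t; lra.
Unshelve. all: by end_near. Qed.

End Entropy.

(** * Labellings and the entropy of their joins *)

Section Labels.
Context {R : realType} {X : pointedMetricType R}.
Local Notation Mp := (@Mprob R X).
Implicit Types (mu nu : Mp) (K J : finType).

(* A finite partition is encoded as a labelling [l : X -> K] with values in a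
   finite type; [word f l n] then labels the n-th join of the partition. *)
Definition mlab K (l : X -> K) : Prop := forall k, bmeas (l @^-1` [set k]).

Definition Hl K nu (l : X -> K) : R := \sum_k phi (pr nu (l @^-1` [set k])).

Definition word (f : X -> X) K (l : X -> K) n (x : X) : {ffun 'I_n -> K} :=
  [ffun i : 'I_n => l (iter i f x)].

Lemma preimage_lab K (l : X -> K) (P : pred K) :
  l @^-1` [set k | P k] = \bigcup_(k in [set k | P k]) (l @^-1` [set k]).
Proof.
by apply/seteqP; split=> [x Plx|x [k /= Pk lk]]; [exists (l x)|rewrite /= lk].
Qed.

Lemma mlab_pred K (l : X -> K) (P : pred K) : mlab l -> bmeas (l @^-1` [set k | P k]).
Proof. by move=> ml; rewrite preimage_lab; apply: bmeas_bigcup. Qed.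

Lemma lab_disj K (l : X -> K) k k' : k != k' ->
  l @^-1` [set k] `&` l @^-1` [set k'] = set0.
Proof.
move=> kk'; rewrite -subset0 => x [/= lk lk'].
by move: kk'; rewrite -lk -lk' eqxx.
Qed.

Lemma pr_lab K nu (l : X -> K) (P : pred K) : mlab l ->
  pr nu (l @^-1` [set k | P k]) = \sum_(k | P k) pr nu (l @^-1` [set k]).
Proof.
by move=> ml; rewrite preimage_lab pr_bigcup// => k k'; exact: lab_disj.
Qed.

Lemma pr_lab1 K nu (l : X -> K) : mlab l -> \sum_k pr nu (l @^-1` [set k]) = 1.
Proof.
move=> ml; rewrite -(pr_lab nu xpredT ml) -(prT nu); congr pr.
by apply/seteqP; split.
Qed.

Lemma pr_lab01 K nu (l : X -> K) k : mlab l -> 0 <= pr nu (l @^-1` [set k]) <= 1.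
Proof.
move=> ml; rewrite pr_ge0 -(prT nu) pr_le//; exact: bmeas_open openT.
Qed.

Lemma mlab_comp K J (h : K -> J) (l : X -> K) : mlab l -> mlab (h \o l).
Proof.
move=> ml j.
rewrite (_ : _ @^-1` _ = l @^-1` [set k | h k == j]); first exact: mlab_pred.
by apply/seteqP; split=> x /= /eqP.
Qed.

Lemma mlab_pair K J (l : X -> K) (l' : X -> J) : mlab l -> mlab l' ->
  mlab (fun x => (l x, l' x)).
Proof.
move=> ml ml' [k j].
rewrite (_ : _ @^-1` _ = l @^-1` [set k] `&` l' @^-1` [set j]).
  by apply: measurableI; [exact: ml|exact: ml'].
by apply/seteqP; split=> x /= [-> ->].
Qed.

Lemma mlab_iter (f : X -> X) K (l : X -> K) i : continuous f -> mlab l ->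
  mlab (l \o iter i f).
Proof.
by move=> fc ml k; apply: (bmeas_preimage (continuous_iter (n := i) fc) (ml k)).
Qed.

Lemma wordE (f : X -> X) K (l : X -> K) n (w : {ffun 'I_n -> K}) :
  word f l n @^-1` [set w] =
  \bigcap_(i in [set: 'I_n]) (iter i f @^-1` (l @^-1` [set (w i)])).
Proof.
apply/seteqP; split=> x /=.
  by move=> <- i _ /=; rewrite ffunE.
by move=> H; apply/ffunP => i; rewrite ffunE; exact: H.
Qed.

Lemma mlab_word (f : X -> X) K (l : X -> K) n : continuous f -> mlab l ->
  mlab (word f l n).
Proof.
move=> fc ml w; rewrite wordE; apply: bmeas_bigcap => i.
exact: (bmeas_preimage (continuous_iter (n := i) fc) (ml _)).
Qed.

Lemma Hl_ge0 K nu (l : X -> K) : mlab l -> 0 <= Hl nu l.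
Proof. by move=> ml; apply: sumr_ge0 => k _; rewrite phi_ge0// pr_lab01. Qed.

Lemma pr_comp K J nu (h : K -> J) (l : X -> K) j : mlab l ->
  pr nu ((h \o l) @^-1` [set j]) = \sum_(k | h k == j) pr nu (l @^-1` [set k]).
Proof.
move=> ml; rewrite -pr_lab//; congr pr.
by apply/seteqP; split=> x /= /eqP.
Qed.

Lemma Hl_refine K J nu (h : K -> J) (l : X -> K) : mlab l ->
  Hl nu (h \o l) <= Hl nu l.
Proof.
move=> ml; rewrite /Hl (partition_big h xpredT)//=; apply: ler_sum => j _.
by rewrite pr_comp//; apply: phi_sum => k; exact: pr_ge0.
Qed.

Lemma Hl_pair K J nu (l : X -> K) (l' : X -> J) : mlab l -> mlab l' ->
  Hl nu (fun x => (l x, l' x)) <= Hl nu l + Hl nu l'.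
Proof.
move=> ml ml'; have mp := mlab_pair ml ml'.
pose p (kj : K * J) := pr nu ((fun x => (l x, l' x)) @^-1` [set kj]).
have := @entropy_pair R K J p (fun=> pr_ge0 _ _) (pr_lab1 nu mp).
have -> : \sum_i phi (\sum_j p (i, j)) = Hl nu l.
  apply: eq_bigr => k _; congr phi.
  rewrite -[in RHS](_ : fst \o (fun x => (l x, l' x)) = l)// pr_comp//.
  rewrite (reindex_onto (fun j => (k, j)) snd) /=; last by move=> [a b] /= /eqP ->.
  by apply: eq_big => j; rewrite ?eqxx.
have -> : \sum_j phi (\sum_i p (i, j)) = Hl nu l'; last by [].
apply: eq_bigr => k _; congr phi.
rewrite -[in RHS](_ : snd \o (fun x => (l x, l' x)) = l')// pr_comp//.
rewrite (reindex_onto (fun i => (i, k)) fst) /=; last by move=> [a b] /= /eqP ->.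
by apply: eq_big => i; rewrite ?eqxx.
Qed.

Lemma pr_iter (f : X -> X) nu (A : set X) n : continuous f -> Minv f nu ->
  bmeas A -> pr nu (iter n f @^-1` A) = pr nu A.
Proof.
move=> fc inv mA; elim: n => [//|n IH].
rewrite -IH /pr -(inv (iter n f @^-1` A)); last first.
  exact: (bmeas_preimage (continuous_iter (n := n) fc) mA).
congr (fine (nu _)); apply/seteqP; split=> x /=; by rewrite -iterSr.
Qed.

Lemma Hl_iter (f : X -> X) nu K (l : X -> K) n : continuous f -> Minv f nu ->
  mlab l -> Hl nu (l \o iter n f) = Hl nu l.
Proof.
by move=> fc inv ml; apply: eq_bigr => k _; rewrite -(pr_iter n fc inv (ml k)).
Qed.

(** The long word is a recoding of the pair formed by the first [n] letters and the word of length
    [m] read after [n] steps; by invariance the latter has the entropy of the unshifted word. *)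
Lemma Hl_word_sub (f : X -> X) nu K (l : X -> K) n m : continuous f ->
  Minv f nu -> mlab l ->
  Hl nu (word f l (n + m)) <= Hl nu (word f l n) + Hl nu (word f l m).
Proof.
move=> fc inv ml.
pose h (w : {ffun 'I_n -> K} * {ffun 'I_m -> K}) : {ffun 'I_(n + m) -> K} :=
  [ffun i : 'I_(n + m) => match fintype.split i with inl a => w.1 a | inr b => w.2 b end].
have -> : word f l (n + m) = h \o (fun x => (word f l n x, word f l m (iter n f x))).
  apply/funext => x /=; apply/ffunP => i; rewrite !ffunE.
  case: splitP => j -> /=; rewrite ffunE//.
  by rewrite -iterD addnC.
have mn : mlab (word f l n) by exact: mlab_word.
have mm : mlab (word f l m) by exact: mlab_word.
have mm' : mlab (word f l m \o iter n f) by exact: mlab_iter.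
rewrite (le_trans (Hl_refine _ _ (mlab_pair mn mm')))//.
rewrite (le_trans (Hl_pair _ mn mm'))// lerD2l.
by rewrite (Hl_iter n fc inv mm).
Qed.

Lemma Hl_word_limit (f : X -> X) nu K (l : X -> K) : continuous f ->
  Minv f nu -> mlab l ->
  exists2 h : R, Hl nu (word f l n.+1) / n.+1%:R @[n --> \oo] --> h &
    forall n, h <= Hl nu (word f l n.+1) / n.+1%:R.
Proof.
move=> fc inv ml; apply: (@fekete R (fun n => Hl nu (word f l n))) => [n|n m].
  by apply: Hl_ge0; apply: mlab_word.
exact: (Hl_word_sub n m fc inv ml).
Qed.

Lemma partition_label k (P : 'I_k -> set X) : is_partition P ->
  exists l : X -> 'I_k, mlab l /\ forall j, P j = l @^-1` [set j].
Proof.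
move=> [mP [dP cP]].
have /choice[l Hl] : forall x, exists j, P j x.
  by move=> x; have : setT x by []; rewrite -cP => -[j _ Pj]; exists j.
have PE j : P j = l @^-1` [set j].
  apply/seteqP; split=> x /= => [Pjx|<-//].
  apply/eqP/negPn/negP => /dP; rewrite -subset0 => /(_ x); apply.
  by split => //; exact: Hl.
by exists l; split => // j; rewrite -PE; exact: mP.
Qed.

Lemma label_partition k (l : X -> 'I_k) : mlab l ->
  is_partition (fun j => l @^-1` [set j]).
Proof.
move=> ml; split; [exact: ml|split => [j j'|]]; first exact: lab_disj.
by apply/seteqP; split=> // x _; exists (l x).
Qed.

Lemma Hjoin_label (f : X -> X) nu k (P : 'I_k -> set X) (l : X -> 'I_k) n :
  (forall j, P j = l @^-1` [set j]) -> Hjoin f nu P n = Hl nu (word f l n).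
Proof.
move=> PE; apply: eq_bigr => w _; rewrite wordE /pr; congr (phi (fine (nu _))).
by apply: eq_bigcapr => i _; rewrite PE.
Qed.

(** The limit is an infimum. The first half serves the lower bound, where the word length is
    dictated by other constants; the second serves the upper bound, where one good length
    suffices. *)
Lemma hpart_label (f : X -> X) nu k (P : 'I_k -> set X) (l : X -> 'I_k) :
  continuous f -> Minv f nu -> mlab l -> (forall j, P j = l @^-1` [set j]) ->
  (forall n, hpart f nu P <= Hl nu (word f l n.+1) / n.+1%:R) /\
  (forall t, hpart f nu P < t -> exists n, Hl nu (word f l n.+1) / n.+1%:R < t).
Proof.
move=> fc inv ml PE; have [h hcvg hle] := Hl_word_limit fc inv ml.
have -> : hpart f nu P = h.
  apply/cvg_lim => //; under eq_fun do rewrite (Hjoin_label _ _ _ PE).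
  exact: hcvg.
split=> // t; rewrite -subr_gt0 => th.
have /cvgrPdist_lt/(_ _ th)[N _ /(_ N)/=] := hcvg.
rewrite leqnn distrC => /(_ isT) /(le_lt_trans (ler_norm _)) H.
by exists N; move: H; rewrite ltrD2r.
Qed.

Lemma hmeas_ge0 (f : X -> X) nu : continuous f -> Minv f nu ->
  (0 <= hmeas f nu)%E.
Proof.
move=> fc inv; pose l := fun _ : X => ord0 : 'I_1.
have ml : mlab l.
  move=> k; rewrite (_ : _ @^-1` _ = setT); first exact: bmeas_open openT.
  by apply/seteqP; split=> x //= _; rewrite (ord1 k).
apply: (@le_trans _ _ (hpart f nu (fun j => l @^-1` [set j]))%:E); last first.
  apply: ereal_sup_ubound; exists 1%N, (fun j => l @^-1` [set j]); split => //.
  exact: label_partition.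
rewrite lee_fin leNgt; apply/negP.
have [_ /[apply] [[n]]] := hpart_label fc inv ml (fun=> erefl).
by apply/negP; rewrite -leNgt divr_ge0//; apply: Hl_ge0; apply: mlab_word.
Qed.

End Labels.

(** * Bowen entropy *)

Section BowenMeasure.
Context {R : realType} {X : pointedMetricType R}.
Variable f : X -> X.
Implicit Types (Z : set X) (s eps : R) (N : nat).

Lemma cover_cost_ge0 s (c : option (X * nat)) : (0 <= cover_cost s c)%E.
Proof. by case: c => [[x n]|] //=; rewrite lee_fin expR_ge0. Qed.

Lemma mBowen_ge0 Z s N eps : (0 <= mBowen f Z s N eps)%E.
Proof.
apply: le_ereal_inf_tmp => _ [c [_ ->]]; apply: nneseries_ge0 => n _ _.
exact: cover_cost_ge0.
Qed.

Lemma mBowen_leN Z s N M eps : (N <= M)%N -> (mBowen f Z s N eps <= mBowen f Z s M eps)%E.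
Proof.
move=> NM; apply: ereal_inf_le_tmp => _ [c [[cN cZ] ->]]; exists c; split => //.
by split => // i x n /cN; exact: leq_trans.
Qed.

Lemma mBowen_leZ Z Z' s N eps : Z `<=` Z' -> (mBowen f Z s N eps <= mBowen f Z' s N eps)%E.
Proof.
move=> ZZ; apply: ereal_inf_le_tmp => _ [c [[cN cZ] ->]]; exists c; split => //.
by split => //; exact: subset_trans cZ.
Qed.

Lemma Bball_le n (x : X) (eps eps' : R) : eps <= eps' -> Bball f n x eps `<=` Bball f n x eps'.
Proof. by move=> ee y xy i /xy /lt_le_trans; exact. Qed.

Lemma mBowen_leeps Z s N (eps eps' : R) : eps <= eps' ->
  (mBowen f Z s N eps' <= mBowen f Z s N eps)%E.
Proof.
move=> ee; apply: ereal_inf_le_tmp => _ [c [[cN cZ] ->]]; exists c; split => //.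
split => // y /cZ[i _ ciy]; exists i => //.
by move: ciy; rewrite /cover_ball; case: (c i) => [[x n]|//]; exact: Bball_le.
Qed.

Lemma mBowen_les Z s s' N eps : s <= s' -> (mBowen f Z s' N eps <= mBowen f Z s N eps)%E.
Proof.
move=> ss; apply: le_ereal_inf_tmp => _ [c [cZ ->]].
apply: (@le_trans _ _ (\sum_(i <oo) cover_cost s' (c i))%E).
  by apply: ereal_inf_lbound; exists c.
apply: lee_nneseries => [n _ _|n _]; first exact: cover_cost_ge0.
case: (c n) => [[x m]|] //=.
by rewrite lee_fin ler_expR lerN2 ler_wpM2l.
Qed.

Lemma mBowen_lim_cvg Z s eps :
  mBowen f Z s N eps @[N --> \oo] --> ereal_sup (range (fun N => mBowen f Z s N eps)).
Proof. by apply: ereal_nondecreasing_cvgn => N M; exact: mBowen_leN. Qed.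

Lemma mBowen_limE Z s eps :
  mBowen_lim f Z s eps = ereal_sup (range (fun N => mBowen f Z s N eps)).
Proof. by apply/cvg_lim => //; exact: mBowen_lim_cvg. Qed.

Lemma mBowen_lim0 Z s eps :
  (forall N, (mBowen f Z s N eps <= 0)%E) -> mBowen_lim f Z s eps = 0%E.
Proof.
move=> H; rewrite mBowen_limE; apply/eqP; rewrite eq_le; apply/andP; split.
  by apply: ge_ereal_sup => _ [N _ <-].
by apply: le_trans (mBowen_ge0 Z s 0 eps) _; apply: ereal_sup_ubound; exists 0%N.
Qed.

Lemma mBowen_le_lim Z s N eps : (mBowen f Z s N eps <= mBowen_lim f Z s eps)%E.
Proof. by rewrite mBowen_limE; apply: ereal_sup_ubound; exists N. Qed.

Lemma htop_le Z s eps : (forall N, (mBowen f Z s N eps <= 0)%E) ->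
  (htop_eps f Z eps <= s%:E)%E.
Proof.
by move=> H; apply: ereal_inf_lbound; exists s; split => //; exact: mBowen_lim0.
Qed.

Lemma htop_ge Z s N eps : (0 < mBowen f Z s N eps)%E -> (s%:E <= htop_eps f Z eps)%E.
Proof.
move=> H; apply: le_ereal_inf_tmp => _ [s' [H0 ->]]; rewrite lee_fin leNgt.
apply/negP => s's; have := mBowen_le_lim Z s' N eps; rewrite H0.
move/(le_trans (mBowen_les _ _ _ (ltW s's))) => /(lt_le_trans H).
by rewrite ltxx.
Qed.

Lemma htop_leeps Z (eps eps' : R) : eps <= eps' ->
  (htop_eps f Z eps' <= htop_eps f Z eps)%E.
Proof.
move=> ee; apply: ereal_inf_le_tmp => _ [s [H0 ->]]; exists s; split => //.
apply: mBowen_lim0 => N; rewrite -H0.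
exact: le_trans (mBowen_leeps _ _ _ ee) (mBowen_le_lim _ _ _ _).
Qed.

Lemma htop_leZ Z Z' eps : Z `<=` Z' -> (htop_eps f Z eps <= htop_eps f Z' eps)%E.
Proof.
move=> ZZ; apply: ereal_inf_le_tmp => _ [s [H0 ->]]; exists s; split => //.
apply: mBowen_lim0 => N; rewrite -H0.
exact: le_trans (mBowen_leZ _ _ _ ZZ) (mBowen_le_lim _ _ _ _).
Qed.

(** [htop_eps] does not increase with [eps], so the limit at [0+] is a supremum, and a lower bound
    at a single scale is enough. *)
Lemma hBowenE Z : hBowen f Z = ereal_sup [set htop_eps f Z eps | eps in `]0, +oo[].
Proof.
apply/cvg_lim => //; apply: (@nonincreasing_at_right_cvge _ _ _ +oo%O) => //.
by move=> e e' _ _; exact: htop_leeps.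
Qed.

Lemma hBowen_le Z (c : \bar R) : (forall eps, 0 < eps -> (htop_eps f Z eps <= c)%E) ->
  (hBowen f Z <= c)%E.
Proof.
move=> H; rewrite hBowenE; apply: ge_ereal_sup => _ [e + <-].
by rewrite /= in_itv/= andbT => /H.
Qed.

Lemma hBowen_ge Z eps : 0 < eps -> (htop_eps f Z eps <= hBowen f Z)%E.
Proof.
move=> e0; rewrite hBowenE; apply: ereal_sup_ubound; exists eps => //.
by rewrite /= in_itv/= e0.
Qed.

Lemma hBowen_leZ Z Z' : Z `<=` Z' -> (hBowen f Z <= hBowen f Z')%E.
Proof.
move=> ZZ; apply: hBowen_le => e e0.
exact: le_trans (htop_leZ _ ZZ) (hBowen_ge _ e0).
Qed.

(** Nearly optimal covers with errors [e / 2 ^ (i + 1)] are merged along a bijection between [nat]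
    and [nat * nat]. *)
Lemma mBowen_bigcup (Z : nat -> set X) (b : nat -> R) s N eps :
  (forall i, (mBowen f (Z i) s N eps <= (b i)%:E)%E) -> (forall i, 0 <= b i) ->
  (mBowen f (\bigcup_i Z i) s N eps <= \sum_(i <oo) (b i)%:E)%E.
Proof.
move=> Hb b0; apply/lee_addgt0Pr => e e0.
apply: le_trans (epsilon_trick xpredT _ (ltW e0)); last by move=> n; rewrite lee_fin.
have /choice[c Hc] : forall i, exists c, is_cover f (Z i) N eps c /\
    (\sum_(k <oo) cover_cost s (c k) <= (b i)%:E + (e / (2 ^ i.+1)%:R)%:E)%E.
  move=> i; have ei : 0 < e / (2 ^ i.+1)%:R by rewrite divr_gt0// ltr0n expn_gt0.
  have : (mBowen f (Z i) s N eps < (b i)%:E + (e / (2 ^ i.+1)%:R)%:E)%E.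
    by rewrite (le_lt_trans (Hb i))// -EFinD lte_fin ltrDl.
  by move=> /ereal_inf_lt[_ [c [cZ ->]] /ltW H]; exists c.
have /card_esym/ppcard_eqP[g] := card_nat2.
apply: (@le_trans _ _ (\sum_(k <oo) cover_cost s (c (g k).1 (g k).2))%E).
  apply: ereal_inf_lbound; exists (fun k => c (g k).1 (g k).2); split => //; split.
    by move=> k x n; have [[cN _] _] := Hc (g k).1; exact: cN.
  move=> y [i _ Ziy]; have [[_ /(_ y Ziy)[j _ cij]] _] := Hc i.
  by exists (g^-1%FUN (i, j)) => //=; rewrite invK ?inE.
apply: (@le_trans _ _ (\sum_(i <oo) \sum_(k <oo) cover_cost s (c i k))%E); last first.
  apply: lee_nneseries => [n _ _|n _]; last by case: (Hc n).
  by apply: nneseries_ge0 => k _ _; exact: cover_cost_ge0.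
rewrite nneseries_esumT; last by move=> k; exact: cover_cost_ge0.
rewrite [leRHS]nneseries_esumT; last first.
  by move=> i; apply: nneseries_ge0 => k _ _; exact: cover_cost_ge0.
rewrite [leRHS](eq_esum (b := fun i => (\esum_(j in [set: nat]) cover_cost s (c i j))%E)).
  rewrite esum_esum; last by move=> *; exact: cover_cost_ge0.
  rewrite (@reindex_esum R _ _ setT (setT `*`` (fun=> setT)) g)//.
  split=> [k _ //|k k' _ _ /(@inj _ _ _ g)->//|[i j] _]; rewrite ?inE//.
  by exists (g^-1%FUN (i, j)) => //; rewrite invK ?inE.
by move=> i _; rewrite nneseries_esumT// => k; exact: cover_cost_ge0.
Qed.

Lemma mBowen_bigcup0 (Z : nat -> set X) s N eps :
  (forall i, (mBowen f (Z i) s N eps <= 0)%E) ->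
  (mBowen f (\bigcup_i Z i) s N eps <= 0)%E.
Proof.
move=> H; apply: le_trans (mBowen_bigcup (b := fun=> 0) H _) _ => //.
by rewrite eseries0 //.
Qed.

Lemma mBowen_finite Z (T : finType) (P : pred T) (c : T -> X) n s N eps : (N <= n)%N ->
  Z `<=` \bigcup_(t in [set t | P t]) Bball f n (c t) eps ->
  (mBowen f Z s N eps <= (#|P|%:R * expR (- (n%:R * s)))%:E)%E.
Proof.
move=> Nn cZ.
(* The finitely many balls come first; the rest of the sequence is [None], which costs nothing. *)
pose C k := nth None [seq Some (c t, n) | t <- enum P] k.
apply: (@le_trans _ _ (\sum_(k <oo) cover_cost s (C k))%E).
  apply: ereal_inf_lbound; exists C; split => //; split => [k x m|y /cZ[t /= Pt yt]].
    rewrite /C; case: (ltnP k (size (enum P))) => kP; last first.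
      by rewrite nth_default// size_map.
    case: (enum P) kP => // t0 l kP.
    by rewrite (nth_map t0)// => -[_ <-].
  exists (index t (enum P)) => //=; rewrite /C (nth_map t) ?nth_index ?mem_enum//.
  by rewrite index_mem mem_enum.
rewrite (nneseries_split _ #|P|); last by move=> k _; exact: cover_cost_ge0.
rewrite [X in (_ + X)%E]eseries0 ?adde0; last first.
  by move=> k; rewrite add0n => Pk _; rewrite /C nth_default// size_map -cardE.
rewrite add0n big_mkord.
apply: (@le_trans _ _ (\sum_(k < #|P|) (expR (- (n%:R * s)))%:E)%E).
  apply: lee_sum => k _; rewrite /C.
  case: (enum P) => [|t0 l]; first by rewrite /= nth_nil/= lee_fin expR_ge0.
  case: (ltnP k (size (t0 :: l))) => kP; first by rewrite (nth_map t0).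
  by rewrite nth_default ?size_map//= lee_fin expR_ge0.
by rewrite sumEFin sumr_const card_ord -[expR _ *+ _]mulr_natl.
Qed.

End BowenMeasure.

(** * The upper bound *)

Section Upper.
Context {R : realType} {X : pointedMetricType R}.
Local Notation Mp := (@Mprob R X).
Hypothesis Xcompact : compact [set: X].
Variable f : X -> X.
Hypothesis fcont : continuous f.

(** The label is the membership pattern in finitely many balls of radius [r / 2] that cover the
    space: equal patterns mean a common ball. *)
Lemma small_label (r : R) : 0 < r -> exists k (l : X -> 'I_k), mlab l /\
  forall x y, l x = l y -> mdist x y < r.
Proof.
move=> r0; have [s Hs] := finite_net Xcompact (fun=> half_gt0 r0).
pose B (x : X) : {ffun 'I_(size s) -> bool} :=
  [ffun i : 'I_(size s) => mdist (nth point s i) x < r / 2].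
have mB : mlab B.
  move=> b; rewrite (_ : _ @^-1` _ = \bigcap_(i in [set: 'I_(size s)])
      (if b i then [set x | mdist (nth point s i) x < r / 2]
       else ~` [set x | mdist (nth point s i) x < r / 2])).
    apply: bmeas_bigcap => i; case: ifP => _; last apply: bmeasC.
      by apply: bmeas_open; exact: open_mdist.
    by apply: bmeas_open; exact: open_mdist.
  apply/seteqP; split=> x /=.
    by move=> <- i _; rewrite ffunE; case: ifP => //= ->.
  move=> H; apply/ffunP => i; rewrite ffunE; have := H i I.
  by case: (b i) => //= /negP/negbTE.
exists #|{: {ffun 'I_(size s) -> bool}}|, (enum_rank \o B); split.
  exact: mlab_comp.
move=> x y /= /enum_rank_inj Bxy; have [c cs cx] := Hs x.
have cs' : (index c s < size s)%N by rewrite index_mem.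
have := cx; have /ffunP/(_ (Ordinal cs')) := Bxy; rewrite !ffunE /= nth_index//.
move=> -> cy; have := mdist_tri x c y; rewrite (mdist_symm x c); lra.
Qed.

(* Shannon code: costs [- ln p], rounded up to multiples of [tau] so that only
   countably many cost functions occur. *)
Lemma code_lengths (W : finType) (p : W -> R) (tau : R) : (forall w, 0 <= p w) ->
  \sum_w p w = 1 -> 0 < tau ->
  exists k : W -> nat, \sum_w expR (- (tau * (k w)%:R)) <= 1 /\
    \sum_w p w * (tau * (k w)%:R) <= \sum_w phi (p w) + 2 * tau.
Proof.
move=> p0 p1 t0.
have W0 : (0 < #|W|)%N.
  rewrite lt0n; apply/eqP => W0; move: p1; rewrite big_pred0 => [/eqP|w].
    by rewrite eq_sym oner_eq0.
  by have := card0_eq W0 w; rewrite inE.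
have W0' : 0 < (#|W|%:R : R) by rewrite ltr0n.
(* Adding [th] to each weight keeps words of measure zero at a finite cost and adds total mass
   [tau]. Normalisation then costs [ln (1 + tau) <= tau], and rounding up another [tau]. *)
pose th := tau / #|W|%:R.
have th0 : 0 < th by rewrite divr_gt0.
have Wth : #|W|%:R * th = tau by rewrite /th mulrC divfK ?gt_eqF.
pose p' w := (p w + th) / (1 + tau).
have p'0 w : 0 < p' w by rewrite divr_gt0//; [have := p0 w|]; lra.
have p'1 : \sum_w p' w = 1.
  rewrite -mulr_suml big_split/= p1 sumr_const -[th *+ _]mulr_natl Wth divff// gt_eqF//; lra.
have p'le w : p' w <= 1.
  by rewrite -p'1 (bigD1 w)//= lerDl sumr_ge0// => v _; exact: ltW.
have a0 w : 0 <= - ln (p' w) / tau.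
  by rewrite divr_ge0 ?(ltW t0)// oppr_ge0 ln_le0.
pose k w := (Num.truncn (- ln (p' w) / tau)).+1.
have k1 w : - ln (p' w) <= tau * (k w)%:R.
  rewrite mulrC -ler_pdivrMr// ltW//.
  by have /andP[_] := truncn_itv (a0 w).
have k2 w : tau * (k w)%:R <= - ln (p' w) + tau.
  rewrite /k -[_.+1]addn1 natrD mulrDr mulr1 lerD2r mulrC -ler_pdivlMr//.
  by have /andP[] := truncn_itv (a0 w).
exists k; split.
  rewrite -[leRHS]p'1; apply: ler_sum => w _.
  apply: (@le_trans _ _ (expR (ln (p' w)))); last by rewrite lnK ?posrE.
  by rewrite ler_expR lerNl; exact: k1.
have H w : p w * (tau * (k w)%:R) <= phi (p w) + p w * (2 * tau).
  have := p0 w; rewrite le_eqVlt => /predU1P[<-|pw].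
    by rewrite phi0 !mul0r addr0.
  rewrite /phi addrC -mulrN -mulrDr ler_pM2l//.
  rewrite (le_trans (k2 w))// /p' ln_div ?posrE; [|lra|lra].
  have h1 : ln (1 + tau) <= tau by apply: le_ln1Dx; lra.
  have h2 : ln (p w) <= ln (p w + th) by rewrite ler_ln ?posrE; lra.
  lra.
rewrite (le_trans (ler_sum _ (fun w _ => H w)))//.
by rewrite big_split/= -mulr_suml p1 mul1r.
Qed.

Lemma continuous_minr (g h : X -> R) : continuous g -> continuous h ->
  continuous (fun x => Num.min (g x) (h x)).
Proof.
move=> /continuousP_mdist gc /continuousP_mdist hc; apply/continuousP_mdist.
move=> x e e0; have [d d0 H] := gc x e e0; have [d' d'0 H'] := hc x e e0.
exists (Num.min d d'); first by rewrite lt_min d0.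
move=> y; rewrite lt_min => /andP[/H + /H'].
rewrite !ltr_norml => /andP[? ?] /andP[? ?]; rewrite /Order.min.
by case: (ltP (g x)) => ?; case: (ltP (g y)) => ?; apply/andP; split; lra.
Qed.

(* The cost of the code word of [y] is only measurable in [y]; weak* limits need a
   continuous majorant [psi], obtained by regularity, at the price of replacing [y]
   by a [rho]-close point. *)
Lemma cost_function (nu : Mp) (W : finType) (g : X -> W) (c : W -> R) (rho eta : R) :
  mlab g -> (forall w, 0 <= c w) -> 0 < rho -> 0 < eta ->
  exists psi : X -> R, [/\ continuous psi, (forall y, 0 <= psi y),
    (forall y, exists w, c w <= psi y /\ exists2 z, g z = w & mdist y z < rho) &
    Rint nu psi <= \sum_w pr nu (g @^-1` [set w]) * c w + eta].
Proof.
move=> mg c0 rho0 eta0.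
pose B := \sum_w c w.
have cB w : c w <= B by rewrite /B (bigD1 w)//= lerDl sumr_ge0.
have B0 : 0 <= B by exact: sumr_ge0.
(* So small that the exceptional sets, where [psi] is only known to be at most [B], contribute at
   most [eta] in total. *)
pose gam := eta / (B * #|W|%:R + 1).
have D0 : 0 < B * #|W|%:R + 1 by rewrite ltr_wpDl// mulr_ge0.
have gam0 : 0 < gam by rewrite divr_gt0.
have /choice[C HC] : forall w, exists C, [/\ closed C, C `<=` g @^-1` [set w] &
    pr nu (g @^-1` [set w] `\` C) < gam].
  move=> w; have [F [G [cF oG FA AG H]]] := prob_regular nu (mg w) gam0.
  exists F; split => //; apply: le_lt_trans H; apply: pr_le.
  - by apply: measurableD; [exact: mg|exact: bmeas_closed].
  - by apply: measurableD; [exact: bmeas_open|exact: bmeas_closed].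
  - by move=> x [/AG].
pose O w := \bigcup_(z in C w) [set y | mdist z y < rho].
have oO w : open (O w) by apply: bigcup_open => z _; exact: open_mdist.
have CO w : C w `<=` O w by move=> z Cz; exists z => //=; rewrite mdistxx.
have cC w : closed (C w) by case: (HC w).
have /choice[u Hu] w := urysohn_fun Xcompact (cC w) (oO w) (CO w).
(* Equal to [c w] on the closed core [C w] and to the upper bound [B] of all costs off its
   neighbourhood [O w]. *)
pose ps w x := B + (c w - B) * u w x.
pose psi x := \big[Num.min/B]_(w : W) ps w x.
have u01 w x : 0 <= u w x <= 1 by have [_ + _ _] := Hu w; apply.
have psc w x : c w <= ps w x.
  by rewrite /ps; have := cB w; have /andP[] := u01 w x; nra.
exists psi; split.
- rewrite /psi; elim: (index_enum W) => [|w s IH].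
    by under eq_fun do rewrite big_nil; move=> x; exact: cvg_cst.
  under eq_fun do rewrite big_cons; apply: continuous_minr => //.
  rewrite /ps => x; apply: cvgD; first exact: cvg_cst.
  by apply: cvgM; [exact: cvg_cst|have [+ _ _ _] := Hu w; exact].
- move=> y; rewrite /psi; apply: (big_ind (fun v => 0 <= v)) => // [a b a0 b0|w _].
    by rewrite le_min a0.
  exact: le_trans (psc w y).
- move=> y; rewrite /psi.
  have QB : exists w, c w <= B /\ exists2 z, g z = w & mdist y z < rho.
    by exists (g y); split => //; exists y; rewrite ?mdistxx.
  elim/big_ind: _ => // [a b Ha Hb|w _].
    by rewrite /Order.min; case: ifP.
  have [Oy|nOy] := pselect (O w y).
    have [z Cz /= zy] := Oy; exists w; split => //; exists z.
      by have [_ + _] := HC w; apply.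
    by rewrite mdist_symm.
  by have [_ _ _ H] := Hu w; rewrite /ps (H _ nOy) mulr0 addr0.
pose A (wb : W * bool) := if wb.2 then C wb.1 else g @^-1` [set wb.1] `\` C wb.1.
pose v (wb : W * bool) := if wb.2 then c wb.1 else B.
have Ag wb x : A wb x -> g x = wb.1.
  case: wb => w [] /=; rewrite /A/=; first by have [_ + _] := HC w; apply.
  by case.
have psc_ic : continuous psi.
  rewrite /psi; elim: (index_enum W) => [|w s IH].
    by under eq_fun do rewrite big_nil; move=> x; exact: cvg_cst.
  under eq_fun do rewrite big_cons; apply: continuous_minr => //.
  rewrite /ps => x; apply: cvgD; first exact: cvg_cst.
  by apply: cvgM; [exact: cvg_cst|have [+ _ _ _] := Hu w; exact].
have psB x : psi x <= B.
  rewrite /psi; elim: (index_enum W) => [|w s IH]; first by rewrite big_nil.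
  by rewrite big_cons ge_min IH orbT.
have psw w x : psi x <= ps w x.
  by rewrite /psi (bigD1 w)//= ge_min lexx.
have := @Rint_le_sum _ _ Xcompact _ nu psi A v psc_ic.
move=> /(_ _ _ _ _)/le_trans; apply.
- case=> w [] /=; rewrite /A/=; first exact: bmeas_closed.
  by apply: measurableD; [exact: mg|exact: bmeas_closed].
- move=> [w b] [w' b'] ne; rewrite -subset0 => x [Ax Ax'].
  have /= e := Ag _ _ Ax; have /= e' := Ag _ _ Ax'.
  move: ne Ax Ax'; rewrite -e -e' /A /= xpair_eqE eqxx /=.
  by case: b b' => -[] //= _; [move=> Cx []|move=> [_ nC] /nC].
- move=> x; have [Cx|nCx] := pselect (C (g x) x); first by exists (g x, true).
  by exists (g x, false).
- case=> w [] x; rewrite /A /v /=.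
    move=> Cx; apply: le_trans (psw w x) _.
    by have [_ _ H _] := Hu w; rewrite /ps (H _ Cx) mulr1 addrC subrK.
  by move=> _; exact: psB.
have -> : \sum_i v i * pr nu (A i) = \sum_w (c w * pr nu (C w) +
    B * pr nu (g @^-1` [set w] `\` C w)).
  under [RHS]eq_bigr do rewrite -(big_bool _ (fun b => v (_, b) * pr nu (A (_, b)))).
  by rewrite pair_bigA; apply: eq_bigr => -[].
rewrite big_split/=; apply: lerD.
  apply: ler_sum => w _; rewrite mulrC ler_wpM2r//.
  by apply: (pr_le nu (bmeas_closed (cC w)) (mg w)); case: (HC w).
rewrite -mulr_sumr.
apply: (@le_trans _ _ (B * \sum_(w : W) gam)).
  by rewrite ler_wpM2l//; apply: ler_sum => w _; case: (HC w) => _ _ /ltW.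
rewrite sumr_const -[gam *+ _]mulr_natl mulrA /gam mulrA ler_pdivrMr// mulrC.
rewrite ler_pM2l//; lra.
Qed.

(** Kraft's inequality is multiplicative under concatenation, and each counted sequence contributes
    at least [expR (- T)] to the product. *)
Lemma Kraft_count (W : finType) (c : W -> R) q (T : R) :
  \sum_w expR (- c w) <= 1 ->
  #|[pred s : {ffun 'I_q -> W} | \sum_j c (s j) <= T]|%:R <= expR T.
Proof.
move=> Hc.
have E : \sum_(s : {ffun 'I_q -> W}) expR (- \sum_j c (s j)) <= 1.
  have -> : \sum_(s : {ffun 'I_q -> W}) expR (- \sum_j c (s j)) =
      \prod_(j < q) \sum_w expR (- c w).
    rewrite bigA_distr_bigA; apply: eq_bigr => s _.
    by rewrite -sumrN expR_sum.
  rewrite prodr_const; apply: exprn_ile1 => //.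
  by apply: sumr_ge0 => w _; exact: expR_ge0.
rewrite -[leRHS]mulr1 -(ler_pM2l (expR_gt0 (- T))) mulrA -expRD addrC subrr expR0 mul1r.
apply: le_trans E; rewrite mulrC mulr_natl -sumr_const.
rewrite [leRHS](bigID (fun s : {ffun 'I_q -> W} => \sum_j c (s j) <= T))/=.
rewrite ler_wpDr//; first by apply: sumr_ge0 => s _; exact: expR_ge0.
by apply: ler_sum => s; rewrite inE ler_expR lerN2.
Qed.

End Upper.

(** * Coded orbits and the upper bound *)

Section UpperMain.
Context {R : realType} {X : pointedMetricType R}.
Local Notation Mp := (@Mprob R X).
Hypothesis Xcompact : compact [set: X].
Variable f : X -> X.
Hypothesis fcont : continuous f.

Section OneScale.
Variables (eps : R) (k : nat) (l : X -> 'I_k).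
Hypotheses (eps0 : 0 < eps) (ml : mlab l)
  (lsmall : forall x y, l x = l y -> mdist x y < eps / 8).
Local Notation W n := {ffun 'I_n -> 'I_k}.

(** The auxiliary point [z] is there because [cost_function] yields the code word of a point close
    to [y], not of [y] itself. *)
Definition near_word n (w : W n) : set X := [set y | exists z,
  word f l n z = w /\ forall i, (i < n)%N -> mdist (iter i f y) (iter i f z) < eps / 8].

(* For one of the [n] phases [r], the orbit of [x] cut into [q] consecutive words of
   length [n] is described at total cost at most [(q + 1) n t]. *)
Definition coded n (c : W n -> R) (t : R) (q : nat) : set X :=
  [set x | exists (r : 'I_n) (s : {ffun 'I_q -> W n}),
    \sum_j c (s j) <= (q.+1 * n)%:R * t /\
    forall j, near_word (s j) (iter (r + j * n) f x)].

(** Three steps of size [eps / 8]: from [x] to its auxiliary point, across a cell of the labelling,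
    and on to [y]. *)
Lemma near_word_dist n (w : W n) x y i : near_word w x -> near_word w y ->
  (i < n)%N -> mdist (iter i f x) (iter i f y) < eps.
Proof.
move=> [z [zw xz]] [z' [zw' yz']] iltn.
have lz : l (iter i f z) = l (iter i f z').
  by move: zw; rewrite -zw' => /ffunP/(_ (Ordinal iltn)); rewrite !ffunE.
have := lsmall lz; have := xz i iltn; have := yz' i iltn.
have := mdist_tri (iter i f x) (iter i f z) (iter i f y).
have := mdist_tri (iter i f z) (iter i f z') (iter i f y).
rewrite (mdist_symm (iter i f z') (iter i f y)); have := eps0; lra.
Qed.

(** Up to time [q * n] a coded point is determined within [eps] by its phase, its first word and its
    [q] code words. The factor [n * #|W n|] counts the first two, Kraft's inequality the third. *)
Lemma coded_bound n (c : W n -> R) t s q N :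
  \sum_w expR (- c w) <= 1 -> (N <= q * n)%N ->
  (mBowen f (coded c t q) s N eps <=
   ((n * #|W n|)%:R * expR ((q.+1 * n)%:R * t) * expR (- ((q * n)%:R * s)))%:E)%E.
Proof.
move=> Hc Nqn.
pose T := ('I_n * W n * {ffun 'I_q -> W n})%type.
pose Q := [pred s : {ffun 'I_q -> W n} | \sum_j c (s j) <= (q.+1 * n)%:R * t].
pose P := [pred a : T | Q a.2].
pose cell (a : T) := [set x | word f l n x = a.1.2 /\
  forall j, near_word (a.2 j) (iter (a.1.1 + j * n) f x)].
have /choice[ctr Hctr] : forall a, exists x, (exists y, cell a y) -> cell a x.
  move=> a; have [[y Hy]|ny] := pselect (exists y, cell a y); first by exists y.
  by exists point.
have H : (mBowen f (coded c t q) s N eps <=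
    (#|P|%:R * expR (- ((q * n)%:R * s)))%:E)%E.
  apply: (mBowen_finite (c := ctr)) => // x [r [sg [Hs Hx]]].
  exists (r, word f l n x, sg) => //.
  set a := (_, _, _).
  have ax : cell a x by [].
  have [wa Ha] := Hctr a (ex_intro _ x ax).
  move=> i iqn; have n0 : (0 < n)%N by case: (r) => m; case: (n).
  (* The times before the phase are covered by the first word, as [r < n]. *)
  case: (ltnP i r) => [ir|ri].
    have iltn : (i < n)%N by apply: ltn_trans ir _.
    have e : l (iter i f (ctr a)) = l (iter i f x).
      by move: wa => /ffunP/(_ (Ordinal iltn)); rewrite !ffunE.
    by have := lsmall e; have := eps0; lra.
  have jq : ((i - r) %/ n < q)%N.
    by rewrite ltn_divLR//; apply: leq_ltn_trans iqn; exact: leq_subr.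
  have e y : iter i f y = iter ((i - r) %% n) f (iter (r + (i - r) %/ n * n) f y).
    rewrite -iterD; congr (iter _ f y).
    by rewrite addnCA [X in (_ + X)%N]addnC -divn_eq subnKC.
  rewrite !e; apply: near_word_dist (Ha (Ordinal jq)) (Hx (Ordinal jq)) _.
  by rewrite ltn_mod.
apply: le_trans H _; rewrite lee_fin ler_wpM2r ?expR_ge0//.
have -> : #|P| = (#|{: 'I_n * W n}| * #|Q|)%N.
  by rewrite -cardX; apply: eq_card => -[a b]; rewrite !inE.
rewrite card_prod card_ord natrM ler_wpM2l//.
exact: Kraft_count.
Qed.

(* If the empirical average of [psi] is below [n t] up to time [q n], then so is the
   average of [psi] along one of the [n] residue classes modulo [n]. *)
Lemma coded_often nu x n (c : W n -> R) (psi : X -> R) (t eta : R) (Q : nat) :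
  (0 < n)%N -> 0 <= t -> 0 < eta -> Vlim f x nu -> continuous psi ->
  (forall y, 0 <= psi y) ->
  (forall y, exists w, c w <= psi y /\ near_word w y) ->
  Rint nu psi + eta <= n%:R * t ->
  exists2 q, (Q <= q)%N & coded c t q x.
Proof.
move=> n0 t0 eta0 V psic psi0 Hw Hpsi.
have [m [Qm m0 /ltr_normlW emp]] := Vlim_near (Q * n) V psic eta0.
pose q := (m %/ n)%N; exists q.
  by rewrite leq_divRL.
have qm : (q * n <= m)%N by exact: leq_trunc_div.
have mq : (m <= q.+1 * n)%N by rewrite ltnW// ltn_ceil.
pose F i := psi (iter i f x).
have S1 : \sum_(i < m) F i <= m%:R * (n%:R * t).
  have : emp_integ f x m psi <= n%:R * t by lra.
  rewrite /emp_integ mulrC ler_pdivrMr ?ltr0n//.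
  by rewrite [in leRHS]mulrC.
have S2 : \sum_(r < n) \sum_(j < q) F (r + j * n)%N <= \sum_(i < m) F i.
  rewrite exchange_big/=.
  apply: (@le_trans _ _ (\sum_(i < q * n) F i)); last first.
    rewrite -(big_mkord xpredT F) -[leRHS](big_mkord xpredT F).
    rewrite [leRHS](big_cat_nat (n := q * n))//= lerDl.
    by apply: sumr_ge0 => i _; exact: psi0.
  rewrite -(big_mkord xpredT F) big_nat_mul big_mkord; apply: ler_sum => j _.
  have -> : \sum_(j * n <= i < j.+1 * n) F i = \sum_(r < n) F (r + j * n)%N.
    by rewrite -{1}[(j * n)%N]add0n big_addn mulSn addnK big_mkord.
  by [].
have [r Hr] : exists r : 'I_n, \sum_(j < q) F (r + j * n)%N <= (q.+1 * n)%:R * t.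
  apply: contrapT => nr.
  have : \sum_(r < n) (q.+1 * n)%:R * t < \sum_(r < n) \sum_(j < q) F (r + j * n)%N.
    apply: ltr_sum => [|r _]; last by rewrite ltNge; apply/negP => ?; apply: nr; exists r.
    by apply/hasP; exists (Ordinal n0); rewrite ?mem_index_enum.
  rewrite sumr_const card_ord -mulr_natl => lt.
  have : m%:R * (n%:R * t) <= (q.+1 * n)%:R * (n%:R * t).
    by rewrite ler_wpM2r ?mulr_ge0// ler_nat.
  by rewrite [leRHS]mulrCA; lra.
have /choice[w Hw'] := Hw.
exists r, [ffun j : 'I_q => w (iter (r + j * n) f x)]; split.
  apply: le_trans Hr; apply: ler_sum => j _; rewrite ffunE.
  by case: (Hw' (iter (r + j * n) f x)).
by move=> j; rewrite ffunE; case: (Hw' (iter (r + j * n) f x)).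
Qed.

(** Borel-Cantelli: the bounds of [coded_bound] form a geometric series of ratio [rho < 1], whose
    tails tend to zero. *)
Lemma coded_null n (c : W n -> R) (t s : R) (N : nat) : (0 < n)%N ->
  \sum_w expR (- c w) <= 1 -> t < s ->
  (mBowen f [set x | forall Q, exists2 q, (Q <= q)%N & coded c t q x] s N eps <= 0)%E.
Proof.
move=> n0 Hc ts; apply/lee_addgt0Pr => e e0; rewrite add0e.
pose rho := expR (- (n%:R * (s - t))).
have rho0 : 0 < rho by exact: expR_gt0.
have rho1 : rho < 1.
  by rewrite expR_lt1 oppr_lt0 mulr_gt0 ?ltr0n// subr_gt0.
pose C := (n * #|W n|)%:R * expR (n%:R * t).
have C0 : 0 <= C by rewrite mulr_ge0// expR_ge0.
have bE q : (n * #|W n|)%:R * expR ((q.+1 * n)%:R * t) * expR (- ((q * n)%:R * s)) =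
    C * rho ^+ q.
  rewrite /C /rho -expRM_natl -!mulrA -!expRD; congr (_ * expR _).
  by rewrite !natrM -[q.+1]addn1 natrD; ring.
have [Q [NQ HQ]] : exists Q, (N <= Q)%N /\ C * rho ^+ Q / (1 - rho) <= e.
  have cv : geometric (C / (1 - rho)) rho n0 @[n0 --> \oo] --> 0.
    by apply: cvg_geometric; rewrite gtr0_norm.
  move/cvgrPdist_le : cv => /(_ _ e0) [M _ HM].
  exists (maxn N M); split; first exact: leq_maxl.
  have := HM (maxn N M) (leq_maxr _ _); rewrite /= sub0r normrN => /(le_trans (ler_norm _)).
  by rewrite mulrAC.
apply: (@le_trans _ _ (mBowen f (\bigcup_i coded c t (Q + i)) s N eps)).
  apply: mBowen_leZ => x Hx; have [q Qq xq] := Hx Q.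
  by exists (q - Q)%N => //; rewrite subnKC.
apply: (@le_trans _ _ (\sum_(i <oo) (C * rho ^+ (Q + i))%:E)%E).
  apply: mBowen_bigcup => i; last by rewrite mulr_ge0// exprn_ge0// ltW.
  rewrite -bE; apply: coded_bound => //.
  by rewrite (leq_trans NQ)// (leq_trans (leq_addr i Q))// leq_pmulr.
apply: (@le_trans _ _ (C * rho ^+ Q / (1 - rho))%:E); last by rewrite lee_fin.
apply: lime_le.
  by apply: is_cvg_nneseries => i _ _; rewrite lee_fin mulr_ge0// exprn_ge0// ltW.
near=> M; rewrite sumEFin lee_fin big_mkord.
rewrite (eq_bigr (fun i : 'I_M => (C * rho ^+ Q) * rho ^+ i)); last first.
  by move=> i _; rewrite exprD mulrA.
rewrite -mulr_sumr; apply: ler_wpM2l; first by rewrite mulr_ge0// exprn_ge0// ltW.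
rewrite -div1r ler_pdivlMr ?subr_gt0// mulrC.
have := subrX1 rho M; rewrite -opprB -[in RHS]opprB mulNr => /oppr_inj <-.
by rewrite lerBlDr lerDl exprn_ge0// ltW.
Unshelve. all: by end_near. Qed.

Lemma upper_scale (Z : set X) (t s : R) : 0 <= t -> t < s ->
  (forall x, Z x -> exists nu, [/\ Vlim f x nu, Minv f nu & (hmeas f nu <= t%:E)%E]) ->
  forall N, (mBowen f Z s N eps <= 0)%E.
Proof.
move=> t0 ts HZ N.
(* The total rate [t + 6 * eta] stays below [s]. Per word of length [n], the entropy of the
   partition takes [n * eta], the code [2 * eta], the continuous majorant [eta] and the empirical
   average [eta]. *)
pose eta := (s - t) / 8.
have eta0 : 0 < eta by rewrite /eta divr_gt0// subr_gt0.
(* A cost function is stored as a list of integers in units of [eta], so that the codes form a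
   countable type and can be enumerated by [unpickle]. *)
pose cost n (a : seq nat) (w : W n) : R := eta * (nth 0%N a (enum_rank w))%:R.
pose Zc (na : nat * seq nat) : set X := [set x | (0 < na.1)%N /\
  \sum_w expR (- cost na.1 na.2 w) <= 1 /\
  forall Q, exists2 q, (Q <= q)%N & coded (cost na.1 na.2) (t + 6 * eta) q x].
have Zc0 na : (mBowen f (Zc na) s N eps <= 0)%E.
  have [n0|nn0] := pselect ((0 < na.1)%N /\ \sum_w expR (- cost na.1 na.2 w) <= 1).
    have H := @coded_null na.1 (cost na.1 na.2) (t + 6 * eta) s N n0.1 n0.2.
    apply: le_trans (H _); last by rewrite /eta; lra.
    by apply: mBowen_leZ => x [_ []].
  apply: (@le_trans _ _ (mBowen f set0 s N eps)).
    by apply: mBowen_leZ => x [? [? _]]; apply: nn0.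
  apply: (@le_trans _ _ (\sum_(i <oo) (0%R)%:E)%E); last by rewrite eseries0.
  apply: ereal_inf_lbound; exists (fun=> None); split; first by split.
  by apply: eq_eseriesr.
apply: (@le_trans _ _ (mBowen f (\bigcup_i
    (if unpickle i is Some na then Zc na else set0)) s N eps)); last first.
  apply: mBowen_bigcup0 => i; case: (unpickle i) => [na|]; first exact: Zc0.
  apply: le_trans (Zc0 (0%N, [::])).
  by apply: mBowen_leZ.
apply: mBowen_leZ => x /HZ[nu [V inv hnu]].
pose P j := l @^-1` [set j].
have hP : hpart f nu P < t + eta.
  apply: (@le_lt_trans _ _ t); last by rewrite ltrDl.
  rewrite -lee_fin; apply: le_trans hnu; apply: ereal_sup_ubound.
  by exists k, P; split => //; exact: label_partition.
have [_ /(_ _ hP)[n0 Hn]] := hpart_label fcont inv ml (fun=> erefl).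
pose n := n0.+1.
have mw : mlab (word f l n) by exact: mlab_word.
have nR : 1 <= (n%:R : R) by rewrite ler1n.
have Hn' : Hl nu (word f l n) <= n%:R * (t + eta).
  by move/ltW: Hn; rewrite ler_pdivrMr ?ltr0n// mulrC.
have [kap [K1 K2]] := code_lengths (fun w => pr_ge0 nu (word f l n @^-1` [set w]))
  (pr_lab1 nu mw) eta0.
pose a := [seq kap w | w <- enum (W n)].
have costE w : cost n a w = eta * (kap w)%:R.
  rewrite /cost /a (nth_map w); last by rewrite -cardE ltn_ord.
  by rewrite -[nth w _ _]/(nth w (enum (W n)) (enum_rank w)) nth_enum_rank.
have e8 : 0 < eps / 8 by rewrite divr_gt0.
have [rho rho0 Hrho] := @unif_cont_iter _ _ Xcompact f n fcont _ e8.
have c0 w : 0 <= cost n a w by rewrite mulr_ge0// ltW.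
have [psi [psic psi0 psiw psiI]] := cost_function Xcompact nu mw c0 rho0 eta0.
exists (pickle (n, a)) => //; rewrite pickleK; split => //; split.
  by under eq_bigr do rewrite costE.
move=> Q; apply: (@coded_often nu x n _ psi _ eta) => //.
- by rewrite addr_ge0// mulr_ge0// ltW.
- move=> y; have [w [cw [z zw yz]]] := psiw y; exists w; split => //.
  by exists z; split => // i iltn; exact: Hrho.
have : \sum_w pr nu (word f l n @^-1` [set w]) * cost n a w <= n%:R * (t + eta) + 2 * eta.
  under eq_bigr do rewrite costE.
  by apply: le_trans K2 _; rewrite lerD2r.
nra.
Qed.

End OneScale.

Lemma upper_bound (Z : set X) (t : R) : 0 <= t ->
  (forall x, Z x -> exists nu, [/\ Vlim f x nu, Minv f nu & (hmeas f nu <= t%:E)%E]) ->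
  (hBowen f Z <= t%:E)%E.
Proof.
move=> t0 HZ; apply: hBowen_le => eps eps0.
have e8 : 0 < eps / 8 by rewrite divr_gt0.
have [k [l [ml ls]]] := small_label Xcompact e8.
apply/lee_addgt0Pr => e e0; rewrite -EFinD; apply: htop_le.
by apply: (upper_scale eps0 ml ls t0 _ HZ); rewrite ltrDl.
Qed.

End UpperMain.

(** * Entropy of a set of traced concatenations *)

Section Superblocks.
Context {R : realType} {X : pointedMetricType R}.
Hypothesis Xcompact : compact [set: X].
Variable f : X -> X.
Hypothesis fcont : continuous f.
Variables (T : finType) (p : X) (Lam : nat) (b : T -> seq X) (eps s : R).
Hypotheses (Lam0 : (0 < Lam)%N) (eps0 : 0 < eps).

Definition concat (tau : nat -> T) (i : nat) : X :=
  nth p (b (tau (i %/ Lam)%N)) (i %% Lam).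

(** Finite horizons and a non-strict inequality make this set closed, hence compact, so that its
    covers by Bowen balls can be reduced to finite ones. *)
Definition traced : set X := [set x | forall m, exists tau : nat -> T,
  forall i, (i < m * Lam)%N -> mdist (iter i f x) (concat tau i) <= eps].

Lemma closed_ball_iter i (y : X) : closed [set x | mdist (iter i f x) y <= eps].
Proof.
apply: (@closed_comp _ _ (fun x => mdist (iter i f x) y) [set t | t <= eps]).
  move=> x _; rewrite /prop_for; under eq_fun do rewrite mdist_symm.
  apply: (@continuous_comp _ _ _ (iter i f) (mdist y)); first exact: continuous_iter.
  exact: continuous_mdist.
exact: closed_le.
Qed.

Lemma traced_closed (t0 : T) : closed traced.
Proof.
rewrite (_ : traced = \bigcap_m \bigcup_(tau in [set: {ffun 'I_m -> T}])
    \bigcap_(i in [set i | (i < m * Lam)%N])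
      [set x | mdist (iter i f x) (nth p (b (odflt t0 (omap tau (insub (i %/ Lam)%N))))
         (i %% Lam)) <= eps]).
  apply: closed_bigI => m _; apply: closed_bigcup => [|tau _].
    exact: finite_finset.
  by apply: closed_bigI => i _; exact: closed_ball_iter.
apply/seteqP; split=> x.
  move=> Hx m _; have [tau Htau] := Hx m.
  exists [ffun i : 'I_m => tau i] => // i /= im.
  have im' : (i %/ Lam < m)%N by rewrite ltn_divLR.
  by rewrite insubT /= ffunE; exact: Htau.
move=> Hx m; have [tau _ Htau] := Hx m I.
exists (fun j => odflt t0 (omap tau (insub j))) => i im.
exact: Htau.
Qed.

(* The constant [2 * eps] is for points that [eps]-follow a point which [eps]-traces
   a block; a bound on this set bounds the mass of a Bowen ball. *)
Definition compat (z : X) : pred T := [pred t |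
  [forall i : 'I_Lam, mdist (iter i f z) (nth p (b t) i) < 2 * eps]].

Hypothesis tracing : forall tau : nat -> T, exists x,
  forall i, mdist (iter i f x) (concat tau i) < eps.
Hypothesis compat_frac : forall z, #|compat z|%:R <= expR (- (s * Lam%:R)) * #|T|%:R.

Lemma Bball_open n (y : X) (e : R) : open (Bball f n y e).
Proof.
rewrite (_ : Bball f n y e = \bigcap_(i in [set: 'I_n])
  (iter i f @^-1` [set x | mdist (iter i f y) x < e])).
  rewrite -[X in open X]setCK setC_bigcap; apply: closed_openC.
  apply: closed_bigcup => [|i _]; first exact: finite_finset.
  apply: open_closedC; apply: open_comp => [x _|]; last exact: open_mdist.
  exact: continuous_iter.
apply/seteqP; split=> x /= H i; first by move=> _; exact: H.
by move=> iltn; exact: (H (Ordinal iltn)).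
Qed.

(* Mass distribution: the uniform measure on the [#|T| ^ m] traced concatenations
   gives a Bowen ball of length [n] mass at most [expR (- n s)] up to a constant. *)
Lemma traced_weight (t0 : T) (x : forall m, {ffun 'I_m -> T} -> X) m n (y : X) :
  (forall m (tau : {ffun 'I_m -> T}) i (im : (i < m * Lam)%N) j, nat_of_ord j = (i %/ Lam)%N ->
     mdist (iter i f (x m tau)) (nth p (b (tau j)) (i %% Lam)) < eps) ->
  (n < m)%N ->
  \sum_(tau : {ffun 'I_m -> T} | `[< Bball f n y eps (x m tau) >]) (#|T|%:R ^- m) <=
    expR (`|s| * Lam%:R) * expR (- (n%:R * s)).
Proof.
move=> Hx nm; pose q := (n %/ Lam)%N.
have T0 : 0 < (#|T|%:R : R) by rewrite ltr0n; apply/card_gt0P; exists t0.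
(* Only the [q] complete blocks before time [n] restrict [tau]. *)
pose F (j : 'I_m) : pred T := if (j < q)%N then compat (iter (j * Lam) f y) else xpredT.
apply: (@le_trans _ _ (\sum_(tau in family F) \prod_(j < m) (#|T|%:R^-1 : R))).
  rewrite [leRHS](eq_bigr (fun=> #|T|%:R ^- m)); last first.
    by move=> tau _; rewrite prodr_const card_ord exprVn.
  rewrite [leRHS](bigID (fun tau => `[< Bball f n y eps (x m tau) >]))/=.
  rewrite ler_wpDr//; first by apply: sumr_ge0 => tau _; rewrite invr_ge0 exprn_ge0// ltW.
  rewrite le_eqVlt; apply/orP; left; apply/eqP; apply: eq_bigl => tau.
  apply/idP/andP => [/[dup] H /asboolP Bx|[]//]; split=> //.
  apply/familyP => j; rewrite /F; case: ifP => // jq.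
  rewrite inE; apply/forallP => i /=.
  have ijq : (j * Lam + i < q * Lam)%N.
    by apply: (@leq_trans (j.+1 * Lam)); [rewrite mulSn addnC ltn_add2r|rewrite leq_mul2r jq orbT].
  have ijn : (j * Lam + i < n)%N by apply: leq_trans ijq (leq_trunc_div _ _).
  have ijm : (j * Lam + i < m * Lam)%N.
    by rewrite (ltn_trans ijn)// (leq_trans nm)// leq_pmulr.
  have := Bx _ ijn; have := Hx m tau _ ijm j.
  rewrite divnMDl// divn_small// addn0 => /(_ erefl).
  rewrite modnMDl modn_small// -iterD (addnC i) => h1 h2.
  by have := mdist_tri (iter (j * Lam + i) f y) (iter (j * Lam + i) f (x m tau))
    (nth p (b (tau j)) i); lra.
rewrite -(bigA_distr_big_dep _ (fun _ _ => #|T|%:R^-1)).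
apply: (@le_trans _ _ (\prod_(j < m) (if (j < q)%N then expR (- (s * Lam%:R)) else 1))).
  apply: ler_prod => j _; rewrite sumr_ge0/=; last by move=> *; rewrite invr_ge0 ltW.
  rewrite sumr_const -[leLHS]mulr_natl ler_pdivrMr// /F; case: ifP => _.
    exact: compat_frac.
  by rewrite mul1r ler_nat; exact: max_card.
have qm : (q <= m)%N by rewrite (leq_trans (leq_div _ _))// ltnW.
rewrite -big_mkcond/=.
have -> : \prod_(j < m | (j < q)%N) expR (- (s * Lam%:R)) = expR (- (s * Lam%:R)) ^+ q.
  rewrite -(big_mkord (fun j => (j < q)%N) (fun=> expR (- (s * Lam%:R)))).
  rewrite (big_cat_nat (n := q))//= [X in _ * X]big1_seq ?mulr1; last first.
    by move=> j; rewrite mem_index_iota => /andP[jq /andP[]]; rewrite leqNgt jq.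
  rewrite big_nat_cond (eq_bigl (fun j => 0 <= j < q)%N).
    by rewrite -big_nat prodr_const_nat subn0.
  by move=> j; rewrite /= andbb.
rewrite -expRM_natl -expRD ler_expR.
have nE : n%:R = q%:R * Lam%:R + (n %% Lam)%:R :> R.
  by rewrite -natrM -natrD -divn_eq.
have r1 : (n %% Lam)%:R <= (Lam%:R : R) by rewrite ler_nat ltnW// ltn_pmod.
have r0 : 0 <= ((n %% Lam)%:R : R) by [].
have := ler_norm s; have := ler_norm (- s); rewrite normrN => h1 h2.
rewrite nE; move: ((n %% Lam)%:R) r0 r1 => r r0 r1.
(* [s] may be negative, whence the absolute value; the incomplete last block only costs the constant
   factor of the bound. *)
have : s * r <= `|s| * Lam%:R.
  apply: (@le_trans _ _ (`|s| * r)); first by rewrite ler_wpM2r.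
  by rewrite ler_wpM2l.
move: (`|s| * Lam%:R) => z; lra.
Qed.

(** Compactness leaves finitely many balls of a given cover. With [m] larger than all their lengths
    [traced_weight] applies to each of them, and the total weight 1 bounds the cost of the cover
    from below. *)
Lemma traced_entropy (t0 : T) : (s%:E <= htop_eps f traced eps)%E.
Proof.
(* Length [N = 0] suffices, because the bound holds for covers by balls of any lengths. *)
apply: (@htop_ge _ _ _ _ _ 0); apply: (@lt_le_trans _ _ (expR (- (`|s| * Lam%:R)))%:E).
  by rewrite lte_fin expR_gt0.
apply: le_ereal_inf_tmp => _ [c [[_ cZ] ->]].
have Zc : compact traced.
  exact: (subclosed_compact (traced_closed t0) Xcompact).
move: Zc; rewrite compact_cover => /(_ nat setT (fun i => cover_ball f eps (c i))).
case=> [i _|//|D _ HD].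
  by rewrite /cover_ball; case: (c i) => [[y n]|]; [exact: Bball_open|exact: open0].
pose M := (\max_(i <- finmap.enum_fset D) i).+1.
have HM y : traced y -> exists2 i : 'I_M, true & cover_ball f eps (c i) y.
  move=> /HD[i /= iD yi]; have iM : (i < M)%N by rewrite ltnS; exact: leq_bigmax_seq.
  by exists (Ordinal iM).
pose len (i : nat) := if c i is Some (_, n) then n else 0%N.
pose m := (\max_(i < M) len i).+1.
have lenm (i : 'I_M) : (len i < m)%N by rewrite ltnS; exact: leq_bigmax.
have T0 : 0 < (#|T|%:R : R) by rewrite ltr0n; apply/card_gt0P; exists t0.
pose ext m (tau : {ffun 'I_m -> T}) j := odflt t0 (omap tau (insub j)).
have /choice[x Hx] : forall mt : {m & {ffun 'I_m -> T}}, exists x,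
    forall i, mdist (iter i f x) (concat (ext (tag mt) (tagged mt)) i) < eps.
  by move=> mt; exact: tracing.
pose x' m (tau : {ffun 'I_m -> T}) := x (Tagged (fun m => {ffun 'I_m -> T}) tau).
have Hx' m' (tau : {ffun 'I_m' -> T}) i (im : (i < m' * Lam)%N) j : nat_of_ord j = (i %/ Lam)%N ->
     mdist (iter i f (x' m' tau)) (nth p (b (tau j)) (i %% Lam)) < eps.
  move=> ji; have := Hx (Tagged (fun m => {ffun 'I_m -> T}) tau) i.
  by rewrite /concat /ext /= -ji valK.
have trx m' (tau : {ffun 'I_m' -> T}) : traced (x' m' tau).
  move=> k; exists (ext m' tau) => i _; apply: ltW.
  exact: (Hx (Tagged (fun m => {ffun 'I_m -> T}) tau) i).
have one : \sum_(tau : {ffun 'I_m -> T}) (#|T|%:R ^- m) = (1 : R).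
  by rewrite sumr_const card_ffun card_ord -[_ *+ _]mulr_natl natrX mulfV// expf_neq0// gt_eqF.
have H1 : (1 : R) <= \sum_(i < M) \sum_(tau : {ffun 'I_m -> T} |
    `[< cover_ball f eps (c i) (x' m tau) >]) (#|T|%:R ^- m).
  rewrite -[leLHS]one (exchange_big_dep xpredT)//=; apply: ler_sum => tau _.
  have [i _ Hi] := HM _ (trx m tau).
  rewrite (bigD1 i)/=; last exact/asboolP.
  rewrite lerDl sumr_ge0// => j _; by rewrite invr_ge0 exprn_ge0// ltW.
have H2 : (1 : R) <= expR (`|s| * Lam%:R) * \sum_(i < M) fine (cover_cost s (c i)).
  apply: le_trans H1 _; rewrite mulr_sumr; apply: ler_sum => i _.
  have := lenm i; rewrite /len /cover_ball /cover_cost.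
  case: (c i) => [[y n]|] /= nm; first exact: traced_weight.
  rewrite mulr0 big1// => tau; by move=> /asboolP.
apply: (@le_trans _ _ (\sum_(i < M) cover_cost s (c i))%E); last first.
  rewrite -(big_mkord xpredT (fun i => cover_cost s (c i))).
  by apply: nneseries_lim_ge => n _ _; exact: cover_cost_ge0.
rewrite (eq_bigr (fun i : 'I_M => (fine (cover_cost s (c i)))%:E)); last first.
  by move=> i _; case: (c i) => [[]|].
by rewrite sumEFin lee_fin expRN -[leLHS]mul1r ler_pdivrMr ?expR_gt0// mulrC.
Qed.

End Superblocks.

(** * Counting typical words *)

Section TypeClass.
Context {R : realType}.

(** Multinomial coefficient, by induction on the first letter: removing one [w] divides the product
    of factorials by the multiplicity of [w], and the multiplicities add up to the length. *)
Lemma card_permutations_fact (W : finType) (s : seq W) :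
  (size (permutations s) * \prod_w (count_mem w s)`! = (size s)`!)%N.
Proof.
have [n] := ubnP (size s); elim: n => // n IH in s *; rewrite ltnS => sn.
have [s0|s0] := posnP (size s).
  by rewrite (size0nil s0)/= big1.
rewrite (perm_size (permutationsE s0)) size_flatten /shape -map_comp.
rewrite sumnE big_map big_distrl/=.
have H w : w \in undup s -> (size [seq w :: u | u <- permutations (rem w s)] *
    \prod_w' (count_mem w' s)`! = count_mem w s * (size s).-1`!)%N.
  rewrite mem_undup => ws; rewrite size_map.
  have sr : size (rem w s) = (size s).-1 by rewrite size_rem.
  rewrite -sr -IH; last by rewrite sr prednK.
  rewrite mulnCA; congr (_ * _)%N; rewrite (bigD1 w)//= [in RHS](bigD1 w)//=.
  have cw : count_mem w s = (count_mem w (rem w s)).+1.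
    by rewrite (permP (perm_to_rem ws))/= eqxx.
  rewrite cw factS -mulnA; congr (_ * (_ * _))%N.
  apply: eq_bigr => w' w'w; rewrite (permP (perm_to_rem ws))/=.
  by rewrite eq_sym (negbTE w'w).
rewrite big_seq (eq_bigr _ H) -big_seq -big_distrl/=.
have -> : (\sum_(w <- undup s) count_mem w s = size s)%N.
  rewrite -sum1_size -(big_undup_iterop_count _ s xpredT)/=.
  by apply: eq_bigr => w _; rewrite Monoid.iteropE iter_addn_0 mul1n.
by rewrite -[in RHS](prednK s0) factS prednK.
Qed.

(** Crude Stirling bound; the induction step is [n * ln (1 + 1 / n) <= 1]. *)
Lemma ln_fact_ge (n : nat) : n%:R * ln n%:R - n%:R <= ln (n`!%:R) :> R.
Proof.
elim: n => [|n IH]; first by rewrite fact0 ln1 mul0r subr0.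
rewrite factS natrM lnM ?posrE ?ltr0n ?fact_gt0//.
have [->|n0] := posnP n; first by rewrite fact0 !ln1; lra.
have n0' : 0 < (n%:R : R) by rewrite ltr0n.
have h : n%:R * ln n.+1%:R <= n%:R * ln n%:R + 1 :> R.
  have := @le_ln1Dx R (n%:R^-1).
  have -> : 1 + n%:R^-1 = n.+1%:R / n%:R :> R.
    by rewrite -[n.+1]addn1 natrD mulrDl divff ?gt_eqF// mul1r.
  rewrite ln_div ?posrE ?ltr0n// => /(_ _).
  have : -1 < n%:R^-1 :> R by rewrite (lt_trans (ltrN10 R))// invr_gt0.
  move=> + H => /H; rewrite -(ler_pM2l n0') divff ?gt_eqF//; lra.
have e : n.+1%:R = n%:R + 1 :> R by rewrite -natr1.
by move: IH h; rewrite e; lra.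
Qed.

Lemma ln_fact_le (n : nat) : ln (n`!%:R) <= n.+1%:R * ln n.+1%:R - n%:R :> R.
Proof.
elim: n => [|n IH]; first by rewrite fact0 ln1; lra.
rewrite factS natrM lnM ?posrE ?ltr0n ?fact_gt0//.
have h : 1 <= n.+2%:R * ln n.+2%:R - n.+2%:R * ln n.+1%:R :> R.
  have n2 : 0 < (n.+2%:R : R) by rewrite ltr0n.
  have := @le_ln1Dx R (- n.+2%:R^-1).
  have -> : 1 - n.+2%:R^-1 = n.+1%:R / n.+2%:R :> R.
    apply: (mulIf (lt0r_neq0 n2)).
    by rewrite mulrBl mul1r mulVf ?divfK ?gt_eqF// -[n.+2%:R]natr1 addrK.
  rewrite ln_div ?posrE ?ltr0n// => H.
  have : -1 < - n.+2%:R^-1 :> R by rewrite ltrN2 invf_lt1// ltr1n.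
  move=> /H; rewrite -(ler_pM2l n2) mulrN divff ?gt_eqF//; lra.
move: IH h; have -> : n.+2%:R = n.+1%:R + 1 :> R by rewrite -natr1.
have -> : n.+1%:R = n%:R + 1 :> R by rewrite -natr1.
by lra.
Qed.

Definition typeseq (W : finType) (c : W -> nat) : seq W :=
  flatten [seq nseq (c w) w | w <- enum W].

Lemma count_typeseq (W : finType) (c : W -> nat) w : count_mem w (typeseq c) = c w.
Proof.
rewrite count_flatten -map_comp sumnE big_map big_enum/= (bigD1 w)//=.
rewrite count_nseq/= eqxx mul1n big1 ?addn0// => v vw.
by rewrite count_nseq/= (negbTE vw).
Qed.

Lemma sum_typeseq (W : finType) (c : W -> nat) (F : W -> R) :
  \sum_(w <- typeseq c) F w = \sum_w (c w)%:R * F w.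
Proof.
rewrite big_flatten/= big_map big_enum/=; apply: eq_bigr => w _.
by rewrite big_nseq iter_addr_0 mulr_natl.
Qed.

Lemma ln_prod_fact (W : finType) (c : W -> nat) :
  ln ((\prod_w (c w)`!)%N%:R) = \sum_w ln ((c w)`!%:R) :> R.
Proof.
have H : (0 < \prod_w (c w)`!)%N /\
    ln ((\prod_w (c w)`!)%N%:R) = \sum_w ln ((c w)`!%:R) :> R; last by case: H.
apply: (big_ind2 (fun (x : nat) (y : R) => (0 < x)%N /\ ln x%:R = y)).
- by rewrite ln1.
- move=> x1 y1 x2 y2 [h1 <-] [h2 <-]; split; first by rewrite muln_gt0 h1.
  by rewrite natrM lnM// posrE ltr0n.
- by move=> w _; rewrite fact_gt0.
Qed.

(** From [ln z <= a * z - 1 - ln a] with [a = eta / (4 * k)]: the linear term uses half of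
    [eta * t], and [t > M] absorbs the constants in the other half. *)
Lemma log_sublinear (k eta : R) (N0 : nat) : 0 < k -> 0 < eta ->
  exists t : nat, [/\ (N0 <= t)%N, k < t%:R & 2 * k * (1 + ln (t.+1%:R)) <= eta * t%:R].
Proof.
move=> k0 eta0; pose a := eta / (4 * k).
have a0 : 0 < a by rewrite divr_gt0// mulr_gt0.
pose M : R := 1 + 4 * k * `|ln a| / eta.
have M0 : 0 <= M by rewrite addr_ge0// divr_ge0 ?(ltW eta0)// mulr_ge0// mulr_ge0// ltW.
pose t := (N0 + Num.truncn k + Num.truncn M).+1.
have kt : k < t%:R.
  have /andP[_] := truncn_itv (ltW k0); move/lt_le_trans; apply.
  by rewrite ler_nat /t ltnS; lia.
have Mt : M < t%:R.
  have /andP[_] := truncn_itv M0; move/lt_le_trans; apply.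
  by rewrite ler_nat /t ltnS; lia.
exists t; split => //; first by rewrite /t; lia.
have t1 : 0 < (t.+1%:R : R) by rewrite ltr0n.
have H : ln (t.+1%:R) <= a * t.+1%:R - 1 - ln a.
  have := @le_ln1Dx R (a * t.+1%:R - 1).
  rewrite (addrC 1) subrK lnM ?posrE// => /(_ _).
  have : -1 < a * t.+1%:R - 1 by have := mulr_gt0 a0 t1; lra.
  by move=> + H => /H; lra.
have e : 2 * k * a = eta / 2.
  by rewrite /a; field; rewrite gt_eqF.
apply: (@le_trans _ _ (2 * k * (a * t.+1%:R - ln a))).
  by rewrite ler_wpM2l; [|rewrite mulr_ge0// ltW|lra].
rewrite mulrBr mulrA e -[t.+1%:R]natr1.
have : eta * M <= eta * t%:R by rewrite ler_wpM2l// ltW.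
have -> : eta * M = eta + 4 * k * `|ln a| by rewrite /M; field; rewrite gt_eqF.
have := ler_norm (- ln a); rewrite normrN => h.
have : 4 * k * (- ln a) <= 4 * k * `|ln a| by rewrite ler_wpM2l// mulr_ge0// ltW.
lra.
Qed.

(** Each letter [w] is taken [t * p w] times, rounded down, so a sum over [s] is off by at most one
    term per letter. The arrangements are counted by a multinomial coefficient, and Stirling loses
    at most twice [#|W| * (1 + ln (t + 1))], which is sublinear in [t]. *)
Lemma type_class (W : finType) (p : W -> R) (eta : R) (N0 : nat) :
  (forall w, 0 <= p w) -> \sum_w p w = 1 -> 0 < eta ->
  exists (s : seq W) (t : nat), [/\ (N0 <= t)%N, (forall w, w \in s -> 0 < p w),
    (forall F : W -> R, `|\sum_(w <- s) F w - t%:R * \sum_w p w * F w| <= \sum_w `|F w|) &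
    t%:R * (\sum_w phi (p w) - eta) <= ln ((size (permutations s))%:R)].
Proof.
move=> p0 p1 eta0.
have p1' w : p w <= 1.
  by rewrite -p1 (bigD1 w)//= lerDl sumr_ge0.
have W0 : (0 < #|W|)%N.
  rewrite lt0n; apply/eqP => W0; move: p1; rewrite big_pred0 => [/eqP|w].
    by rewrite eq_sym oner_eq0.
  by have := card0_eq W0 w; rewrite inE.
pose k : R := #|W|%:R.
have k0 : 0 < k by rewrite ltr0n.
have [t [N0t kt Ht]] := log_sublinear N0 k0 eta0.
pose c w := Num.truncn (t%:R * p w).
have tp0 w : 0 <= t%:R * p w by rewrite mulr_ge0.
have c1 w : (c w)%:R <= t%:R * p w by have /andP[] := truncn_itv (tp0 w).
have c2 w : t%:R * p w < (c w)%:R + 1 by have /andP[_] := truncn_itv (tp0 w); rewrite -[_.+1%:R]natr1.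
exists (typeseq c), t; split => //.
- move=> w; rewrite lt_neqAle p0 andbT; apply: contraTneq => pw.
  rewrite -has_pred1 has_count count_typeseq /c -pw mulr0 -leqNgt leqn0.
  by rewrite truncn0.
- move=> F; rewrite sum_typeseq mulr_sumr -sumrB.
  apply: le_trans (ler_norm_sum _ _ _) _; apply: ler_sum => w _.
  rewrite mulrA -mulrBl normrM ler_piMl// ler_norml.
  by have := c1 w; have := c2 w => ? ?; apply/andP; split; lra.
pose L := size (typeseq c).
have LE : (L%:R : R) = \sum_w (c w)%:R.
  rewrite /L -sum1_size natr_sum sum_typeseq.
  by apply: eq_bigr => w _; rewrite mulr1.
have t0 : 0 < (t%:R : R) by exact: lt_trans kt.
have Lk : t%:R - k <= L%:R.
  have -> : t%:R - k = \sum_w (t%:R * p w - 1).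
    by rewrite sumrB -mulr_sumr p1 mulr1 sumr_const.
  by rewrite LE; apply: ler_sum => w _; have := c2 w; lra.
have L0 : 0 < (L%:R : R) by lra.
have NE : ln ((size (permutations (typeseq c)))%:R) =
    ln (L`!%:R) - \sum_w ln ((c w)`!%:R) :> R.
  have := card_permutations_fact (typeseq c).
  under eq_bigr do rewrite count_typeseq.
  rewrite -/L => H; rewrite -H natrM lnM ?posrE ?ltr0n.
  - by rewrite ln_prod_fact addrK.
  - by rewrite lt0n; apply: contra_eq_neq H => ->; rewrite mul0n eq_sym -lt0n fact_gt0.
  - by rewrite prodn_gt0// => w; rewrite fact_gt0.
rewrite NE.
(* Rounding makes [s] shorter than [t]; the tangent inequality for [ln (t / L)] replaces [L * ln L]
   by [t * ln t]. *)
have h1 : t%:R * ln t%:R - k * (ln t%:R + 1) <= L%:R * ln L%:R.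
  have H : L%:R * ln t%:R - t%:R + L%:R <= L%:R * ln L%:R :> R.
    have := @le_ln1Dx R (t%:R / L%:R - 1).
    rewrite (addrC 1) subrK ln_div ?posrE// => /(_ _).
    have : -1 < t%:R / L%:R - 1 :> R by rewrite ltrBrDl subrr divr_gt0.
    move=> + H => /H/(ler_wpM2l (ltW L0)).
    have -> : L%:R * (t%:R / L%:R - 1) = t%:R - L%:R :> R by field; rewrite gt_eqF.
    by rewrite mulrBr; lra.
  have t1 : 1 <= (t%:R : R) by rewrite ler1n lt0n; apply: contraTneq t0 => ->; rewrite ltxx.
  have := ln_ge0 t1 => lt0.
  have := ler_wpM2r lt0 Lk; lra.
have h2 : \sum_w ln ((c w)`!%:R) <= t%:R * ln t%:R - t%:R * \sum_w phi (p w) +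
    k * (1 + ln t.+1%:R) - L%:R.
  have H w : ln ((c w)`!%:R) <= (t%:R * ln t%:R) * p w - t%:R * phi (p w) +
      (1 + ln t.+1%:R) - (c w)%:R.
    apply: le_trans (ln_fact_le _) _; rewrite lerD2r.
    have lt1 : 0 <= ln (t.+1%:R) :> R by apply: ln_ge0; rewrite ler1n.
    have := p0 w; rewrite le_eqVlt => /predU1P[pw|pw].
      have -> : c w = 0%N by rewrite /c -pw mulr0 truncn0.
      rewrite ln1 -pw phi0 !mulr0 subr0 add0r; lra.
    have tp : 0 < t%:R * p w by exact: mulr_gt0.
    pose y := t%:R * p w.
    have a1 : (c w).+1%:R * ln ((c w).+1%:R) <= (y + 1) * ln (y + 1).
      have cy : (c w).+1%:R <= y + 1 by rewrite -[_.+1%:R]natr1 lerD2r.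
      apply: ler_pM => //; first by apply: ln_ge0; rewrite ler1n.
      by rewrite ler_ln ?posrE ?ltr0n// addr_gt0.
    have a2 : y * ln (y + 1) <= y * ln y + 1.
      have := @le_ln1Dx R (y^-1).
      have -> : 1 + y^-1 = (y + 1) / y by rewrite mulrDl divff ?gt_eqF// mul1r.
      rewrite ln_div ?posrE ?addr_gt0// => /(_ _).
      have : -1 < y^-1 by rewrite (lt_trans (ltrN10 R))// invr_gt0.
      move=> + H => /H; rewrite -(ler_pM2l tp) -/y divff ?gt_eqF//; lra.
    have a3 : ln (y + 1) <= ln (t.+1%:R).
      by rewrite ler_ln ?posrE ?addr_gt0// -[_.+1%:R]natr1 lerD2r /y ler_piMr.
    have a4 : y * ln y = t%:R * ln t%:R * p w - t%:R * phi (p w).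
      by rewrite /y lnM ?posrE// /phi; ring.
    rewrite -a4; lra.
  apply: le_trans (ler_sum _ (fun w _ => H w)) _.
  rewrite !(sumrB, big_split)/= -!mulr_sumr p1 mulr1 -LE sumr_const -[_ *+ _]mulr_natl.
  rewrite [\sum_(i : W) ln _]sumr_const -[ln _ *+ _]mulr_natl.
  by rewrite -[#|xpredT|%:R]/k; lra.
have h3 := ln_fact_ge L.
have h4 : ln (t%:R) <= ln (t.+1%:R) :> R by rewrite ler_ln ?posrE ?ler_nat.
have h5 := ler_wpM2l (ltW k0) h4.
rewrite -/L; lra.
Qed.

End TypeClass.

Section CompatCount.
Context {R : realType}.

(* Each word gets weight [th] per special letter; the total weight of the words
   agreeing with [g] at the other positions factorises over the positions. *)
Lemma compat_count (T S : finType) (s0 : S) (special : pred S) (Lam D : nat)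
    (F : T -> seq S) (C : pred T) (g : nat -> S) (th : R) :
  0 < th -> (forall t, size (F t) = Lam) -> injective F ->
  (forall t, C t -> count special (F t) = D) ->
  (forall t i, C t -> (i < Lam)%N ->
     special (nth s0 (F t) i) \/ nth s0 (F t) i = g i) ->
  #|C|%:R <= th ^- D * (1 + #|special|%:R * th) ^+ Lam.
Proof.
move=> th0 sF iF cD HC.
pose wt (x : S) : R := if special x then th else 1.
have wt0 x : 0 <= wt x by rewrite /wt; case: ifP => // _; exact: ltW.
pose G (t : T) : {ffun 'I_Lam -> S} := [ffun i : 'I_Lam => nth s0 (F t) i].
have iG : injective G.
  move=> t t' /ffunP e; apply: iF; apply: (@eq_from_nth _ s0); rewrite !sF// => i iL.
  by have := e (Ordinal iL); rewrite !ffunE.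
(* The letters possible at position [i] have total weight at most [#|special| * th + 1], the 1 being
   for [g i]. *)
pose Q (i : 'I_Lam) : pred S := [pred x | special x || (x == g i)].
have wG t : C t -> \prod_i wt (G t i) = th ^+ D.
  move=> Ct; rewrite -(cD t Ct) -sum1_count.
  rewrite (eq_bigr (fun i : 'I_Lam => wt (nth s0 (F t) i))); last by move=> i _; rewrite ffunE.
  rewrite -(big_mkord xpredT (fun i => wt (nth s0 (F t) i))) -{1}(sF t).
  rewrite -(big_nth s0 xpredT wt).
  elim: (F t) => [|x u IH]; first by rewrite !big_nil expr0.
  by rewrite !big_cons IH /wt; case: ifP => _; rewrite ?mul1r// exprD expr1.
have H : th ^+ D * #|C|%:R <= \prod_(i < Lam) \sum_(x | Q i x) wt x.
  rewrite bigA_distr_big_dep mulrC mulr_natl -sumr_const.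
  rewrite (eq_bigr (fun t => \prod_i wt (G t i))); last by move=> t Ct; rewrite wG.
  rewrite -[leLHS]big_enum -(big_map G xpredT (fun u : {ffun 'I_Lam -> S} => \prod_i wt (u i)))/=.
  rewrite [leRHS](bigID (fun u => u \in [seq G t | t <- enum C]))/= ler_wpDr//.
    by apply: sumr_ge0 => u _; apply: prodr_ge0 => i _; exact: wt0.
  rewrite big_uniq/=; last by rewrite map_inj_uniq// enum_uniq.
  rewrite le_eqVlt; apply/orP; left; apply/eqP; apply: eq_bigl => u.
  apply/idP/andP => [|[]//] uC; split => //.
  have /mapP[t + ->] := uC; rewrite mem_enum => Ct; apply/familyP => i; rewrite inE ffunE.
  have [->//|->] := HC t i Ct (ltn_ord i).
  by rewrite eqxx orbT.
rewrite -ler_pdivlMl ?exprn_gt0// in H.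
apply: le_trans H _; rewrite ler_wpM2l ?invr_ge0 ?exprn_ge0 ?(ltW th0)//.
rewrite -[X in _ ^+ X]card_ord -prodr_const; apply: ler_prod => i _.
rewrite sumr_ge0//=.
rewrite (bigID special)/= [leRHS]addrC; apply: lerD.
  rewrite (eq_bigl special) => [|x]; last by rewrite /Q/=; case: (special x); rewrite ?andbF.
  rewrite (eq_bigr (fun=> th)) ?sumr_const ?mulr_natl// => x sx.
  by rewrite /wt sx.
apply: (@le_trans _ _ (\sum_(x | x == g i) (1 : R))); last by rewrite big_pred1_eq.
rewrite big_mkcond [leRHS]big_mkcond; apply: ler_sum => x _ /=.
rewrite /wt /Q/=; case: (special x); rewrite ?andbF/=; first by case: ifP.
by rewrite andbT.
Qed.

End CompatCount.

(** * Chains and loops *)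

Section Chains.
Context {R : realType} {X : pointedMetricType R}.
Hypothesis Xcompact : compact [set: X].
Variable f : X -> X.
Hypothesis fcont : continuous f.
Implicit Types (delta : R) (p x y : X).

Definition jump delta : rel X := [rel a b | mdist (f a) b <= delta].

Lemma jump_refl delta v : 0 <= delta -> jump delta v (f v).
Proof. by move=> d0; rewrite /jump /= mdistxx. Qed.

Lemma jump_orbit delta y m v : 0 <= delta -> mdist (iter m.+1 f v) y <= delta ->
  path (jump delta) v (rcons (traject f (f v) m) y).
Proof.
move=> d0; elim: m v => [|m IH] v; first by rewrite /= andbT.
by rewrite iterSr => /IH /= ->; rewrite jump_refl.
Qed.

Lemma path_orbit delta m v : 0 <= delta -> path (jump delta) v (traject f (f v) m).
Proof. by move=> d0; elim: m v => [|m IH] v //=; rewrite jump_refl// IH. Qed.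

(* Transitivity gives chains between the members of a finite net, whose lengths are
   then bounded uniformly. *)
Lemma bounded_chains delta : top_transitive f -> 0 < delta ->
  exists M, forall x y, exists2 u, (size u <= M)%N & path (jump delta) x (rcons u y).
Proof.
move=> ft d0; have [d d_gt0 Hd] := unif_cont Xcompact fcont (half_gt0 d0).
have [s Hs] := finite_net Xcompact (fun=> half_gt0 d_gt0).
have [s' Hs'] := finite_net Xcompact (fun=> half_gt0 (half_gt0 d0)).
(* A transition from near [c] to near [c']: [nu.1] is its duration and [nu.2] its starting point. *)
have /choice[nu Hnu] : forall cc : X * X, exists nu : nat * X, [/\ (0 < nu.1)%N,
    mdist cc.1 nu.2 < d / 2 & mdist cc.2 (iter nu.1 f nu.2) < delta / 2 / 2].
  move=> [c c'].
  have [||n [n0 [_ [[u /= cu <-] /= c'u]]]] := ft [set y | mdist c y < d / 2]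
    [set y | mdist c' y < delta / 2 / 2] (open_mdist _ _) (open_mdist _ _).
  - by exists c => /=; rewrite mdistxx half_gt0.
  - by exists c' => /=; rewrite mdistxx !half_gt0.
  - by exists (n, u).
pose M := (\max_(c <- s) \max_(c' <- s') (nu (c, c')).1)%N.
exists M => x y; have [c cs cx] := Hs x; have [c' cs' c'y] := Hs' y.
have [n0 cu c'u] := Hnu (c, c').
have nM : ((nu (c, c')).1 <= M)%N.
  apply: (@leq_trans (\max_(c' <- s') (nu (c, c')).1)%N).
    by apply: (@leq_bigmax_seq _ s' xpredT (fun c' => (nu (c, c')).1)).
  by apply: (@leq_bigmax_seq _ s xpredT (fun c => \max_(c' <- s') (nu (c, c')).1)%N).
move: n0 cu c'u nM; case: (nu (c, c')) => n u /= n0 cu c'u nM.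
have fxu : mdist (f x) (f u) < delta / 2.
  by apply: Hd; have := mdist_tri x c u; rewrite (mdist_symm x c); lra.
have fuy : mdist (iter n f u) y < delta / 2.
  by have := mdist_tri (iter n f u) c' y; rewrite (mdist_symm (iter n f u) c'); lra.
case: n n0 {c'u} nM fuy => [//|[|n]] _ nM fuy.
  exists [::] => //; rewrite /= andbT /jump /=.
  by have := mdist_tri (f x) (f u) y; move: fuy => /=; lra.
exists (traject f (f u) n.+1); first by rewrite size_traject ltnW.
rewrite /= {1}/jump/= ltW/=; last by lra.
by apply: jump_orbit; [exact: ltW|rewrite -iterSr; lra].
Qed.

(** At the last index the default value [p] of [nth] turns the condition into the closing jump back
    to [p]. *)
Definition isloop delta p (s : seq X) : Prop := nth p s 0 = p /\
  forall i, (i < size s)%N -> jump delta (nth p s i) (nth p s i.+1).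

Lemma isloop_path delta p (s : seq X) :
  path (jump delta) p (rcons s p) -> isloop delta p (p :: s).
Proof.
move=> /(pathP p) H; split=> // i /= is_.
have := H i; rewrite size_rcons => /(_ is_).
rewrite nth_rcons -rcons_cons nth_rcons /= is_.
case: ltnP => // si; case: ifP => // _.
  by rewrite (nth_default _ si).
by rewrite (nth_default _ si).
Qed.

Lemma isloop_cat delta p (s t : seq X) :
  isloop delta p s -> isloop delta p t -> isloop delta p (s ++ t).
Proof.
move=> [s0 Hs] [t0 Ht]; split.
  by case: s s0 {Hs} => //= a s ->.
move=> i; rewrite size_cat !nth_cat => ist.
case: (ltnP i (size s)) => [is_|si].
  case: ltnP => [|si]; first by move=> _; exact: Hs.
  have -> : i.+1 = size s by apply/eqP; rewrite eqn_leq is_ si.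
  by rewrite subnn t0; have := Hs i is_; rewrite (nth_default _ si).
rewrite ltnNge leqW//= subSn//; apply: Ht.
by rewrite ltn_subLR.
Qed.

Lemma isloop_flatten delta p (T : eqType) (b : T -> seq X) (s : seq T) :
  (forall t, t \in s -> isloop delta p (b t)) ->
  isloop delta p (flatten [seq b t | t <- s]).
Proof.
elim: s => [|t s IH] H /=; first by split.
apply: isloop_cat; first by apply: H; rewrite mem_head.
by apply: IH => u us; apply: H; rewrite inE us orbT.
Qed.

(** [M] is fixed before the orbit segment and its length, so the length can afterwards be taken so
    large that the connections are negligible. *)
Lemma bounded_loops delta : top_transitive f -> 0 < delta ->
  exists M, forall p x n, (0 < n)%N -> exists u v, [/\ (size u <= M)%N, (size v <= M)%N &
    isloop delta p (p :: u ++ traject f x n ++ v)].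
Proof.
move=> ft d0; have [M HM] := bounded_chains ft d0.
exists M => p x [//|n] _.
have [u uM pu] := HM p x; have [v vM pv] := HM (iter n f x) p.
exists u, v; split => //; apply: isloop_path.
rewrite rcons_cat /= -cat_rcons cat_path pu last_rcons /= rcons_cat cat_path.
by rewrite path_orbit ?(ltW d0)//= last_traject pv.
Qed.

(** At the end of a block the default value [p] of [nth] coincides with the first point of the next
    block, as all blocks are loops at [p]. *)
Lemma concat_pseudo_orbit delta p (T : finType) (b : T -> seq X) Lam (tau : nat -> T) :
  (0 < Lam)%N -> (forall t, size (b t) = Lam) -> (forall t, isloop delta p (b t)) ->
  pseudo_orbit f delta (concat p Lam b tau).
Proof.
move=> L0 sb lb i; rewrite /concat.
have [_ /(_ (i %% Lam)%N)] := lb (tau (i %/ Lam)%N).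
rewrite sb ltn_pmod// => /(_ isT) /=; congr (mdist _ _ <= _).
case: (ltnP (i %% Lam).+1 Lam) => h.
  have e : i.+1 = (i %/ Lam * Lam + (i %% Lam).+1)%N by rewrite addnS -divn_eq.
  by rewrite e divnMDl// modnMDl (divn_small h) addn0 (modn_small h).
have e : i.+1 = ((i %/ Lam).+1 * Lam)%N.
  by rewrite mulSn addnC {1}(divn_eq i Lam) -addnS; congr addn; apply/eqP; rewrite eqn_leq h ltn_pmod.
rewrite nth_default ?sb// e mulnK// modnMl.
by case: (lb (tau (i %/ Lam).+1)).
Qed.

End Chains.

(** * The lower bound *)

Section TracedAverages.
Context {R : realType} {X : pointedMetricType R}.
Local Notation Mp := (@Mprob R X).
Hypothesis Xcompact : compact [set: X].
Variable f : X -> X.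
Hypothesis fcont : continuous f.
Variables (T : finType) (p : X) (Lam : nat) (b : T -> seq X) (eps : R).
Hypotheses (Lam0 : (0 < Lam)%N) (sb : forall t, size (b t) = Lam).

Lemma sum_blocks (F : nat -> R) q :
  \sum_(i < q * Lam) F i = \sum_(j < q) \sum_(a < Lam) F (j * Lam + a)%N.
Proof.
rewrite -(big_mkord xpredT F) big_nat_mul big_mkord; apply: eq_bigr => j _.
rewrite -{1}[(j * Lam)%N]add0n big_addn mulSn addnK big_mkord.
by apply: eq_bigr => a _; rewrite addnC.
Qed.

(** The errors are [t] for tracing, [t'] for the deviation of a block, and [t] for the incomplete
    last block once [n] is large compared with [Lam * B]. *)
Lemma traced_emp (g : X -> R) (B I t t' : R) x :
  (forall y, `|g y| <= B) -> `|I| <= B -> 0 < t -> 0 <= t' ->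
  (forall y z, mdist y z <= eps -> `|g y - g z| <= t) ->
  (forall a, `|\sum_(y <- b a) g y - Lam%:R * I| <= Lam%:R * t') ->
  traced f p Lam b eps x ->
  exists N : nat, forall n, (N <= n)%N -> (0 < n)%N ->
    `|emp_integ f x n g - I| <= t + t' + t.
Proof.
move=> gB IB t0 t'0 gt bt tx.
have B0 : 0 <= B by apply: le_trans IB.
pose N := (Num.truncn (Lam%:R * (2 * B) / t)).+1.
exists N => n Nn n0.
have Nt : Lam%:R * (2 * B) <= n%:R * t.
  rewrite -ler_pdivrMr//; apply: ltW.
  have h : 0 <= Lam%:R * (2 * B) / t by rewrite divr_ge0 ?(ltW t0)// !mulr_ge0.
  have /andP[_ /lt_le_trans] := truncn_itv h; apply.
  by rewrite ler_nat.
have nR : 0 < (n%:R : R) by rewrite ltr0n.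
pose q := (n %/ Lam)%N; have [tau Htau] := tx q.
have qn : (q * Lam <= n)%N by exact: leq_trunc_div.
have E : emp_integ f x n g - I = n%:R^-1 * \sum_(i < n) (g (iter i f x) - I).
  rewrite /emp_integ sumrB sumr_const card_ord -[I *+ n]mulr_natl mulrBr.
  by rewrite mulrA mulVf ?gt_eqF// mul1r.
rewrite E normrM ger0_norm ?invr_ge0// mulrC ler_pdivrMr//.
pose F i := g (iter i f x) - I.
have FB i : `|F i| <= 2 * B.
  by rewrite (le_trans (ler_normB _ _))//; have := gB (iter i f x); lra.
rewrite -(big_mkord xpredT F) (big_cat_nat (n := q * Lam))//=.
have h1 : `|\sum_(0 <= i < q * Lam) F i| <= n%:R * (t + t').
  rewrite big_mkord sum_blocks.
  apply: (@le_trans _ _ (\sum_(j < q) Lam%:R * (t + t'))); last first.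
    rewrite sumr_const card_ord -[_ *+ _]mulr_natl mulrA -natrM ler_wpM2r//.
      by rewrite addr_ge0// ltW.
    by rewrite ler_nat.
  apply: le_trans (ler_norm_sum _ _ _) _; apply: ler_sum => j _.
  have -> : \sum_(a < Lam) F (j * Lam + a)%N =
      \sum_(a < Lam) (g (iter (j * Lam + a) f x) - g (nth p (b (tau j)) a)) +
      (\sum_(y <- b (tau j)) g y - Lam%:R * I).
    rewrite (big_nth p) sb big_mkord -[Lam%:R * I](_ : \sum_(a < Lam) I = _); last first.
      by rewrite sumr_const card_ord mulr_natl.
    by rewrite -sumrB -big_split; apply: eq_bigr => a _ /=; rewrite /F addrA subrK.
  apply: le_trans (ler_normD _ _) _; rewrite mulrDr; apply: lerD => //.
  apply: le_trans (ler_norm_sum _ _ _) _.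
  rewrite mulr_natl -[X in _ <= _ *+ X]card_ord -sumr_const; apply: ler_sum => a _.
  apply: gt; have jL : (j * Lam + a < q * Lam)%N.
    by apply: (@leq_trans (j.+1 * Lam)); [rewrite mulSn addnC ltn_add2r|rewrite leq_mul2r ltn_ord orbT].
  by have := Htau _ jL; rewrite /concat divnMDl// divn_small// addn0 modnMDl modn_small.
have h2 : `|\sum_(q * Lam <= i < n) F i| <= n%:R * t.
  apply: le_trans Nt; apply: le_trans (ler_norm_sum _ _ _) _.
  apply: (@le_trans _ _ (\sum_(q * Lam <= i < n) 2 * B)); first exact: ler_sum.
  rewrite sumr_const_nat -[_ *+ _]mulr_natl ler_wpM2r ?mulr_ge0// ler_nat.
  by rewrite {1}(divn_eq n Lam) addKn ltnW// ltn_pmod.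
by apply: le_trans (ler_normD _ _) _; rewrite mulrC mulrDr; apply: lerD.
Qed.

Lemma Rint_bound (nu : Mp) (g : X -> R) (B : R) : continuous g ->
  (forall y, `|g y| <= B) -> `|Rint nu g| <= B.
Proof.
move=> gc gB; rewrite ler_norml; apply/andP; split.
  rewrite -(Rint_cst Xcompact nu (- B)); apply: Rint_le => // [|y].
    by move=> y; exact: cvg_cst.
  by have := gB y; rewrite ler_norml => /andP[].
rewrite -(Rint_cst Xcompact nu B); apply: Rint_le => // [|y].
  by move=> y; exact: cvg_cst.
by have := gB y; rewrite ler_norml => /andP[].
Qed.

(** [traced_emp] gives three [t], and a fourth comes from approximating [mu] by an empirical
    average. *)
Lemma traced_Dsub (U : set Mp) (nu : Mp) (k : nat) (gs : 'I_k -> X -> R) (e t B : R) :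
  (forall j, continuous (gs j)) -> 0 < t -> 4 * t < e ->
  (forall mu, Minv f mu ->
     (forall j, (`| integ mu (gs j) - integ nu (gs j) | < e%:E)%E) -> U mu) ->
  (forall j y, `|gs j y| <= B) ->
  (forall j y z, mdist y z <= eps -> `|gs j y - gs j z| <= t) ->
  (forall j a, `|\sum_(y <- b a) gs j y - Lam%:R * Rint nu (gs j)| <= Lam%:R * t) ->
  traced f p Lam b eps `<=` Dsub f U.
Proof.
move=> gsc t0 te HU gB gt bt x tx mu V; apply: HU; first exact: (Vlim_Minv Xcompact fcont V).
move=> j; rewrite !(integE Xcompact)// -EFinB abse_EFin lte_fin.
have [N HN] := traced_emp (gB j) (Rint_bound nu (gsc j) (gB j)) t0 (ltW t0) (gt j) (bt j) tx.
have [n [Nn n0 Hn]] := Vlim_near N V (gsc j) t0.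
have := HN n Nn n0; move: Hn; rewrite !(ltr_norml, ler_norml).
by move=> /andP[? ?] /andP[? ?]; apply/andP; split; lra.
Qed.

End TracedAverages.

(** * Closed cores and mean statistics of words *)

Section WordStatistics.
Context {R : realType} {X : pointedMetricType R}.
Local Notation Mp := (@Mprob R X).
Hypothesis Xcompact : compact [set: X].
Variable f : X -> X.
Hypothesis fcont : continuous f.
Implicit Types (nu : Mp).

(* The disjoint closed cores are at positive distance from each other, so that the
   label of a point of a core can be read off from any point close to it. *)
Lemma closed_cores nu (A : finType) (la : X -> A) (gam : R) : mlab la -> 0 < gam ->
  exists K : A -> set X, [/\ forall a, closed (K a), forall a x, K a x -> la x = a,
    mlab (fun x => (la x, `[< K (la x) x >])) &
    \sum_a pr nu ((fun x => (la x, `[< K (la x) x >])) @^-1` [set (a, false)]) <= gam].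
Proof.
move=> ml gam0.
have A0 : 0 < (#|A|.+1%:R : R) by rewrite ltr0n.
have /choice[K HK] : forall a, exists K, [/\ closed K, K `<=` la @^-1` [set a] &
    pr nu (la @^-1` [set a] `\` K) < gam / #|A|.+1%:R].
  move=> a; have [F [G [cF oG FA AG H]]] := prob_regular nu (ml a) (divr_gt0 gam0 A0).
  exists F; split => //; apply: le_lt_trans H; apply: pr_le.
  - by apply: measurableD; [exact: ml|exact: bmeas_closed].
  - by apply: measurableD; [exact: bmeas_open|exact: bmeas_closed].
  - by move=> x [/AG].
have Kc a : closed (K a) by case: (HK a).
have Kl a x : K a x -> la x = a by have [_ + _] := HK a; apply.
have false_E a : (fun x => (la x, `[< K (la x) x >])) @^-1` [set (a, false)] =
    la @^-1` [set a] `\` K a.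
  apply/seteqP; split=> x /=.
    by move=> [<- /negbT/asboolPn].
  by move=> [<- nK]; congr pair; apply/negbTE/asboolPn.
have true_E a : (fun x => (la x, `[< K (la x) x >])) @^-1` [set (a, true)] = K a.
  apply/seteqP; split=> x /=.
    by move=> [<-] /asboolP.
  by move=> Kx; rewrite (Kl _ _ Kx); congr pair; apply/asboolP.
exists K; split => //.
  move=> [a []]; rewrite ?true_E ?false_E; first exact: bmeas_closed.
  by apply: measurableD; [exact: ml|exact: bmeas_closed].
apply: (@le_trans _ _ (\sum_(a : A) gam / #|A|.+1%:R)).
  by apply: ler_sum => a _; rewrite false_E; case: (HK a) => _ _ /ltW.
rewrite sumr_const -[_ *+ _]mulr_natl mulrCA ler_piMr ?(ltW gam0)//.
by rewrite ler_pdivrMr// mul1r ler_nat.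
Qed.

Lemma cores_separated (A : finType) (K : A -> set X) (la : X -> A) :
  (forall a, closed (K a)) -> (forall a x, K a x -> la x = a) ->
  exists2 d : R, 0 < d & forall a b x y, K a x -> K b y -> mdist x y < d -> a = b.
Proof.
move=> cK Kl.
have /choice[r Hr] : forall ab : A * A, exists r : R, 0 < r /\
    (ab.1 != ab.2 -> forall x y, K ab.1 x -> K ab.2 y -> r <= mdist x y).
  move=> [a b]; have [->|ab] := eqVneq a b; first by exists 1; split=> //=; rewrite eqxx.
  have [|d d0 Hd] := closed_disjoint_dist Xcompact (cK a) (cK b); last by exists d.
  rewrite -subset0 => x [/Kl xa /Kl xb]; move/eqP: ab; apply.
  by rewrite -xa -xb.
have [d d0 Hd] := @min_seq R _ (enum {: A * A}) r (fun c => (Hr c).1).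
exists d => // a b x y Kx Ky xy; apply/eqP; apply: contraT => ab.
have := (Hr (a, b)).2 ab x y Kx Ky; have := Hd (a, b); rewrite mem_enum => /(_ isT).
by move=> h1 h2; move: xy; rewrite ltNge (le_trans h1 h2).
Qed.

(** By invariance each letter of a word is distributed like the label of a point. *)
Lemma word_marginal nu (C : finType) (lab : X -> C) n (Phi : C -> R) (i : 'I_n) :
  Minv f nu -> mlab lab ->
  \sum_(w : {ffun 'I_n -> C}) pr nu (word f lab n @^-1` [set w]) * Phi (w i) =
  \sum_c pr nu (lab @^-1` [set c]) * Phi c.
Proof.
move=> inv ml; have mw : mlab (word f lab n) by exact: mlab_word.
rewrite (partition_big (fun w : {ffun 'I_n -> C} => w i) xpredT)//=.
apply: eq_bigr => c _.
rewrite (eq_bigr (fun w => pr nu (word f lab n @^-1` [set w]) * Phi c)); last first.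
  by move=> w /eqP ->.
rewrite -mulr_suml; congr (_ * _).
rewrite -(pr_comp nu (fun w : {ffun 'I_n -> C} => w i) c mw) -(pr_iter i fcont inv (ml c)).
by congr pr; apply/seteqP; split=> x /=; rewrite ffunE.
Qed.

(** Only the mean over words is controlled: without ergodicity single words may deviate. One [tau]
    pays for replacing orbit points by representatives of their labels, the other for comparing the
    mean over labels with the integral. *)
Lemma word_average nu (C : finType) (lab : X -> C) n (g : X -> R) (tau : R)
    (xw : {ffun 'I_n -> C} -> X) :
  Minv f nu -> mlab lab -> continuous g -> 0 <= tau ->
  (forall y z, lab y = lab z -> `|g y - g z| <= tau) ->
  (forall w, 0 < pr nu (word f lab n @^-1` [set w]) -> word f lab n (xw w) = w) ->
  `|\sum_w pr nu (word f lab n @^-1` [set w]) *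
      (\sum_(i < n) g (iter i f (xw w)) - n%:R * Rint nu g)| <= n%:R * (2 * tau).
Proof.
move=> inv ml gc tau0 gt Hx; have mw : mlab (word f lab n) by exact: mlab_word.
pose pw w := pr nu (word f lab n @^-1` [set w]).
have /choice[y Hy] : forall c, exists y, (exists y', lab y' = c) -> lab y = c.
  move=> c; have [[y' Hy']|ny] := pselect (exists y', lab y' = c); first by exists y'.
  by exists point.
pose J := \sum_c pr nu (lab @^-1` [set c]) * g (y c).
have gy z : `|g z - g (y (lab z))| <= tau.
  by apply: gt; rewrite Hy//; exists z.
have hJ : `|J - Rint nu g| <= tau.
  have cov x : exists c, (lab @^-1` [set c]) x by exists (lab x).
  have lo := @Rint_ge_sum _ _ Xcompact C nu g (fun c => lab @^-1` [set c])
    (fun c => g (y c) - tau) gc ml (@lab_disj _ _ _ lab) cov.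
  have up := @Rint_le_sum _ _ Xcompact C nu g (fun c => lab @^-1` [set c])
    (fun c => g (y c) + tau) gc ml (@lab_disj _ _ _ lab) cov.
  have e1 : \sum_c (g (y c) - tau) * pr nu (lab @^-1` [set c]) = J - tau.
    under eq_bigr do rewrite mulrBl mulrC.
    by rewrite sumrB -mulr_sumr (pr_lab1 nu ml) mulr1.
  have e2 : \sum_c (g (y c) + tau) * pr nu (lab @^-1` [set c]) = J + tau.
    under eq_bigr do rewrite mulrDl mulrC.
    by rewrite big_split/= -mulr_sumr (pr_lab1 nu ml) mulr1.
  rewrite e1 in lo; rewrite e2 in up; rewrite ler_norml.
  have h1 : J - tau <= Rint nu g.
    by apply: lo => c x <-; have := gy x; rewrite ler_norml => /andP[? ?]; lra.
  have h2 : Rint nu g <= J + tau.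
    by apply: up => c x <-; have := gy x; rewrite ler_norml => /andP[? ?]; lra.
  by apply/andP; split; lra.
have -> : \sum_w pw w * (\sum_(i < n) g (iter i f (xw w)) - n%:R * Rint nu g) =
    \sum_(i < n) (\sum_w pw w * (g (iter i f (xw w)) - g (y (w i))) + (J - Rint nu g)).
  have E w : pw w * (\sum_(i < n) g (iter i f (xw w)) - n%:R * Rint nu g) =
     \sum_(i < n) (pw w * (g (iter i f (xw w)) - g (y (w i))) + pw w * g (y (w i)) -
       pw w * Rint nu g).
    rewrite -[n%:R * _](_ : \sum_(i < n) Rint nu g = _); last first.
      by rewrite sumr_const card_ord mulr_natl.
    by rewrite -sumrB mulr_sumr; apply: eq_bigr => i _; ring.
  rewrite (eq_bigr _ (fun w _ => E w)) exchange_big/=; apply: eq_bigr => i _.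
  rewrite sumrB big_split/= (word_marginal (fun c => g (y c)) i inv ml) -/J.
  by rewrite -mulr_suml (pr_lab1 nu mw) mul1r addrA.
apply: le_trans (ler_norm_sum _ _ _) _.
rewrite mulr_natl -[X in _ <= _ *+ X]card_ord -sumr_const; apply: ler_sum => i _.
apply: le_trans (ler_normD _ _) _.
suff : `|\sum_w pw w * (g (iter i f (xw w)) - g (y (w i)))| <= tau by move: hJ; lra.
apply: le_trans (ler_norm_sum _ _ _) _.
have -> : tau = \sum_w pw w * tau by rewrite -mulr_suml (pr_lab1 nu mw) mul1r.
apply: ler_sum => w _; have pw0 : 0 <= pw w by exact: pr_ge0.
rewrite normrM (ger0_norm pw0); move: pw0; rewrite le_eqVlt => /predU1P[<-|pw0].
  by rewrite !mul0r.
rewrite ler_pM2l//.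
have -> : w i = lab (iter i f (xw w)) by rewrite -{1}(Hx w pw0) ffunE.
exact: gy.
Qed.

End WordStatistics.

(** * Blocks and their symbolic counterparts *)

Section Symbols.
Context {R : realType} {X : pointedMetricType R}.
Variable f : X -> X.
Variables (A : finType) (lab : X -> A * bool) (n : nat) (p0 : X).
Local Notation W := {ffun 'I_n -> A * bool}.
Variables (xw : W -> X) (u v : W -> seq X).

(* A block is a loop through [p0] that contains an orbit segment of length [n] with
   itinerary [w]; its symbolic counterpart [sym w] marks the connecting points by
   [None]. The boolean in a letter tells whether the point lies in a closed core, and
   the letters which do not determine a core are the special ones. *)
Definition block (w : W) : seq X := p0 :: u w ++ traject f (xw w) n ++ v w.

Definition letters (w : W) : seq (A * bool) := [seq w i | i <- enum 'I_n].

Definition sym (w : W) : seq (option (A * bool)) :=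
  nseq (size (u w)).+1 None ++ [seq Some c | c <- letters w] ++ nseq (size (v w)) None.

Definition special (c : option (A * bool)) : bool :=
  if c is Some (_, true) then false else true.

Lemma size_letters w : size (letters w) = n.
Proof. by rewrite size_map size_enum_ord. Qed.

Lemma size_block w : size (block w) = (size (u w) + size (v w) + n).+1.
Proof. by rewrite /= !size_cat size_traject -addnA [(n + _)%N]addnC. Qed.

Lemma size_sym w : size (sym w) = size (block w).
Proof. by rewrite size_block !size_cat !size_nseq size_map size_letters; lia. Qed.

Lemma count_special_sym w : count special (sym w) =
  (size (u w) + size (v w)).+1 + count (fun c => ~~ c.2) (letters w).
Proof.
rewrite !count_cat !count_nseq /= !mul1n count_map.
rewrite (eq_count (a2 := fun c => ~~ c.2)); last by case=> a [].
lia.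
Qed.

Lemma count_letters w : count (fun c => ~~ c.2) (letters w) =
  \sum_(i < n) (~~ (w i).2 : nat).
Proof. by rewrite count_map -sum1_count big_mkcond/= big_enum/=; apply: eq_bigr => i _; case: ifP. Qed.

(** Where the symbol is a letter, the block runs along the orbit of [xw w], whose itinerary is
    [w]. *)
Lemma label_block w i c : word f lab n (xw w) = w ->
  nth None (sym w) i = Some c -> lab (nth p0 (block w) i) = c.
Proof.
move=> ww; rewrite /sym /block -cat_cons !nth_cat size_nseq -[size (p0 :: u w)]/((size (u w)).+1).
case: ltnP => hi; first by rewrite nth_nseq; case: ifP.
rewrite size_map size_letters size_traject; case: ltnP => hi'; last first.
  by rewrite nth_nseq; case: ifP.
have i0 : 'I_n by exact: (Ordinal hi').
rewrite (nth_map (w i0)) ?size_letters// (nth_map i0) ?size_enum_ord//.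
case=> <-; rewrite (set_nth_default (xw w)) ?size_traject// nth_traject//.
have -> : nth i0 (enum 'I_n) (i - (size (u w)).+1) = Ordinal hi'.
  by apply: val_inj; rewrite /= nth_enum_ord.
by move/ffunP/(_ (Ordinal hi')) : ww; rewrite ffunE.
Qed.

Let flatten_consE (T : Type) (t : seq T) ss : flatten (t :: ss) = t ++ flatten ss.
Proof. by []. Qed.

Lemma size_blocks (s : seq W) :
  size (flatten [seq sym w | w <- s]) = size (flatten [seq block w | w <- s]).
Proof. elim: s => // w s IH; by rewrite !map_cons !flatten_consE size_cat size_sym IH [in RHS]size_cat. Qed.

Lemma label_blocks (s : seq W) i c : (forall w, w \in s -> word f lab n (xw w) = w) ->
  nth None (flatten [seq sym w | w <- s]) i = Some c ->
  lab (nth p0 (flatten [seq block w | w <- s]) i) = c.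
Proof.
elim: s i => [|w s IH] i H; first by rewrite /= nth_nil.
rewrite !map_cons !flatten_consE.
rewrite (nth_cat None) (nth_cat p0) size_sym.
case: ltnP => _; first by apply: label_block; apply: H; rewrite mem_head.
by apply: IH => w' w's; apply: H; rewrite inE w's orbT.
Qed.

Lemma pmap_sym w : pmap id (sym w) = letters w.
Proof.
rewrite !pmap_cat (_ : pmap id (nseq _ None) = [::]); last by elim: (_.+1).
rewrite (_ : pmap id (nseq _ None) = [::]); last by elim: (size _).
by rewrite cats0 /=; elim: (letters w) => //= c l ->.
Qed.

(** Erasing the marks [None] leaves a concatenation of words of the same length [n], which can be
    cut in only one way, whatever the lengths of the connections. *)
Lemma sym_inj (s s' : seq W) : (0 < n)%N -> size s = size s' ->
  flatten [seq sym w | w <- s] = flatten [seq sym w | w <- s'] -> s = s'.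
Proof.
move=> n0 ss /(congr1 (pmap id)).
have E t : pmap id (flatten [seq sym w | w <- t]) = flatten [seq letters w | w <- t].
  by elim: t => // w t IH; rewrite !map_cons !flatten_consE pmap_cat IH pmap_sym.
rewrite !E => e; apply: (@inj_map _ _ letters).
  by move=> w w' /eq_in_map ww; apply/ffunP => i; apply: ww; rewrite mem_enum.
apply: eq_from_flatten_shape e _.
have shE t : shape [seq letters w | w <- t] = nseq (size t) n.
  by elim: t => //= w t ->; rewrite size_letters.
by rewrite !shE ss.
Qed.

End Symbols.

(** * A list of blocks with the statistics of the measure *)

Section TypicalBlocks.
Context {R : realType} {X : pointedMetricType R}.
Local Notation Mp := (@Mprob R X).
Hypothesis Xcompact : compact [set: X].
Variable f : X -> X.
Hypothesis fcont : continuous f.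
Variables (nu : Mp) (A : finType) (lab : X -> A * bool) (n : nat) (p0 : X).
Local Notation W := {ffun 'I_n -> A * bool}.
Variables (xw : W -> X) (u v : W -> seq X).
Variables (k : nat) (gs : 'I_k -> X -> R) (B tau gam hh eta : R) (M : nat).
Hypotheses (inv : Minv f nu) (ml : mlab lab) (n0 : (0 < n)%N)
  (Hx : forall w, 0 < pr nu (word f lab n @^-1` [set w]) -> word f lab n (xw w) = w)
  (uM : forall w, (size (u w) <= M)%N) (vM : forall w, (size (v w) <= M)%N)
  (gsc : forall j, continuous (gs j)) (gB : forall j y, `|gs j y| <= B)
  (B0 : 0 <= B) (tau0 : 0 < tau)
  (gt : forall j y z, lab y = lab z -> `|gs j y - gs j z| <= tau)
  (gam0 : 0 < gam) (gam1 : gam <= 6^-1)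
  (bad : \sum_a pr nu (lab @^-1` [set (a, false)]) <= gam)
  (nM : (2 * M + 1)%:R <= gam * n%:R)
  (nMB : (2 * M + 1)%:R * (2 * B) <= tau * n%:R)
  (Hh : n%:R * hh <= Hl nu (word f lab n)) (eta0 : 0 < eta).

Local Notation blk := (block f p0 xw u v).
Local Notation sy := (sym u v).
Local Notation pw := (fun w : W => pr nu (word f lab n @^-1` [set w])).

Let mw : mlab (word f lab n). Proof. exact: mlab_word. Qed.
Let nR : 1 <= (n%:R : R). Proof. by rewrite ler1n. Qed.
Let uvM w : ((size (u w) + size (v w)).+1 <= 2 * M + 1)%N.
Proof. by rewrite addn1 ltnS mul2n -addnn leq_add. Qed.

Let dev j (w : W) : R :=
  \sum_(y <- blk w) gs j y - (size (blk w))%:R * Rint nu (gs j).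

(** [word_average] contributes [2 * tau * n]; the connections and [p0] contribute the rest by
    [nMB]. *)
Let dev_mean j : `|\sum_w pw w * dev j w| <= 3 * (tau * n%:R).
Proof.
pose I := Rint nu (gs j).
have IB : `|I| <= B by exact: Rint_bound.
have HA := word_average Xcompact fcont inv ml (@gsc j) (ltW tau0) (@gt j) Hx.
have D w : `|dev j w - (\sum_(i < n) gs j (iter i f (xw w)) - n%:R * I)| <= tau * n%:R.
  have -> : dev j w - (\sum_(i < n) gs j (iter i f (xw w)) - n%:R * I) =
      (gs j p0 - I) + \sum_(y <- u w) (gs j y - I) + \sum_(y <- v w) (gs j y - I).
    have st : \sum_(y <- traject f (xw w) n) gs j y = \sum_(i < n) gs j (iter i f (xw w)).
      rewrite (big_nth p0) size_traject big_mkord; apply: eq_bigr => i _.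
      by rewrite (set_nth_default (xw w)) ?size_traject// nth_traject.
    have SB (s : seq X) : \sum_(y <- s) (gs j y - I) = \sum_(y <- s) gs j y - (size s)%:R * I.
      by rewrite sumrB big_const_seq count_predT iter_addr_0 mulr_natl.
    rewrite !SB /dev size_block big_cons !big_cat/= st -/I -addn1 !natrD.
    move: (\sum_(y <- u w) _) (\sum_(y <- v w) _) (\sum_(i < n) _) => a b c.
    by move: ((size (u w))%:R) ((size (v w))%:R) (n%:R : R) (gs j p0) => a1 a2 a3 a4; ring.
  have sB (s : seq X) : `|\sum_(y <- s) (gs j y - I)| <= (size s)%:R * (2 * B).
    apply: le_trans (ler_norm_sum _ _ _) _; rewrite mulr_natl -iter_addr_0 -count_predT -big_const_seq.
    by apply: ler_sum => y _; rewrite (le_trans (ler_normB _ _))//; have := gB j y; lra.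
  apply: le_trans nMB; apply: (@le_trans _ _ ((size (u w) + size (v w)).+1%:R * (2 * B))).
    rewrite -addn1 !natrD; have h1 := sB (u w); have h2 := sB (v w).
    have h3 : `|gs j p0 - I| <= 2 * B.
      by rewrite (le_trans (ler_normB _ _))//; have := gB j p0; lra.
    apply: le_trans (ler_normD _ _) _.
    have := ler_normD (gs j p0 - I) (\sum_(y <- u w) (gs j y - I)); lra.
  by rewrite ler_wpM2r ?mulr_ge0// ler_nat uvM.
have -> : \sum_w pw w * dev j w = \sum_w pw w * (\sum_(i < n) gs j (iter i f (xw w)) - n%:R * I) +
    \sum_w pw w * (dev j w - (\sum_(i < n) gs j (iter i f (xw w)) - n%:R * I)).
  by rewrite -big_split; apply: eq_bigr => w _ /=; ring.
apply: le_trans (ler_normD _ _) _.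
suff : `|\sum_w pw w * (dev j w - (\sum_(i < n) gs j (iter i f (xw w)) - n%:R * I))| <= tau * n%:R.
  by move: HA; rewrite -/I; lra.
apply: le_trans (ler_norm_sum _ _ _) _.
have -> : tau * n%:R = \sum_w pw w * (tau * n%:R) by rewrite -mulr_suml (pr_lab1 nu mw) mul1r.
by apply: ler_sum => w _; rewrite normrM (ger0_norm (pr_ge0 _ _)) ler_wpM2l ?pr_ge0.
Qed.

Let spec (w : W) : R := (count (@special A) (sy w))%:R.

(** One [gam * n] is for the connections and [p0], the other for the expected number of letters
    outside the cores. *)
Let spec_mean : \sum_w pw w * spec w <= 2 * (gam * n%:R).
Proof.
have E w : spec w <= gam * n%:R + \sum_(i < n) (~~ (w i).2)%:R.
  rewrite /spec count_special_sym natrD count_letters natr_sum lerD2r.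
  by apply: le_trans nM; rewrite ler_nat uvM.
apply: (@le_trans _ _ (\sum_w (pw w * (gam * n%:R) + \sum_(i < n) pw w * (~~ (w i).2)%:R))).
  apply: ler_sum => w _; rewrite -mulr_sumr -mulrDr ler_wpM2l ?pr_ge0//.
rewrite big_split/= -mulr_suml (pr_lab1 nu mw) mul1r exchange_big/=.
have H i : \sum_(w : W) pw w * (~~ (w i).2)%:R <= gam.
  rewrite (word_marginal fcont (fun c => (~~ c.2)%:R) i inv ml); apply: le_trans bad.
  have -> : \sum_c pr nu (lab @^-1` [set c]) * (~~ c.2)%:R =
     \sum_a \sum_b pr nu (lab @^-1` [set (a, b)]) * (~~ b)%:R.
    by rewrite pair_bigA; apply: eq_bigr => -[].
  by apply: ler_sum => a _; rewrite big_bool/= mulr0 mulr1 add0r.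
apply: (@le_trans _ _ (gam * n%:R + \sum_(i < n) gam)); first by rewrite lerD2l; apply: ler_sum.
by rewrite sumr_const card_ord -[gam *+ _]mulr_natl; lra.
Qed.

(* The words in the type class of [s] are the permutations of [s]: they all share the
   statistics of [nu] and there are about [exp (t n hh)] of them. *)
Lemma typical_blocks : exists (s : seq W) (t : nat), [/\ (0 < t)%N /\ s != [::],
  (forall w, w \in s -> word f lab n (xw w) = w),
  `|(size (flatten [seq blk w | w <- s]))%:R - t%:R * n%:R| <= 3 * gam * (t%:R * n%:R),
  (count (@special A) (flatten [seq sy w | w <- s]))%:R <= 3 * gam * (t%:R * n%:R) &
  (forall j, `|\sum_(y <- flatten [seq blk w | w <- s]) gs j y -
      (size (flatten [seq blk w | w <- s]))%:R * Rint nu (gs j)| <=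
      (size (flatten [seq blk w | w <- s]))%:R * (8 * tau)) /\
  t%:R * n%:R * (hh - eta) <= ln ((size (permutations s))%:R)].
Proof.
(* With [t >= E] the rounding errors of [type_class] are at most [gam * t] for the number of words
   and of special letters, and [tau * t] for each [dev j]. *)
pose E : R := #|W|%:R / gam + \sum_w `|spec w| / gam + \sum_j \sum_w `|dev j w| / tau.
have E1 : 0 <= #|W|%:R / gam by rewrite divr_ge0// ltW.
have E2 : 0 <= \sum_w `|spec w| / gam by apply: sumr_ge0 => w _; rewrite divr_ge0// ltW.
have E3 j : 0 <= \sum_w `|dev j w| / tau by apply: sumr_ge0 => w _; rewrite divr_ge0// ltW.
have E4 : 0 <= \sum_j \sum_w `|dev j w| / tau by exact: sumr_ge0.
have [s [t [Nt sp sF sN]]] := type_class (Num.truncn E).+1 (fun w => pr_ge0 nu (word f lab n @^-1` [set w]))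
  (pr_lab1 nu mw) eta0.
have E0 : 0 <= E by rewrite /E; lra.
have Et : E <= t%:R.
  have /andP[_ /ltW] := truncn_itv E0; move/le_trans; apply; by rewrite ler_nat.
have Wt : #|W|%:R <= gam * t%:R.
  rewrite mulrC -ler_pdivrMr//; apply: le_trans Et; rewrite /E; lra.
have spt : \sum_w `|spec w| <= gam * t%:R.
  rewrite mulrC -ler_pdivrMr//; apply: le_trans Et; rewrite mulr_suml /E; lra.
have devt j : \sum_w `|dev j w| <= tau * t%:R.
  rewrite mulrC -ler_pdivrMr//; apply: le_trans Et; rewrite mulr_suml /E.
  have : \sum_w `|dev j w| / tau <= \sum_j \sum_w `|dev j w| / tau.
    by rewrite [leRHS](bigD1 j)//= lerDl sumr_ge0.
  lra.
have t0 : (0 < t)%N by apply: leq_trans Nt.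
have tR : 1 <= (t%:R : R) by rewrite ler1n.
have tn : t%:R <= t%:R * n%:R :> R by rewrite ler_peMr.
have tn0 : 0 < t%:R * n%:R :> R by apply: lt_le_trans tn; lra.
have sL : `|(size s)%:R - t%:R| <= gam * t%:R.
  have := sF (fun=> 1).
  have -> : \sum_w pw w * 1 = 1 by under eq_bigr do rewrite mulr1; exact: pr_lab1.
  rewrite mulr1 big_const_seq count_predT iter_addr_0 => /le_trans; apply.
  by rewrite sumr_const normr1.
have LE : (size (flatten [seq blk w | w <- s]))%:R =
    \sum_(w <- s) (size (blk w))%:R :> R.
  rewrite size_flatten sumnE big_map big_map natr_sum//.
have Lhi : (size (flatten [seq blk w | w <- s]))%:R <= (1 + gam) * t%:R * ((1 + gam) * n%:R).
  rewrite LE; apply: (@le_trans _ _ (\sum_(w <- s) (1 + gam) * n%:R)).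
    apply: ler_sum => w _; rewrite size_block.
    apply: (@le_trans _ _ ((2 * M + 1 + n)%:R)); first by rewrite ler_nat -addSn leq_add2r uvM.
    by rewrite natrD mulrDl mul1r addrC lerD2l.
  rewrite big_const_seq count_predT iter_addr_0 -[_ *+ size s]mulr_natl ler_wpM2r//.
    by rewrite mulr_ge0//; have := gam0; lra.
  by move: sL; rewrite ler_norml => /andP[_]; lra.
have Llo : (1 - gam) * t%:R * n%:R <= (size (flatten [seq blk w | w <- s]))%:R.
  rewrite LE; apply: (@le_trans _ _ (\sum_(w <- s) n%:R)); last first.
    by apply: ler_sum => w _; rewrite size_block ler_nat -addSn leq_addl.
  rewrite big_const_seq count_predT iter_addr_0 -[_ *+ size s]mulr_natl ler_wpM2r//.
  by move: sL; rewrite ler_norml => /andP[+ _]; lra.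
have gx : gam * gam * (t%:R * n%:R) <= 6^-1 * gam * (t%:R * n%:R).
  apply: (ler_wpM2r (ltW tn0)); exact: (ler_wpM2r (ltW gam0)).
have gx0 : 0 <= gam * (t%:R * n%:R) by rewrite mulr_ge0 ?(ltW tn0)// ltW.
have gx1 : gam * (t%:R * n%:R) <= 6^-1 * (t%:R * n%:R) by move: gam1; exact: (ler_wpM2r (ltW tn0)).
have LtN : `|(size (flatten [seq blk w | w <- s]))%:R - t%:R * n%:R| <= 3 * gam * (t%:R * n%:R).
  by rewrite ler_norml; apply/andP; split; lra.
have half : t%:R * n%:R <= 2 * (size (flatten [seq blk w | w <- s]))%:R :> R.
  move: Llo gx1 tn0; move: ((size _)%:R) => S0; move: (t%:R) (n%:R) => a b; lra.
exists s, t; split.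
- split => //; apply/negP => /eqP se; move: half; rewrite se /= mulr0; lra.
- by move=> w /sp; exact: Hx.
- exact: LtN.
- have -> : (count (@special A) (flatten [seq sy w | w <- s]))%:R = \sum_(w <- s) spec w.
    by rewrite count_flatten sumnE big_map big_map natr_sum.
  have := sF spec; rewrite ler_norml => /andP[_]; rewrite lerBlDr => /le_trans; apply.
  have := ler_wpM2l (ltW (lt_le_trans ltr01 tR)) spec_mean.
  have : gam * t%:R <= gam * (t%:R * n%:R) by rewrite ler_wpM2l// ltW.
  move: spt; lra.
split.
  (* Rounding and mean deviation give at most [4 * tau * t * n], and [t * n] is at most twice the
     total length: hence [8 * tau]. *)
  move=> j; set I := Rint nu (gs j).
  have -> : \sum_(y <- flatten [seq blk w | w <- s]) gs j y -
      (size (flatten [seq blk w | w <- s]))%:R * I = \sum_(w <- s) dev j w.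
    by rewrite LE big_flatten/= big_map mulr_suml -sumrB.
  have H := sF (dev j).
  have H1 := dev_mean j.
  have H2 : `|t%:R * \sum_w pw w * dev j w| <= t%:R * (3 * (tau * n%:R)).
    by rewrite normrM ger0_norm// ler_wpM2l.
  have H3 : tau * t%:R <= tau * (t%:R * n%:R) by rewrite ler_wpM2l// ltW.
  have H4 := ler_wpM2l (ltW tau0) half.
  have H5 : `|\sum_(w <- s) dev j w| <= `|\sum_(w <- s) dev j w - t%:R * \sum_w pw w * dev j w| +
      `|t%:R * \sum_w pw w * dev j w|.
    by rewrite -{1}[\sum_(w <- s) dev j w](subrK (t%:R * \sum_w pw w * dev j w)) ler_normD.
  have H6 := devt j; lra.
apply: le_trans sN; rewrite -mulrA ler_wpM2l// mulrBr.
have : eta <= n%:R * eta by rewrite ler_peMl// ltW.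
by move: Hh; rewrite /Hl; lra.
Qed.

End TypicalBlocks.

(* The choice of constants for [lower_bound], applied to the bound of [compat_count]
   with [sg] letters, [D] special positions and [N] blocks of length [L], [L] close
   to [x]. *)
Lemma weighted_count_le (R : realType) (th kap gam s eta hh x N sg : R) (D L : nat) :
  0 < th -> `|ln th| <= kap -> 0 <= sg -> sg * th <= eta / 4 ->
  0 <= gam -> gam <= 6^-1 -> gam * (3 * kap + 3 * `|s| + 1) <= eta -> 0 <= x -> 0 < N ->
  D%:R <= 3 * gam * x -> `|L%:R - x| <= 3 * gam * x -> hh = s + 8 * eta ->
  x * (hh - eta) <= ln N ->
  th ^- D * (1 + sg * th) ^+ L <= expR (- (s * L%:R)) * N.
Proof.
move=> th0 lk sg0 sgth g0 g6 ge x0 N0 Dx Lx hE lN.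
have th1 : 0 <= sg * th by rewrite mulr_ge0// ltW.
have -> : th ^- D = expR (- (ln th * D%:R)).
  by rewrite expRN expRM_natr lnK// posrE.
have h1 : (1 + sg * th) ^+ L <= expR (sg * th * L%:R).
  by rewrite expRM_natr lerXn2r ?nnegrE ?expR_ge0 ?addr_ge0// expR_ge1Dx.
apply: le_trans (ler_wpM2l (expR_ge0 _) h1) _.
rewrite -{1}(lnK (_ : N \is Num.pos)) ?posrE// -!expRD ler_expR.
have D0 : 0 <= D%:R :> R by [].
have L0 : 0 <= L%:R :> R by [].
move: D0 L0 Dx Lx; move: (D%:R) (L%:R) => d l d0 l0 dx; rewrite ler_norml => /andP[l1 l2].
have a1 : - (ln th * d) <= kap * (3 * gam * x).
  rewrite -mulNr; apply: (@le_trans _ _ (kap * d)); first last.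
    by rewrite ler_wpM2l// (le_trans _ lk).
  by rewrite ler_wpM2r// (le_trans _ lk)// -normrN ler_norm.
have gx : gam * x <= 6^-1 * x by rewrite ler_wpM2r.
have a2 : sg * th * l <= eta / 4 * (2 * x).
  have l3 : l <= 2 * x by lra.
  by apply: (le_trans (ler_wpM2r l0 sgth)); rewrite ler_wpM2l// (le_trans th1).
have a3 : s * l <= s * x + `|s| * (3 * gam * x).
  rewrite -lerBlDl -mulrBr; apply: le_trans (ler_norm _) _; rewrite normrM ler_wpM2l//.
  by rewrite ler_norml; apply/andP; split; lra.
have a4 : gam * (3 * kap + 3 * `|s| + 1) * x <= eta * x by rewrite ler_wpM2r.
have a5 : 0 <= gam * x by rewrite mulr_ge0.
have a6 : 0 <= eta * x by rewrite mulr_ge0//; lra.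
by move: lN a1 a2 a3 a4 a5 a6; rewrite hE; lra.
Qed.

(** * Choice of constants and the lower bound *)

Section LowerBound.
Context {R : realType} {X : pointedMetricType R}.
Local Notation Mp := (@Mprob R X).
Hypothesis Xcompact : compact [set: X].
Variable f : X -> X.
Hypothesis fcont : continuous f.
Hypotheses (ftrans : top_transitive f) (ftrace : tracing_property f).

Lemma common_modulus k (gs : 'I_k -> X -> R) (t : R) : (forall j, continuous (gs j)) -> 0 < t ->
  exists B d : R, [/\ 0 <= B, 0 < d, (forall j y, `|gs j y| <= B) &
    forall j y z, mdist y z < d -> `|gs j y - gs j z| <= t].
Proof.
move=> gsc t0.
have /choice[b Hb] : forall j, exists b : R, 0 < b /\ forall y, `|gs j y| <= b.
  by move=> j; have [b b0 H] := continuous_bounded Xcompact (@gsc j); exists b.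
have /choice[d Hd] : forall j, exists d : R, 0 < d /\
    forall y z, mdist y z < d -> `|gs j y - gs j z| < t.
  by move=> j; have [d d0 H] := unif_cont_real Xcompact (@gsc j) t0; exists d.
have [d0 d00 Hd0] := @min_seq R _ (enum 'I_k) d (fun j => (Hd j).1).
exists (\sum_j b j), d0; split => //.
- by apply: sumr_ge0 => j _; apply: ltW; case: (Hb j).
- move=> j y; rewrite (le_trans ((Hb j).2 y))// (bigD1 j)//= lerDl sumr_ge0// => i _.
  by apply: ltW; case: (Hb i).
- move=> j y z yz; apply: ltW; apply: (Hd j).2; apply: lt_le_trans yz _.
  by apply: Hd0; rewrite mem_enum.
Qed.

Lemma Hl_word_refine (nu : Mp) (K J : finType) (h : K -> J) (l : X -> K) n : mlab l ->
  Hl nu (word f (h \o l) n) <= Hl nu (word f l n).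
Proof.
move=> ml; pose hw (w : {ffun 'I_n -> K}) : {ffun 'I_n -> J} := [ffun i => h (w i)].
have -> : word f (h \o l) n = hw \o word f l n.
  by apply/funext => x; apply/ffunP => i; rewrite !ffunE.
by apply: Hl_refine; exact: mlab_word.
Qed.

Lemma lower_bound (nu : Mp) (U : set Mp) (k : nat) (gs : 'I_k -> X -> R) (e s : R)
    (m : nat) (P : 'I_m -> set X) :
  Minv f nu -> (forall j, continuous (gs j)) -> 0 < e ->
  (forall mu, Minv f mu ->
     (forall j, (`| integ mu (gs j) - integ nu (gs j) | < e%:E)%E) -> U mu) ->
  is_partition P -> s < hpart f nu P ->
  (s%:E <= hBowen f (Dsub f U))%E.
Proof.
move=> inv gsc e0 HU partP sh.
have [l0 [ml0 PE]] := partition_label partP.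
have [hle _] := hpart_label fcont inv ml0 PE.
set hh := hpart f nu P in sh hle.
pose eta := (hh - s) / 8.
have eta0 : 0 < eta by rewrite divr_gt0// subr_gt0.
have hhE : hh = s + 8 * eta by rewrite /eta; field.
(* [traced_Dsub] asks for [4 * te < e], and [typical_blocks] delivers deviations of [8 * tau]. *)
pose te := e / 5; have te0 : 0 < te by rewrite divr_gt0.
have te4 : 4 * te < e by rewrite /te; lra.
pose tau := te / 8; have tau0 : 0 < tau by rewrite divr_gt0.
have tau8 : 8 * tau = te by rewrite /tau; field.
have taule : tau <= te by lra.
have [B [d [B0 d0 gB gd]]] := common_modulus gsc tau0.
have [q [lq [mlq lqs]]] := small_label Xcompact d0.
(* The given partition provides the entropy; the fine one makes the functions [gs] nearly constant
   on each label. *)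
pose A : finType := ('I_m * 'I_q)%type.
pose la x : A := (l0 x, lq x).
have mla : mlab la by exact: mlab_pair.
pose S : finType := option (A * bool).
pose sg : R := #|S|%:R.
have sg0 : 0 < sg by rewrite ltr0n; apply/card_gt0P; exists None.
(* With this weight the special letters raise the count by at most a factor [1 + eta / 4] per
   position. Each special position costs a factor of at most [expR kap], and [gam] makes these
   positions rare enough. *)
pose th := eta / (4 * sg); have th0 : 0 < th by rewrite divr_gt0// mulr_gt0.
pose kap := `|ln th|; have kap0 : 0 <= kap by exact: normr_ge0.
pose gam := Num.min 6^-1 (eta / (3 * kap + 3 * `|s| + 1)).
have D0 : 0 < 3 * kap + 3 * `|s| + 1 by have := normr_ge0 s; lra.
have gam0 : 0 < gam by rewrite lt_min invr_gt0 ltr0n divr_gt0.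
have gam6 : gam <= 6^-1 by rewrite ge_min lexx.
have gamE : gam * (3 * kap + 3 * `|s| + 1) <= eta.
  by rewrite -ler_pdivlMr// ge_min lexx orbT.
have [K [cK Kl mlab_lab bad]] := closed_cores nu mla gam0.
set lab := (fun x => (la x, `[< K (la x) x >])) in mlab_lab bad.
have [e1 e10 Hsep] := cores_separated Xcompact cK Kl.
(* Two core points within [2 * eps] of the same point are less than [e1] apart and thus in the same
   core; [eps < d] controls the functions [gs] under tracing. *)
pose eps := Num.min (e1 / 4) (d / 2).
have eps0 : 0 < eps by rewrite lt_min !divr_gt0.
have epsl : eps <= e1 / 4 by rewrite ge_min lexx.
have epsr : eps <= d / 2 by rewrite ge_min lexx orbT.
have eps1 : 4 * eps <= e1 by lra.
have epsd : eps < d by lra.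
have [delta [delta0 Htrace]] := ftrace eps0.
have [M HM] := bounded_loops Xcompact fcont ftrans delta0.
(* A word length beyond [C0] makes the connections and [p0] negligible, both in length and in their
   effect on the sums of the [gs]. *)
pose C0 : R := (2 * M + 1)%:R / gam + (2 * M + 1)%:R * (2 * B) / tau.
have C00 : 0 <= C0.
  by rewrite addr_ge0// divr_ge0 ?(ltW gam0) ?(ltW tau0)// !mulr_ge0.
pose n := (Num.truncn C0).+1.
have Cn : C0 <= n%:R by have /andP[_ /ltW] := truncn_itv C00.
have nM : (2 * M + 1)%:R <= gam * n%:R.
  rewrite mulrC -ler_pdivrMr//; apply: le_trans Cn; rewrite /C0 lerDl.
  by rewrite divr_ge0 ?(ltW tau0)// !mulr_ge0.
have nMB : (2 * M + 1)%:R * (2 * B) <= tau * n%:R.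
  rewrite -ler_pdivrMl//; apply: le_trans Cn; rewrite /C0 [tau^-1 * _]mulrC lerDr.
  by rewrite divr_ge0// ltW.
have n0 : (0 < n)%N by [].
pose W : finType := {ffun 'I_n -> A * bool}.
(* A word of positive measure is the itinerary of some point; for words without such a point [xw] is
   arbitrary. *)
have /choice[xw Hx] : forall w : W, exists x,
    0 < pr nu (word f lab n @^-1` [set w]) -> word f lab n x = w.
  move=> w; have [[x Hx]|nx] := pselect (exists x, word f lab n x = w); first by exists x.
  exists point; rewrite (_ : _ @^-1` _ = set0) ?pr0 ?ltxx//.
  by rewrite -subset0 => x Hx; apply: nx; exists x.
pose p0 : X := point.
have /choice[uv Huv] : forall w : W, exists uv : seq X * seq X,
    [/\ (size uv.1 <= M)%N, (size uv.2 <= M)%N &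
    isloop f delta p0 (p0 :: uv.1 ++ traject f (xw w) n ++ uv.2)].
  by move=> w; have [u [v H]] := HM p0 (xw w) n n0; exists (u, v).
pose u w := (uv w).1; pose v w := (uv w).2.
have uM w : (size (u w) <= M)%N by case: (Huv w).
have vM w : (size (v w) <= M)%N by case: (Huv w).
have gt j y z : lab y = lab z -> `|gs j y - gs j z| <= tau.
  by move=> yz; apply: gd; apply: lqs; exact: (congr1 (fun c : A * bool => c.1.2) yz).
have Hh : n%:R * hh <= Hl nu (word f lab n).
  have := hle n.-1; rewrite ler_pdivlMr ?ltr0n// mulrC => /le_trans; apply.
  exact: (@Hl_word_refine nu _ _ (fun c : A * bool => c.1.1) lab n mlab_lab).
have [s0 [t [[t0 s0n] s0w LtN Dn [avg lnN]]]] :=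
  typical_blocks Xcompact fcont p0 inv mlab_lab n0 Hx uM vM gsc gB B0 tau0 gt gam0 gam6
    bad nM nMB Hh eta0.
set blk := block f p0 xw u v in LtN avg.
set sy := sym u v in Dn.
pose T : finType := seq_sub (permutations s0).
pose Lam := size (flatten [seq blk w | w <- s0]).
pose bT (a : T) := flatten [seq blk w | w <- ssval a].
pose F (a : T) : seq S := flatten [seq sy w | w <- ssval a].
have perm_a (a : T) : perm_eq (ssval a) s0.
  by rewrite -mem_permutations; exact: valP a.
have sb a : size (bT a) = Lam.
  by apply: perm_size; apply: perm_flatten; apply: perm_map; exact: perm_a.
have sF a : size (F a) = Lam by rewrite /F (size_blocks f p0 xw); exact: sb.
have Lam0 : (0 < Lam)%N.
  by rewrite /Lam; case: (s0) s0n.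
have lb a : isloop f delta p0 (bT a).
  by apply: isloop_flatten => w _; case: (Huv w).
have tracing (sigma : nat -> T) : exists x, forall i,
    mdist (iter i f x) (concat p0 Lam bT sigma i) < eps.
  by apply: Htrace; exact: concat_pseudo_orbit.
have T0 : T by exact: (@SeqSub _ (permutations s0) s0 (introT idP (etrans (mem_permutations _ _) (perm_refl _)))).
have sub : traced f p0 Lam bT eps `<=` Dsub f U.
  apply: (traced_Dsub Xcompact fcont Lam0 sb gsc te0 _ HU gB) => [|j y z yz|j a].
  - exact: te4.
  - by apply: le_trans (gd j y z _) taule; exact: le_lt_trans epsd.
  - have := avg j; rewrite -/Lam tau8.
    rewrite /bT; congr (`|_ - _| <= _); apply: perm_big.
    by apply: perm_flatten; apply: perm_map; rewrite perm_sym; exact: perm_a.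
have TE : #|T|%:R = (size (permutations s0))%:R :> R.
  by rewrite card_seq_sub// permutations_uniq.
have Tpos : 0 < (#|T|%:R : R) by rewrite ltr0n; apply/card_gt0P; exists T0.
have frac z : #|compat f p0 Lam bT eps z|%:R <= expR (- (s * Lam%:R)) * #|T|%:R.
  (* By separation [g i] is the only core letter of a point within [2 * eps] of the [i]-th iterate
     of [z]; every other letter compatible there is special. *)
  have /choice[g Hg] : forall i, exists c : S, forall a y, K a y ->
      mdist (iter i f z) y < 2 * eps -> c = Some (a, true).
    move=> i; have [[a [y [Ky zy]]]|na] :=
      pselect (exists a y, K a y /\ mdist (iter i f z) y < 2 * eps).
      exists (Some (a, true)) => a' y' Ky' zy'; congr (Some (_, true)).
      apply: (Hsep _ _ _ _ Ky Ky').
      apply: le_lt_trans (mdist_tri y (iter i f z) y') _; rewrite mdist_symm.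
      apply: lt_le_trans eps1; rewrite (_ : 4 * eps = 2 * eps + 2 * eps) ?ltrD//; ring.
    by exists None => a y Ky zy; exfalso; apply: na; exists a, y.
  pose Dt := count (@special A) (flatten [seq sy w | w <- s0]).
  have := @compat_count R T S None (@special A) Lam Dt F (compat f p0 Lam bT eps z) g th th0 sF.
  move=> /(_ _ _ _)/le_trans; apply.
  - move=> a a' /(sym_inj n0) e'; apply: val_inj; apply: e'.
    by rewrite (perm_size (perm_a a)) (perm_size (perm_a a')).
  - move=> a _; apply/permP; apply: perm_flatten; apply: perm_map; exact: perm_a.
  - move=> a i /forallP Ca iL; have /= Hi := Ca (Ordinal iL).
    case E : (nth None (F a) i) => [[c []]|]; [right|by left|by left].
    rewrite (Hg i c _ _ Hi)//.
    have HL : lab (nth p0 (bT a) i) = (c, true).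
      apply: (@label_blocks _ _ f A lab n p0 xw u v (ssval a) i (c, true) _ E).
      by move=> w; rewrite (perm_mem (perm_a a)); exact: s0w.
    have lac := congr1 (@fst A bool) HL; have /asboolP := congr1 (@snd A bool) HL.
    by rewrite /= in lac; rewrite /= lac.
  have spS : #|@special A|%:R <= sg by rewrite ler_nat max_card.
  apply: (@weighted_count_le R th kap gam s eta hh (t%:R * n%:R)) => //.
  - apply: (@le_trans _ _ (sg * th)); first by rewrite ler_wpM2r// ltW.
    by rewrite /th le_eqVlt; apply/orP; left; apply/eqP; field; rewrite gt_eqF.
  - exact: ltW.
  - by rewrite TE.
apply: le_trans (hBowen_ge _ _ eps0).
apply: le_trans (htop_leZ _ _ sub).
exact: (traced_entropy Xcompact fcont Lam0 tracing frac T0).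
Qed.

End LowerBound.

Theorem theorem2p1 (R : realType) (X : pointedMetricType R) (f : X -> X)
  (Xcompact : compact [set: X]) (fcont : continuous f)
  (ftrans : top_transitive f) (ftrace : tracing_property f)
  (U : set (@Mprob R X)) (Uopen : weak_open_inv f U) (Une : U !=set0) :
  hBowen f (Dsub f U) = ereal_sup [set hmeas f nu | nu in U] /\
  hBowen f (Dcap f U) = ereal_sup [set hmeas f nu | nu in U].
Proof.
have [UM Uo] := Uopen.
set S := ereal_sup _.
(* [V(x)] contained in [U] also meets [U], since [V(x)] is nonempty. *)
have sub_cap : (hBowen f (Dsub f U) <= hBowen f (Dcap f U))%E.
  apply: hBowen_leZ => x xU; have [mu Vmu] := Vlim_nonempty Xcompact f x.
  by exists mu; split => //; exact: xU.
have S0 : (0 <= S)%E.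
  have [nu Unu] := Une; apply: (le_trans (hmeas_ge0 fcont (UM _ Unu))).
  by apply: ereal_sup_ubound; exists nu.
have up : (hBowen f (Dcap f U) <= S)%E.
  have HS nu : U nu -> (hmeas f nu <= S)%E.
    by move=> Unu; apply: ereal_sup_ubound; exists nu.
  case: (S) S0 HS => [t|_ _|] //; last by rewrite leey.
  rewrite lee_fin => t0 HS; apply: (upper_bound Xcompact fcont t0) => x [nu [Vnu Unu]].
  by exists nu; split; [|exact: UM|exact: HS].
have low : (S <= hBowen f (Dsub f U))%E.
  apply: ge_ereal_sup => _ [nu Unu <-]; apply: ge_ereal_sup => _ [m [P [partP ->]]].
  have [k [gs [e [gsc [e0 HU]]]]] := Uo nu Unu.
  (* [lower_bound] asks for a rate strictly below the entropy of the partition. *)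
  apply/lee_subgt0Pr => r r0; rewrite -EFinB.
  apply: (lower_bound Xcompact fcont ftrans ftrace (UM _ Unu) gsc e0 HU partP).
  by rewrite ltrBlDr ltrDl.
split; apply/eqP; rewrite eq_le.
- by rewrite low andbT (le_trans sub_cap up).
- by rewrite up (le_trans low sub_cap).
Qed.
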